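(* Let $K$ be a measurable kernel on $\mathbb{R}^N$ with $K(x)=K(-x)\ge 0$ for every $x\in\mathbb{R}^N$, satisfying one of the following two assumptions: (Fractional type) $\min\{1,|h|\}\,K(h)\in L^1(\mathbb{R}^N)$, and there exist $C>0$ and $s\in(0,1)$ such that $K(h)\ge C|h|^{-N-s}$; (Integrable type) $K\in L^1(\mathbb{R}^N)$ with $\|K\|_1>0$, and $\liminf_{z\to 0}\big[K(z)-K(z+x)\big]>0$ for every $x\neq 0$. Then for any given $m>0$ there exist a lattice $G\in\mathcal{G}_m$ and a fundamental domain $D\in\mathcal{D}_G$ such that $$\mathrm{Per}_K(D)=\min_{G'\in\mathcal{G}_m,\;E\in\mathcal{D}_{G'}}\mathrm{Per}_K(E).$$
   Context: A lattice is a discrete subgroup $G$ of $(\mathbb{R}^N,+)$ of rank $N$. Its volume $d(G)\in(0,+\infty)$ is the absolute value of the determinant of the matrix of any set of generators $(v_1,\dots,v_N)$ of $G$ as a $\mathbb{Z}$-module. For $m\in(0,+\infty)$, $\mathcal{G}_m$ is the family of lattices $G$ with $d(G)=m$. A measurable set $D\subset\mathbb{R}^N$ is a fundamental domain for $G$ if $\big|\mathbb{R}^N\setminus\bigcup_{g\in G}(D+g)\big|=0$ and $|D\cap(D+g)|=0$ for all $g\in G\setminus\{0\}$, where $|\cdot|$ is Lebesgue measure; $\mathcal{D}_G$ denotes the set of all fundamental domains for $G$. The nonlocal perimeter of a measurable set $E$ is $$\mathrm{Per}_K(E):=\int_E\int_{\mathbb{R}^N\setminus E}K(x-y)\,dx\,dy\in[0,+\infty].$$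 *)

(* Defs.v *)
From HB Require Import structures.
From mathcomp Require Import all_boot all_order all_algebra.
From mathcomp Require Import all_classical all_reals all_analysis.

Set Implicit Arguments.
Unset Strict Implicit.
Unset Printing Implicit Defensive.

Import Order.TTheory GRing.Theory Num.Theory.
Import numFieldNormedType.Exports.

Local Open Scope classical_set_scope.
Local Open Scope ring_scope.

(** R^N is ['rV[R]_N] with the library's topology. Its Borel sigma-algebra is
    the one generated by the coordinates; the Borel-Lebesgue measure is the
    iterated product of the one-dimensional one, and the Lebesgue measure (hence
    the Lebesgue-measurable sets and functions) is its completion. *)

Definition rV_display : measure_display.
Proof. exact: default_measure_display. Qed.

Section borel_rV.
Variables (R : realType) (n : nat).

Definition coord_rV (i : 'I_n) (v : 'rV[R]_n) : measurableTypeR R := v ord0 i.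

Definition borel_rV : set (set 'rV[R]_n) := g_sigma_preimage coord_rV.

Let borel_rV0 : borel_rV set0.
Proof. exact: sigma_algebra0. Qed.

Let borel_rVC A : borel_rV A -> borel_rV (~` A).
Proof. exact: sigma_algebraC. Qed.

Let borel_rV_bigcup (F : (set 'rV[R]_n)^nat) :
  (forall i, borel_rV (F i)) -> borel_rV (\bigcup_i (F i)).
Proof. exact: sigma_algebra_bigcup. Qed.

HB.instance Definition _ := @isMeasurable.Build rV_display 'rV[R]_n borel_rV
  borel_rV0 borel_rVC borel_rV_bigcup.

End borel_rV.

Lemma measurable_coord_rV (R : realType) n (i : 'I_n) :
  measurable_fun [set: 'rV[R]_n] (@coord_rV R n i).
Proof.
move=> _ Y mY; rewrite setTI; apply: sub_sigma_algebra => /=.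
rewrite -bigcup_seq/=; exists i => /=; first by rewrite mem_index_enum.
by exists Y => //; rewrite setTI.
Qed.

Lemma measurable_fun_rVP d (T : measurableType d) (R : realType) n
    (f : T -> 'rV[R]_n) :
  (forall i, measurable_fun [set: T] (@coord_rV R n i \o f)) ->
  measurable_fun [set: T] f.
Proof.
move=> mf _ A mA; rewrite setTI.
have : (<<s preimage_set_system setT f
   (\big[setU/set0]_(i < n) preimage_set_system setT (@coord_rV R n i)
      measurable) >>) (f @^-1` A).
  rewrite g_sigma_preimageE; exists A => //; by rewrite setTI.
apply: smallest_sub; first exact: sigma_algebra_measurable.
move=> _ [B + <-]; rewrite -bigcup_seq => -[i _ [C mC <-]].
have := mf i measurableT _ mC; by rewrite !setTI.
Qed.

Section lebesgue_rV.
Variable R : realType.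

Definition cons_rV n (p : measurableTypeR R * 'rV[R]_n) : 'rV[R]_n.+1 :=
  row_mx p.1%:M p.2.

Definition uncons_rV n (v : 'rV[R]_n.+1) : measurableTypeR R * 'rV[R]_n :=
  (v ord0 ord0, \row_j v ord0 (lift ord0 j)).

Lemma coord_cons_rV0 n p : @cons_rV n p ord0 ord0 = p.1.
Proof.
rewrite /cons_rV (_ : ord0 = lshift n (ord0 : 'I_1)); last exact/val_inj.
by rewrite (@row_mxEl _ 1 1 n) !mxE eqxx mulr1n.
Qed.

Lemma coord_cons_rVS n p j : @cons_rV n p ord0 (lift ord0 j) = p.2 ord0 j.
Proof.
rewrite /cons_rV (_ : lift ord0 j = rshift 1 j); last exact/val_inj.
by rewrite (@row_mxEr _ 1 1 n).
Qed.

Lemma cons_rVK n : cancel (@cons_rV n) (@uncons_rV n).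
Proof.
move=> [x v]; rewrite /uncons_rV coord_cons_rV0; congr pair.
by apply/rowP => j; rewrite mxE coord_cons_rVS.
Qed.

Lemma measurable_cons_rV n : measurable_fun [set: _] (@cons_rV n).
Proof.
apply: measurable_fun_rVP => i; have [j|] := unliftP ord0 i => ->.
- rewrite (_ : _ \o _ = @coord_rV R n j \o snd); last first.
    by apply/funext => p /=; rewrite /coord_rV coord_cons_rVS.
  by apply: measurableT_comp => //; exact: measurable_coord_rV.
- rewrite (_ : _ \o _ = fst) //.
  by apply/funext => p /=; rewrite /coord_rV coord_cons_rV0.
Qed.

Lemma measurable_uncons_rV n : measurable_fun [set: _] (@uncons_rV n).
Proof.
apply: measurable_fun_pair => /=; first exact: (measurable_coord_rV ord0).
apply: measurable_fun_rVP => i.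
rewrite (_ : _ \o _ = coord_rV (lift ord0 i)); first exact: measurable_coord_rV.
by apply/funext => v /=; rewrite /coord_rV mxE.
Qed.

Section step.
Local Open Scope ereal_scope.
Variables (n : nat) (mu : {sigma_finite_measure set 'rV[R]_n -> \bar R}).

Definition cons_measure : set 'rV[R]_n.+1 -> \bar R :=
  pushforward (@lebesgue_measure R \x mu) (@cons_rV n).

Let mcons A : measurable A -> measurable (@cons_rV n @^-1` A).
Proof. by move=> mA; rewrite -[X in measurable X]setTI; exact: measurable_cons_rV. Qed.

Let cons_measure0 : cons_measure set0 = 0.
Proof. by rewrite /cons_measure /pushforward preimage_set0 measure0. Qed.

Let cons_measure_ge0 A : 0 <= cons_measure A.
Proof. exact: (measure_ge0 (@lebesgue_measure R \x mu)). Qed.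

Let cons_measure_sigma_additive : semi_sigma_additive cons_measure.
Proof.
move=> F mF tF mUF; rewrite /cons_measure /pushforward preimage_bigcup.
apply: measure_semi_sigma_additive; first by move=> k; exact: mcons.
- apply/trivIsetP => i j _ _ ij; rewrite -preimage_setI.
  by move/trivIsetP : tF => /(_ _ _ _ _ ij) ->//; rewrite preimage_set0.
- by rewrite -preimage_bigcup; exact: mcons.
Qed.

HB.instance Definition _ := isMeasure.Build _ _ _ cons_measure
  cons_measure0 cons_measure_ge0 cons_measure_sigma_additive.

Let cons_measure_sigma_finite : sigma_finite setT cons_measure.
Proof.
have /sigma_finiteP[F [FT ndF Foo]] := sigma_finiteT (@lebesgue_measure R).
have /sigma_finiteP[G [GT ndG Goo]] := sigma_finiteT mu.
exists (fun k => @uncons_rV n @^-1` (F k `*` G k)).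
  apply/esym; rewrite -subTset => v _ /=.
  have [i _ Fi] : (\bigcup_i F i) (uncons_rV v).1 by rewrite -FT.
  have [j _ Gj] : (\bigcup_j G j) (uncons_rV v).2 by rewrite -GT.
  exists (maxn i j) => //; split.
  - by move: Fi; exact/subsetPset/ndF/leq_maxl.
  - by move: Gj; exact/subsetPset/ndG/leq_maxr.
move=> k; have [mF Fk] := Foo k; have [mG Gk] := Goo k.
have mFG : measurable (F k `*` G k) by exact: measurableX.
split.
  by rewrite -[X in measurable X]setTI; exact: measurable_uncons_rV.
rewrite /cons_measure /pushforward -comp_preimage.
rewrite (_ : _ \o _ = id); last by apply/funext; exact: cons_rVK.
by rewrite preimage_id product_measure1E// lte_mul_pinfty// ge0_fin_numE.
Qed.

HB.instance Definition _ := Measure_isSigmaFinite.Build _ _ _ cons_measure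
  cons_measure_sigma_finite.

End step.

Fixpoint borel_lebesgue_measure n :
    {sigma_finite_measure set 'rV[R]_n -> \bar R} :=
  if n is k.+1 then cons_measure (borel_lebesgue_measure k)
  else dirac (0 : 'rV[R]_0).

(** The carrier R^N endowed with the Lebesgue sigma-algebra. *)
Definition lebesgueRV n : Type :=
  caratheodory_type ((borel_lebesgue_measure n)^*)%mu.
HB.instance Definition _ n := Measurable.on (lebesgueRV n).

Definition lebesgue_rV n : set (lebesgueRV n) -> \bar R :=
  @completed_measure_extension _ _ _ (borel_lebesgue_measure n).
HB.instance Definition _ n := Measure.on (@lebesgue_rV n).

Let lebesgue_rV_sigma_finite n : sigma_finite setT (@lebesgue_rV n).
Proof. exact/completed_measure_extension_sigma_finite/sigma_finiteT. Qed.

HB.instance Definition _ n := Measure_isSigmaFinite.Build _ _ _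
  (@lebesgue_rV n) (@lebesgue_rV_sigma_finite n).

End lebesgue_rV.

Arguments lebesgue_rV {R n}.

Section lattices.
Variables (R : realType) (N : nat).
Implicit Types (G D E : set 'rV[R]_N) (K : 'rV[R]_N -> R).

(** The library's norm on ['rV[R]_N] is the sup norm, not the Euclidean one. *)
Definition enorm (x : 'rV[R]_N) : R := Num.sqrt (\sum_i x ord0 i ^+ 2).

Definition subgroup G := G 0 /\ forall x y, G x -> G y -> G (x - y).

Definition Zindependent r (v : 'I_r -> 'rV[R]_N) :=
  forall a : 'I_r -> int, \sum_i v i *~ a i = 0 -> forall i, a i = 0.

(** [G] has rank [r] as an abelian group. *)
Definition has_rank G (r : nat) :=
  (exists v : 'I_r -> 'rV[R]_N, (forall i, G (v i)) /\ Zindependent v) /\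
  (forall v : 'I_r.+1 -> 'rV[R]_N, (forall i, G (v i)) -> ~ Zindependent v).

Definition lattice G := [/\ subgroup G, G `<=` isolated G & has_rank G N].

Definition Zspan_rows (V : 'M[R]_N) : set 'rV[R]_N :=
  [set \sum_i row i V *~ a i | a in [set: 'I_N -> int]].

(** [get] selects an arbitrary generating matrix; on a lattice the value does
    not depend on it, two such matrices differing by an element of GL_N(Z). *)
Definition covolume G : R := `|\det (get [set V | Zspan_rows V = G])|.

Definition lattices_of_volume (m : R) : set (set 'rV[R]_N) :=
  [set G | lattice G /\ covolume G = m].

Definition translate D (g : 'rV[R]_N) : set 'rV[R]_N := [set x + g | x in D].

Definition fundamental_domains G : set (set 'rV[R]_N) :=
  [set D | [/\ measurable (D : set (lebesgueRV R N)),
    lebesgue_rV (~` \bigcup_(g in G) translate D g) = 0%E &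
    forall g, G g -> g != 0 -> lebesgue_rV (D `&` translate D g) = 0%E]].

Definition nonlocal_perimeter K E : \bar R :=
  (\int[lebesgue_rV]_(y in E) \int[lebesgue_rV]_(x in ~` E) (K (x - y))%:E)%E.

Definition symmetric_kernel K :=
  measurable_fun [set: lebesgueRV R N] (K : lebesgueRV R N -> R) /\
  forall x, K x = K (- x) /\ 0 <= K x.

Definition fractional_type K :=
  lebesgue_rV.-integrable setT
    (fun h : lebesgueRV R N => (Num.min 1 (enorm h) * K h)%:E) /\
  exists C s : R, [/\ 0 < C, 0 < s < 1 &
    forall h, h != 0 -> C * enorm h `^ (- N%:R - s) <= K h].

Definition integrable_type K :=
  [/\ lebesgue_rV.-integrable setT (EFin \o (K : lebesgueRV R N -> R)),
    (0 < 'N[lebesgue_rV]_1 [EFin \o (K : lebesgueRV R N -> R)])%E &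
    forall x, x != 0 ->
      (0 < limf_einf (fun z => (K z - K (z + x))%:E) (0%R : 'rV[R]_N)^')%E].

End lattices.

(* Main.v *)
(* Replace a fundamental domain of the lattice of [V] by a function [f] with values in [0,1]
   whose periodization is 1, and let J(f) be the integral of f(x) f(y) K(x - y) and Per(f) that
   of f(x) (1 - f(y)) K(x - y), so that Per(f) = m |K|_1 - J(f) when K is integrable.

   Existence of a relaxed minimiser. Take a minimising sequence. A short lattice vector spreads
   the mass of [f] and makes J small, so the lattices have bounded bases and, after a linear
   change of variables, one may assume that they converge. Mass can escape to infinity, but
   recentring at lattice points along an ultrafilter gives countably many limit profiles; as
   the recentring does not affect the periodization, their sum is again at most 1 when
   periodized. Interactions between different profiles only increase J, and mass which is
   captured by no profile does not contribute, so J of the sum is at least the limit of J for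
   every simple kernel below K. The sum is a relaxed packing; filling it up to a relaxed domain
   gives a minimiser.

   A minimiser is a set. Suppose that [f] overlaps its translate by a lattice vector w, so that
   e <= f <= 1 - e on some small set A and on A + w. If K is of fractional type, A alone makes
   Per(f) infinite. If K is integrable, Per is concave along the exchange of mass between A and
   A + w, strictly so because K(z) > K(z + w) for small z, so one of the two exchanges lowers
   Per. *)

Require Import Defs.
From HB Require Import structures.
From mathcomp Require Import all_boot all_order all_algebra.
From mathcomp Require Import all_classical all_reals all_analysis.
From mathcomp Require Import perm measurable_realfun ring lra.

Set Implicit Arguments.
Unset Strict Implicit.
Unset Printing Implicit Defensive.

Import Order.TTheory GRing.Theory Num.Theory.
Import numFieldNormedType.Exports.

Local Open Scope classical_set_scope.
Local Open Scope ring_scope.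

(** * Lebesgue measure and linear maps *)

(** A weak limit of sets is only a function, which is why sets are relaxed at all; the constraint is
    stated through integrals over invariant sets because this form is linear and passes to limits.
    The identity relating Per to J is used only through m |k|_1 <= J_k(f) + Per_K(f), for simple
    kernels k <= K of bounded support. No infinite quantity is subtracted, so a single existence
    argument serves both types of kernel, and the bounded range of k reduces every limit to bounded
    sets. What keeps the limit from being trivial is one competitor with Per < m |K|_1: some k then
    has J_k bounded below along the minimising sequence, which rules out short lattice vectors. For
    a singular kernel |K|_1 is infinite and finite perimeter is enough; for an integrable one a
    parallelepiped has J > 0. If every perimeter is infinite, any domain is a minimiser. Kernel and
    competitors are only Lebesgue measurable, whereas Fubini and the changes of variables are
    carried out for Borel functions; both are therefore replaced by Borel versions off null sets. *)

Section image_measure.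
Context d d' (T1 : measurableType d) (T2 : measurableType d') (R : realType).
Variables (m : {measure set T1 -> \bar R}) (f : T1 -> T2).
Hypothesis mf : measurable_fun [set: T1] f.

(* Carries the measurability proof, which the instance for [pushforward] leaves
   as an unresolved hypothesis. *)
Definition image_measure of measurable_fun [set: T1] f := pushforward m f.

Let image_measure0 : image_measure mf set0 = 0%E.
Proof. by rewrite /image_measure /pushforward preimage_set0 measure0. Qed.

Let image_measure_ge0 A : (0 <= image_measure mf A)%E.
Proof. exact: measure_ge0. Qed.

Let image_measure_sigma_additive : semi_sigma_additive (image_measure mf).
Proof.
move=> F mF tF mUF; rewrite /image_measure /pushforward preimage_bigcup.
apply: measure_semi_sigma_additive.
- by move=> n; rewrite -[X in measurable X]setTI; exact: mf.
- apply/trivIsetP => /= i j _ _ ij; rewrite -preimage_setI.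
  by move/trivIsetP : tF => /(_ _ _ _ _ ij) ->//; rewrite preimage_set0.
- by rewrite -preimage_bigcup -[X in measurable X]setTI; exact: mf.
Qed.

HB.instance Definition _ := isMeasure.Build _ _ _ (image_measure mf)
  image_measure0 image_measure_ge0 image_measure_sigma_additive.

End image_measure.

Section lebesgue_line.
Variable R : realType.
Local Open Scope ereal_scope.

(** Both sides are measures of [A] that agree on the intervals []c, d]], and these determine
    Lebesgue measure. *)
Lemma lebesgue_measure_affine_gt0 (a b : R) (A : set (measurableTypeR R)) :
  (0 < a)%R -> measurable A ->
  a%:E * lebesgue_measure ((fun x : measurableTypeR R => a * x + b)%R @^-1` A) =
  lebesgue_measure A.
Proof.
move=> a0 mA.
have mphi : measurable_fun [set: measurableTypeR R]
    (fun x : measurableTypeR R => (a * x + b)%R : measurableTypeR R).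
  apply: measurable_funD => //; exact: measurable_funM.
rewrite -[LHS]/(mscale (NngNum (ltW a0)) (image_measure (@lebesgue_measure R) mphi) A).
apply/esym/lebesgue_measure_unique => // _ [[c d]] _ <-.
rewrite /= /mscale /image_measure /pushforward/=.
rewrite (_ : _ @^-1` _ = `](c - b) / a, (d - b) / a]%classic)%R; last first.
  apply/seteqP; split => x /=; rewrite !in_itv/= => /andP[].
    by rewrite ltr_pdivrMr// ler_pdivlMr// => h1 h2; apply/andP; split; lra.
  by rewrite ltr_pdivrMr// ler_pdivlMr// => h1 h2; apply/andP; split; lra.
rewrite !lebesgue_measure_itv/= !lte_fin.
have -> : ((c - b) / a < (d - b) / a)%R = (c < d)%R.
  by rewrite ltr_pM2r ?invr_gt0// ltrD2r.
case: ifPn => _; last by rewrite mule0.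
by rewrite -!EFinB -EFinM; congr EFin; field; rewrite gt_eqF.
Qed.

Lemma lebesgue_measure_affine (a b : R) (A : set (measurableTypeR R)) :
  a != 0%R -> measurable A ->
  `|a|%:E * lebesgue_measure ((fun x : measurableTypeR R => a * x + b)%R @^-1` A) =
  lebesgue_measure A.
Proof.
move=> a0 mA; have [ap|ap|ae] := ltgtP a 0%R; last by rewrite ae eqxx in a0.
- rewrite ltr0_norm// -[RHS](@lebesgue_measure_affine_gt0 (- a) b)//; last by rewrite oppr_gt0.
  congr (_ * _); rewrite -[LHS]lebesgue_measureN.
    by congr lebesgue_measure; apply/seteqP; split => x /=; rewrite mulrN mulNr.
  rewrite -[X in measurable X]setTI; apply: (_ : measurable_fun _ _) => //.
  by apply: measurable_funD => //; exact: measurable_funM.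
- by rewrite gtr0_norm//; exact: lebesgue_measure_affine_gt0.
Qed.

End lebesgue_line.

Section fibers.
Context d1 d2 (T1 : measurableType d1) (T2 : measurableType d2) (R : realType).
Variables (m1 : {sigma_finite_measure set T1 -> \bar R})
  (m2 : {sigma_finite_measure set T2 -> \bar R}).
Local Open Scope ereal_scope.

Lemma product_measure_ysection (A : set (T1 * T2)) : measurable A ->
  (m1 \x m2) A = \int[m2]_y m1 (ysection A y).
Proof.
move=> mA; rewrite -[LHS]/(\int[m1]_x _).
have := @indic_fubini_tonelli _ _ _ _ _ m1 m2 A mA.
rewrite indic_fubini_tonelli_FE// indic_fubini_tonelli_GE//.
Qed.

(** By Fubini, a map acting inside the fibres and scaling the measure by the same factor on each of
    them scales the product measure by that factor. Translations and elimination steps are composed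
    of such maps. *)
Lemma product_measure_preimage2 (phi : T1 -> T2 -> T2) (c : R) (A : set (T1 * T2)) :
  measurable A -> (0 <= c)%R ->
  (forall x X, measurable X -> c%:E * m2 (phi x @^-1` X) = m2 X) ->
  measurable ((fun p => (p.1, phi p.1 p.2)) @^-1` A) ->
  c%:E * (m1 \x m2) ((fun p => (p.1, phi p.1 p.2)) @^-1` A) = (m1 \x m2) A.
Proof.
move=> mA c0 phiP mB; rewrite /product_measure1/= -ge0_integralZl//.
- apply: eq_integral => x _; rewrite /= -[RHS](phiP x); last exact: measurable_xsection.
  congr (_ * m2 _); apply/seteqP; split => y; rewrite /xsection/= !inE//.
- exact: measurable_fun_xsection.
Qed.

Lemma product_measure_preimage1 (phi : T2 -> T1 -> T1) (c : R) (A : set (T1 * T2)) :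
  measurable A -> (0 <= c)%R ->
  (forall y X, measurable X -> c%:E * m1 (phi y @^-1` X) = m1 X) ->
  measurable ((fun p => (phi p.2 p.1, p.2)) @^-1` A) ->
  c%:E * (m1 \x m2) ((fun p => (phi p.2 p.1, p.2)) @^-1` A) = (m1 \x m2) A.
Proof.
move=> mA c0 phiP mB; rewrite !product_measure_ysection// -ge0_integralZl//.
- apply: eq_integral => x _; rewrite /= -[RHS](phiP x); last exact: measurable_ysection.
  congr (_ * m1 _); apply/seteqP; split => y; rewrite /ysection/= !inE//.
- exact: measurable_fun_ysection.
Qed.

End fibers.

Lemma measurable_preimageT d1 d2 (T1 : measurableType d1) (T2 : measurableType d2)
    (f : T1 -> T2) (A : set T2) :
  measurable_fun [set: T1] f -> measurable A -> measurable (f @^-1` A).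
Proof. by move=> mf mA; rewrite -[X in measurable X]setTI; exact: mf. Qed.

Section lebesgue_row.
Variable R : realType.
Implicit Types n : nat.

Local Notation mu n := (@borel_lebesgue_measure R n).

Lemma measurable_coord_rVP n (i : 'I_n) :
  measurable_fun [set: 'rV[R]_n] (fun x : 'rV[R]_n => x ord0 i).
Proof. exact: measurable_coord_rV. Qed.

Lemma measurable_addr_rV n (v : 'rV[R]_n) : measurable_fun setT (fun x : 'rV[R]_n => x + v).
Proof.
apply: measurable_fun_rVP => i.
rewrite (_ : _ \o _ = fun x : 'rV[R]_n => x ord0 i + v ord0 i); last first.
  by apply/funext => x /=; rewrite /coord_rV mxE.
by apply: measurable_funD => //; exact: measurable_coord_rVP.
Qed.

Lemma measurable_mulmx_rV n m (V : 'M[R]_(n, m)) :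
  measurable_fun setT (fun x : 'rV[R]_n => x *m V).
Proof.
apply: measurable_fun_rVP => i.
rewrite (_ : _ \o _ = fun x : 'rV[R]_n => \sum_k x ord0 k * V k i); last first.
  by apply/funext => x /=; rewrite /coord_rV mxE.
apply: measurable_sum => k; apply: measurable_funM => //; exact: measurable_coord_rVP.
Qed.

Lemma measurable_funB_rV d (S : measurableType d) n (f g : S -> 'rV[R]_n) :
  measurable_fun setT f -> measurable_fun setT g ->
  measurable_fun setT (fun x => f x - g x).
Proof.
move=> mf mg; apply: measurable_fun_rVP => i.
rewrite (_ : _ \o _ = fun x => f x ord0 i - g x ord0 i); last first.
  by apply/funext => x /=; rewrite /coord_rV !mxE.
by apply: measurable_funB; apply: (measurableT_comp (measurable_coord_rVP i)).
Qed.

Lemma borel_lebesgue_translate n (v : 'rV[R]_n) (A : set 'rV[R]_n) : measurable A ->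
  mu n ((fun x : 'rV[R]_n => x + v) @^-1` A) = mu n A.
Proof.
elim: n v A => [|n IH] v A mA.
  by congr (mu 0 _); apply/seteqP; split => x /=; rewrite [x + v]thinmx0 [x]thinmx0.
pose B := @cons_rV R n @^-1` A.
have mB : measurable B by apply: measurable_preimageT => //; exact: measurable_cons_rV.
rewrite -[RHS]/((@lebesgue_measure R \x mu n)%E B).
rewrite -[LHS]/((@lebesgue_measure R \x mu n)%E (@cons_rV R n @^-1` ((fun x : 'rV[R]_n.+1 => x + v) @^-1` A))).
pose f (p : measurableTypeR R * 'rV[R]_n) : measurableTypeR R * 'rV[R]_n :=
  (p.1 + (uncons_rV v).1, p.2).
pose g (p : measurableTypeR R * 'rV[R]_n) : measurableTypeR R * 'rV[R]_n :=
  (p.1, p.2 + (uncons_rV v).2).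
have mf : measurable_fun setT f.
  apply: measurable_fun_pair; last exact: measurable_snd.
  by apply: measurable_funD => //; exact: measurable_fst.
have mg : measurable_fun setT g.
  apply: measurable_fun_pair; first exact: measurable_fst.
  by apply: (measurableT_comp (measurable_addr_rV _)); exact: measurable_snd.
have -> : @cons_rV R n @^-1` ((fun x : 'rV[R]_n.+1 => x + v) @^-1` A) = f @^-1` (g @^-1` B).
  have E p : cons_rV p + v = cons_rV (g (f p)).
    apply/rowP => j.
    by have [i|] := unliftP ord0 j => ->; rewrite mxE !(coord_cons_rVS,coord_cons_rV0)/= ?mxE.
  by apply/funext => p; rewrite -[LHS]/(A (cons_rV p + v)) E.
transitivity ((@lebesgue_measure R \x mu n)%E (g @^-1` B)).
  rewrite -[RHS](@product_measure_preimage1 _ _ _ _ _ _ _ (fun (_ : 'rV[R]_n) (x : measurableTypeR R) => x + (uncons_rV v).1 : measurableTypeR R) 1)//.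
  - by rewrite mul1e.
  - exact: measurable_preimageT.
  - move=> y X mX; rewrite -[RHS](@lebesgue_measure_affine_gt0 _ 1 (uncons_rV v).1)//.
    by congr (_ * lebesgue_measure _)%E; apply/funext => x; rewrite /preimage/= mul1r.
  - by apply: measurable_preimageT => //; exact: measurable_preimageT.
rewrite -[RHS](@product_measure_preimage2 _ _ _ _ _ _ _ (fun (_ : measurableTypeR R) (x : 'rV[R]_n) => x + (uncons_rV v).2) 1)//.
- by rewrite mul1e.
- by move=> x X mX; rewrite mul1e IH.
- exact: measurable_preimageT.
Qed.

Definition scales_lebesgue n (V : 'M[R]_n) := forall A, measurable A ->
  (`|\det V|%:E * mu n ((fun x : 'rV[R]_n => x *m V) @^-1` A) = mu n A)%E.

Lemma scales_lebesgueM n (V W : 'M[R]_n) :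
  scales_lebesgue V -> scales_lebesgue W -> scales_lebesgue (V *m W).
Proof.
move=> sV sW A mA; rewrite -(sW A mA).
rewrite -(sV ((fun x : 'rV[R]_n => x *m W) @^-1` A)); last first.
  by apply: measurable_preimageT => //; exact: measurable_mulmx_rV.
rewrite det_mulmx normrM EFinM muleCA muleA; congr (_ * mu n _)%E.
by apply/seteqP; split => x /=; rewrite mulmxA.
Qed.

Lemma cons_rV_mul n (a : R) (b : 'rV[R]_n) (c : 'cV[R]_n) (D : 'M[R]_n) p :
  cons_rV p *m (block_mx (a%:M) b c D : 'M[R]_(1 + n)) =
  cons_rV (p.1 * a + (p.2 *m c) ord0 ord0, p.1 *: b + p.2 *m D) :> 'rV[R]_n.+1.
Proof.
rewrite /cons_rV/= (@mul_row_block _ 1 1 n 1 n) !mul_scalar_mx.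
suff -> : p.1 *: (a%:M : 'M[R]_1) + p.2 *m c = (p.1 * a + (p.2 *m c) ord0 ord0)%:M by [].
by apply/matrixP => i j; rewrite !ord1 !mxE !eqxx !mulr1n.
Qed.

Lemma block_schur n (a : R) (b : 'rV[R]_n) (c : 'cV[R]_n) (D : 'M[R]_n) : a != 0 ->
  block_mx (a%:M) b c D = block_mx (1%:M) 0 (a^-1 *: c) (1%:M) *m
    block_mx (a%:M) b 0 (D - a^-1 *: (c *m b)) :> 'M[R]_(1 + n).
Proof.
move=> a0; rewrite mulmx_block !mul1mx !mul0mx !addr0 mul_mx_scalar scalerA.
by rewrite mulfV// scale1r -scalemxAl addrC subrK.
Qed.

Lemma det_schur n (a : R) (b : 'rV[R]_n) (c : 'cV[R]_n) (D : 'M[R]_n) : a != 0 ->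
  \det (block_mx (a%:M) b c D : 'M[R]_(1 + n)) = a * \det (D - a^-1 *: (c *m b)).
Proof.
move=> a0; rewrite block_schur// det_mulmx det_lblock det_ublock !det1 !mul1r.
by rewrite det_scalar1.
Qed.

(* One Fubini argument per elimination step: on each line the map scales by the
   pivot [a], and on each hyperplane by the Schur complement. *)
Lemma scales_lebesgue_block n (a : R) (b : 'rV[R]_n) (c : 'cV[R]_n) (D : 'M[R]_n) :
  a != 0 -> scales_lebesgue (D - a^-1 *: (c *m b)) ->
  scales_lebesgue (block_mx (a%:M) b c D : 'M[R]_n.+1).
Proof.
move=> a0 sS A mA; set S := D - _ in sS.
rewrite (det_schur b c D a0) -/S.
pose B := @cons_rV R n @^-1` A.
have mB : measurable B by apply: measurable_preimageT => //; exact: measurable_cons_rV.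
rewrite -[RHS]/((@lebesgue_measure R \x mu n)%E B).
set C := (X in mu n.+1 X).
rewrite -[X in (_ * X)%E = _]/((@lebesgue_measure R \x mu n)%E (@cons_rV R n @^-1` C)).
pose f (p : measurableTypeR R * 'rV[R]_n) : measurableTypeR R * 'rV[R]_n :=
  (a * p.1 + (p.2 *m c) ord0 ord0, p.2).
pose g (p : measurableTypeR R * 'rV[R]_n) : measurableTypeR R * 'rV[R]_n :=
  (p.1, p.2 *m S + p.1 *: (a^-1 *: b)).
have mf : measurable_fun setT f.
  apply: measurable_fun_pair; last exact: measurable_snd.
  apply: measurable_funD; first by apply: measurable_funM => //; exact: measurable_fst.
  apply: (@measurableT_comp _ _ _ _ _ _ (fun x : 'rV[R]_n => (x *m c) ord0 ord0)).
    exact: (measurableT_comp (measurable_coord_rVP _) (measurable_mulmx_rV c)).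
  exact: measurable_snd.
have mg : measurable_fun setT g.
  apply: measurable_fun_pair; first exact: measurable_fst.
  apply: measurable_fun_rVP => i.
  rewrite (_ : _ \o _ = fun p : measurableTypeR R * 'rV[R]_n =>
     (p.2 *m S) ord0 i + p.1 * (a^-1 *: b) ord0 i); last first.
    by apply/funext => x /=; rewrite /coord_rV !mxE.
  apply: measurable_funD; last by apply: measurable_funM => //; exact: measurable_fst.
  apply: (@measurableT_comp _ _ _ _ _ _ (fun x : 'rV[R]_n => (x *m S) ord0 i)).
    exact: (measurableT_comp (measurable_coord_rVP _) (measurable_mulmx_rV S)).
  exact: measurable_snd.
have -> : @cons_rV R n @^-1` C = f @^-1` (g @^-1` B).
  suff E p : cons_rV p *m (block_mx (a%:M) b c D : 'M[R]_n.+1) = cons_rV (g (f p)).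
    by apply/funext => p; rewrite -[LHS]/(A (cons_rV p *m (block_mx (a%:M) b c D : 'M[R]_n.+1))) E.
  case: p => x w; rewrite cons_rV_mul/=; congr cons_rV; congr pair; first by rewrite mulrC.
  set k := (w *m c) ord0 ord0; rewrite scalerA.
  have -> : (a * x + k) / a = x + a^-1 * k by field.
  rewrite /S mulmxBr -scalemxAr mulmxA [w *m c]mx11_scalar -/k mul_scalar_mx scalerA.
  by rewrite scalerDl [x *: b + (_ *: b)]addrC addrA subrK addrC.
rewrite normrM EFinM muleC muleA [X in (X * _)%E]muleC -muleA [X in (_ * X)%E]muleC.
transitivity (`|\det S|%:E * (@lebesgue_measure R \x mu n) (g @^-1` B))%E.
  rewrite muleCA; congr (_ * _)%E.
  rewrite -[RHS](@product_measure_preimage1 _ _ _ _ _ _ _ (fun (y : 'rV[R]_n) (x : measurableTypeR R) => a * x + (y *m c) ord0 ord0 : measurableTypeR R) `|a|)//.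
  - exact: measurable_preimageT.
  - by move=> y X mX; exact: lebesgue_measure_affine.
  - by apply: measurable_preimageT => //; exact: measurable_preimageT.
rewrite -[RHS](@product_measure_preimage2 _ _ _ _ _ _ _ (fun (y : measurableTypeR R) (x : 'rV[R]_n) => x *m S + y *: (a^-1 *: b)) `|\det S|)//.
- move=> x X mX; rewrite -[RHS](@borel_lebesgue_translate _ (x *: (a^-1 *: b)))//.
  rewrite -sS//; apply: measurable_preimageT => //; exact: measurable_addr_rV.
- exact: measurable_preimageT.
Qed.

(** Gaussian elimination by induction on the dimension: one pivot is split off by
    [scales_lebesgue_block], and its Schur complement is again invertible. *)
Lemma scales_lebesgue_unit n (V : 'M[R]_n) : \det V != 0 -> scales_lebesgue V.
Proof.
elim: n V => [|n IH] V dV.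
  move=> A mA; rewrite det_mx00 normr1 mul1e; congr (mu 0 _).
  by apply/seteqP; split => x /=; rewrite [x *m V]thinmx0 [x]thinmx0.
have main (a : R) (b : 'rV[R]_n) (c : 'cV[R]_n) (D : 'M[R]_n) : a != 0 -> \det (block_mx (a%:M) b c D : 'M[R]_n.+1) != 0 ->
    scales_lebesgue (block_mx (a%:M) b c D : 'M[R]_n.+1).
  move=> a0; rewrite (det_schur b c D a0) mulf_eq0 negb_or => /andP[_ dS].
  by apply: scales_lebesgue_block => //; exact: IH.
have VE : V = block_mx ((V ord0 ord0)%:M) (@ursubmx _ 1 n 1 n V) (@dlsubmx _ 1 n 1 n V)
    (@drsubmx _ 1 n 1 n V) :> 'M[R]_(1 + n).
  rewrite -[LHS](@submxK _ 1 n 1 n); congr block_mx.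
  rewrite [LHS]mx11_scalar; congr (_%:M); rewrite !mxE; congr (V _ _); exact: val_inj.
have [V00|V00] := eqVneq (V ord0 ord0) 0; last by rewrite VE; apply: main => //; rewrite -VE.
set b := @ursubmx _ 1 n 1 n V in VE; set c := @dlsubmx _ 1 n 1 n V in VE.
set D := @drsubmx _ 1 n 1 n V in VE.
(* With a zero pivot, invertibility gives a nonzero entry below it; adding that row to the first one
   moves the entry into the pivot position. *)
have [i ci] : exists i, c i ord0 != 0.
  apply/existsP; rewrite -[X in is_true X]negbK; apply/negP => /existsPn c0.
  move: dV; rewrite VE V00.
  have -> : c = 0 by apply/matrixP => i j; rewrite ord1 [RHS]mxE; apply/eqP; have := c0 i; rewrite negbK.
  by rewrite (@det_ublock _ 1 n) det_scalar1 mul0r eqxx.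
pose e : 'rV[R]_n := delta_mx ord0 i.
have ec : e *m c = (c i ord0)%:M.
  by rewrite -rowE; apply/matrixP => k l; rewrite !ord1 !mxE eqxx mulr1n.
have -> : V = block_mx (1%:M) (- e) 0 (1%:M) *m block_mx ((c i ord0)%:M) (b + e *m D) c D :> 'M[R]_(1 + n).
  rewrite VE V00 mulmx_block !mul1mx !mul0mx !add0r !mulNmx ec subrr addrK.
  by congr block_mx; apply/matrixP => k l; rewrite !mxE mul0rn.
apply: scales_lebesgueM.
  apply: main; rewrite ?oner_neq0//.
  by rewrite (@det_ublock _ 1 n) !det1 mul1r oner_neq0.
apply: main => //; move: dV; rewrite VE V00.
have -> : block_mx (0%:M) b c D = block_mx (1%:M) (- e) 0 (1%:M) *m block_mx ((c i ord0)%:M) (b + e *m D) c D :> 'M[R]_(1 + n).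
  rewrite mulmx_block !mul1mx !mul0mx !add0r !mulNmx ec subrr addrK.
  by congr block_mx; apply/matrixP => k l; rewrite !mxE mul0rn.
by rewrite det_mulmx (@det_ublock _ 1 n) !det1 !mul1r.
Qed.

(** Half-open, so that its integer translates partition the space exactly and not only up to a null
    set. *)
Definition unit_box n : set 'rV[R]_n := [set x | forall i, 0 <= x ord0 i < 1].

Lemma measurable_boxes n (J : 'I_n -> interval R) :
  measurable [set x : 'rV[R]_n | forall i, x ord0 i \in J i].
Proof.
rewrite (_ : mkset _ = \bigcap_(i in [set: 'I_n]) ((fun x : 'rV[R]_n => x ord0 i) @^-1` [set` J i])).
  apply: fin_bigcap_measurable => // i _; apply: measurable_preimageT => //.
  exact: measurable_coord_rVP.
by apply/seteqP; split => [x xJ i _ /=|x xJ i]; [exact: xJ|exact: xJ i I].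
Qed.

Lemma unit_boxE n : @unit_box n = [set x : 'rV[R]_n | forall i, x ord0 i \in `[0, 1[].
Proof.
by apply/seteqP; split => x xb i; have := xb i; rewrite in_itv/=.
Qed.

Lemma measurable_unit_box n : measurable (@unit_box n).
Proof. by rewrite unit_boxE; exact: measurable_boxes. Qed.

Lemma borel_lebesgue_unit_box n : mu n (@unit_box n) = 1%E.
Proof.
elim: n => [|n IH].
  by rewrite /= diracE mem_set// => -[].
rewrite -[LHS]/((@lebesgue_measure R \x mu n)%E (@cons_rV R n @^-1` @unit_box n.+1)).
have -> : @cons_rV R n @^-1` @unit_box n.+1 = `[0, 1[ `*` @unit_box n.
  apply/seteqP; split => [[x w] /= H|[x w] /= [H1 H2] j].
    split; first by have := H ord0; rewrite coord_cons_rV0 in_itv.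
    by move=> i; have := H (lift ord0 i); rewrite coord_cons_rVS.
  have [i|] := unliftP ord0 j => ->; first by rewrite coord_cons_rVS; exact: H2.
  by rewrite coord_cons_rV0; move: H1; rewrite in_itv.
rewrite product_measure1E//; last exact: measurable_unit_box.
rewrite IH mule1.
have := @lebesgue_measure_itv R `[0, 1[.
by rewrite /= lte_fin ltr01 oppr0 adde0.
Qed.

End lebesgue_row.

(** * Lattices and their bases *)

Section matrix_norm.
Variable R : realType.

Lemma entry_le_norm m n (x : 'M[R]_(m, n)) i j : `|x i j| <= `|x|.
Proof. by rewrite [leRHS]mx_normrE; exact: (@le_bigmax _ _ _ _ _ (i, j)). Qed.

Lemma norm_le_entries m n (x : 'M[R]_(m, n)) (e : R) :
  0 <= e -> (forall i j, `|x i j| <= e) -> `|x| <= e.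
Proof. by move=> e0 xe; rewrite [leLHS]mx_normrE; apply/bigmax_leP; split => // -[]. Qed.

Lemma norm_mulmx_le m n p (x : 'M[R]_(m, n)) (A : 'M[R]_(n, p)) :
  `|x *m A| <= n%:R * (`|x| * `|A|).
Proof.
apply: norm_le_entries => [|i j]; first by rewrite !mulr_ge0.
rewrite mxE (le_trans (ler_norm_sum _ _ _))//.
apply: (@le_trans _ _ (\sum_(k < n) `|x| * `|A|)).
  by apply: ler_sum => k _; rewrite normrM ler_pM// entry_le_norm.
by rewrite sumr_const card_ord mulr_natl.
Qed.

Lemma det_le_norm n (A : 'M[R]_n) : `|\det A| <= #|{: 'S_n}|%:R * `|A| ^+ n.
Proof.
rewrite /determinant (le_trans (ler_norm_sum _ _ _))//.
apply: (@le_trans _ _ (\sum_(s : 'S_n) `|A| ^+ n)).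
  apply: ler_sum => s _; rewrite normrM normrX normrN1 expr1n mul1r normr_prod.
  have -> : `|A| ^+ n = \prod_(i < n) `|A| by rewrite prodr_const card_ord.
  apply: ler_prod => i _.
  by rewrite normr_ge0 entry_le_norm.
by rewrite sumr_const mulr_natl.
Qed.

(** A vector [x] killed by [W] satisfies [L x = - x (W - L)], and the right-hand side is too small
    in norm. *)
Lemma det_near_scalar_neq0 n (W : 'M[R]_n) (L e : R) :
  `|W - L%:M| <= e -> n%:R * e < L -> \det W != 0.
Proof.
move=> We nL; apply/negP => /det0P[x x0 xW].
have : `|L *: x| <= n%:R * (`|x| * e).
  have -> : L *: x = - (x *m (W - L%:M)).
    by rewrite mulmxBr xW sub0r opprK mul_mx_scalar.
  rewrite normrN (le_trans (norm_mulmx_le _ _))// ler_wpM2l// ler_wpM2l//.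
rewrite normrZ mulrCA mulrC ler_pM2l ?normr_gt0// => Le.
have := lt_le_trans nL (le_trans (ler_norm _) Le); by rewrite ltxx.
Qed.

Lemma det_row_replace n (j : 'I_n) (t : 'rV[R]_n) :
  \det (\matrix_l (if l == j then t else delta_mx ord0 l)) = t ord0 j.
Proof.
rewrite (expand_det_col _ j) (bigD1 j)//= big1 ?addr0 => [|i ij]; last first.
  by rewrite !mxE (negbTE ij) !mxE eqxx/= eq_sym (negbTE ij) mul0r.
rewrite mxE eqxx /cofactor addnn -signr_odd odd_double expr0 mul1r.
rewrite (_ : row' _ _ = 1%:M) ?det1 ?mulr1//.
apply/matrixP => k l; rewrite !mxE eq_sym (negbTE (neq_lift _ _)) !mxE eqxx/=.
by rewrite (inj_eq lift_inj) eq_sym.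
Qed.

End matrix_norm.

Section lattice_points.
Variables (R : realType) (N : nat).
Implicit Types (V W : 'M[R]_N) (c d : 'rV[int]_N).

Definition lattice_point V c : 'rV[R]_N := map_mx intr c *m V.

Lemma lattice_point0 V : lattice_point V 0 = 0.
Proof. by rewrite /lattice_point map_mx0 mul0mx. Qed.

Lemma lattice_pointD V c d : lattice_point V (c + d) = lattice_point V c + lattice_point V d.
Proof. by rewrite /lattice_point map_mxD mulmxDl. Qed.

Lemma lattice_pointB V c d : lattice_point V (c - d) = lattice_point V c - lattice_point V d.
Proof. by rewrite /lattice_point map_mxB mulmxBl. Qed.

Lemma lattice_pointN V c : lattice_point V (- c) = - lattice_point V c.
Proof. by rewrite -sub0r lattice_pointB lattice_point0 sub0r. Qed.

Lemma lattice_point_mulmx (A : 'M[int]_N) V c :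
  lattice_point (map_mx intr A *m V) c = lattice_point V (c *m A).
Proof. by rewrite /lattice_point map_mxM mulmxA. Qed.

Lemma lattice_point_delta V i : lattice_point V (delta_mx ord0 i) = row i V.
Proof.
rewrite rowE /lattice_point; congr (_ *m _).
by apply/rowP => j; rewrite !mxE eqxx/=; case: eqP.
Qed.

Lemma lattice_point_sum V c : lattice_point V c = \sum_i row i V *~ c ord0 i.
Proof.
by rewrite /lattice_point mulmx_sum_row; apply: eq_bigr => i _; rewrite mxE scaler_int.
Qed.

Lemma Zspan_rowsE V : Zspan_rows V = range (lattice_point V).
Proof.
apply/seteqP; split => x [a _ <-].
  exists (\row_i a i) => //; rewrite lattice_point_sum.
  by apply: eq_bigr => i _; rewrite mxE.
by exists (fun i => a ord0 i) => //; rewrite lattice_point_sum.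
Qed.

Lemma lattice_point_inj V : \det V != 0 -> injective (lattice_point V).
Proof.
move=> dV c d /(congr1 (mulmx^~ (invmx V)))/=.
rewrite /lattice_point !mulmxK ?unitmxE ?unitfE// => /rowP cd.
by apply/rowP => i; have := cd i; rewrite !mxE => /intr_inj.
Qed.

Lemma sub_Zspan_rows V W : Zspan_rows W `<=` Zspan_rows V ->
  exists A : 'M[int]_N, W = map_mx intr A *m V.
Proof.
rewrite !Zspan_rowsE => sWV.
have /choice[f fP] i : exists c, lattice_point V c = row i W.
  have [c _ cW] := sWV _ (ex_intro2 _ _ (delta_mx ord0 i) I (lattice_point_delta W i)).
  by exists c.
exists (\matrix_i f i); apply/row_matrixP => i.
by rewrite row_mul -fP /lattice_point; congr (_ *m _); apply/rowP => j; rewrite !mxE.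
Qed.

Lemma det_map_intr (A : 'M[int]_N) : `|\det (map_mx intr A : 'M[R]_N)| = (`|\det A|%N)%:R.
Proof. by rewrite det_map_mx -intr_norm natr_absz. Qed.

(** The two change-of-basis matrices are integral and the product of their determinants is 1 in
    absolute value. Hence [covolume] does not depend on the matrix that [get] selects. *)
Lemma Zspan_rows_det V W : \det V != 0 -> Zspan_rows W = Zspan_rows V ->
  `|\det W| = `|\det V|.
Proof.
move=> dV WV.
have [A WA] : exists A : 'M[int]_N, W = map_mx intr A *m V.
  by apply: sub_Zspan_rows; rewrite WV.
have [B VB] : exists B : 'M[int]_N, V = map_mx intr B *m W.
  by apply: sub_Zspan_rows; rewrite WV.
have : (`|\det B|%N * `|\det A|%N)%N = 1%N.
  apply/eqP; rewrite -(eqr_nat R) natrM -!det_map_intr -normrM -det_mulmx.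
  rewrite -(inj_eq (mulIf (_ : `|\det V| != 0))) ?normr_eq0// mul1r -normrM -det_mulmx.
  by rewrite -mulmxA -WA -VB.
move=> /eqP; rewrite muln_eq1 => /andP[_ /eqP dA].
by rewrite WA det_mulmx normrM det_map_intr dA mul1r.
Qed.

Lemma Zspan_rows_unimodular V (A : 'M[int]_N) : `|\det A|%N = 1%N ->
  Zspan_rows (map_mx intr A *m V) = Zspan_rows V.
Proof.
move=> dA; have uA : A \in unitmx.
  rewrite unitmxE; apply: (@intUnitRing.unitzPl _ (\det A)).
  have /eqP := congr1 (fun n : nat => n%:Z) dA; rewrite abszE eqr_norml => /andP[+ _].
  by case/orP => /eqP ->; rewrite ?mulr1// mulrNN mulr1.
rewrite !Zspan_rowsE; apply/seteqP; split => x [c _ <-].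
  by exists (c *m A) => //; rewrite lattice_point_mulmx.
by exists (c *m invmx A) => //; rewrite lattice_point_mulmx mulmxKV.
Qed.

Lemma norm_lattice_coord V c i : \det V != 0 ->
  `|c ord0 i|%:~R <= N%:R * (`|lattice_point V c| * `|invmx V|).
Proof.
move=> dV; rewrite intr_norm; apply: le_trans (norm_mulmx_le _ _).
rewrite /lattice_point mulmxK ?unitmxE ?unitfE//.
by have := entry_le_norm (map_mx intr c : 'rV[R]_N) ord0 i; rewrite mxE.
Qed.

(* Clearing denominators in a nonzero rational kernel vector. *)
Lemma int_rows_dependent (C : 'M[int]_(N.+1, N)) :
  exists a : 'I_N.+1 -> int, (exists i, a i != 0) /\
    forall j, \sum_i C i j * a i = 0.
Proof.
pose K := kermx (map_mx intr C : 'M[rat]_(N.+1, N)).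
have : K != 0.
  by rewrite -mxrank_eq0 mxrank_ker -lt0n subn_gt0 ltnS rank_leq_col.
case/rowV0Pn => u /sub_kermxP uC /rV0Pn[i0 ui0].
pose a i := numq (u ord0 i) * \prod_(k | k != i) denq (u ord0 k).
have aE i : (a i)%:~R = u ord0 i * (\prod_k denq (u ord0 k))%:~R :> rat.
  rewrite (bigD1 i)//= /a !intrM mulrA; congr (_ * _).
  by rewrite -[RHS]numqE.
exists a; split; last first.
  move=> j; apply: (@intr_inj rat); rewrite rmorph_sum/=.
  have /rowP/(_ j) := uC; rewrite !mxE => uCj.
  transitivity (\sum_i u ord0 i * (C i j)%:~R * (\prod_k denq (u ord0 k))%:~R : rat).
    by apply: eq_bigr => i _; rewrite intrM aE; ring.
  rewrite -mulr_suml [X in X * _](_ : _ = 0) ?mul0r//.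
  by rewrite -[RHS]uCj; apply: eq_bigr => i _; rewrite !mxE.
exists i0; rewrite -(intr_eq0 rat) aE mulf_neq0// intr_eq0.
by apply/prodf_neq0 => k _; rewrite gt_eqF// denq_gt0.
Qed.

Lemma lattice_Zspan_rows V : \det V != 0 -> lattice (Zspan_rows V).
Proof.
move=> dV; split.
- split; first by rewrite Zspan_rowsE; exists 0 => //; exact: lattice_point0.
  rewrite Zspan_rowsE => x y [c _ <-] [d _ <-].
  by exists (c - d) => //; rewrite lattice_pointB.
- rewrite Zspan_rowsE => x [c _ <-]; split; first by rewrite inE; exists c.
  (* Lattice points closer than [e] have integer coordinates differing by less than 1, hence are
     equal. *)
  pose e : R := (1 + N%:R * `|invmx V|)^-1.
  have e0 : 0 < e by rewrite invr_gt0 ltr_pwDl// mulr_ge0.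
  exists (ball (lattice_point V c) e); first exact: nbhsx_ballx.
  apply/seteqP; split => [y [cy [d _ dy]]|y ->]; last by split; [exact: ballxx|exists c].
  move: cy; rewrite -dy -ball_normE /= -lattice_pointB => cd.
  suff /eqP : c - d = 0 by rewrite subr_eq0 => /eqP ->.
  apply/rowP => i; rewrite [RHS]mxE; apply/eqP; rewrite -normr_le0 -ltzD1 add0r.
  rewrite -(ltr_int R); apply: le_lt_trans (norm_lattice_coord _ _ dV) _.
  apply: (@le_lt_trans _ _ (N%:R * `|invmx V| * e)).
    by rewrite mulrCA mulrC ler_wpM2l ?mulr_ge0// ltW.
  by rewrite ltr_pdivrMr ?mul1r ?ltrDr// ltr_pwDl// mulr_ge0.
- split.
    exists (fun i => row i V); split.
      by move=> i; rewrite Zspan_rowsE; exists (delta_mx ord0 i) => //; exact: lattice_point_delta.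
    move=> a a0 i; have : lattice_point V (\row_j a j) = lattice_point V 0.
      rewrite lattice_point0 -[RHS]a0 lattice_point_sum.
      by apply: eq_bigr => j _; rewrite mxE.
    by move=> /(lattice_point_inj dV) /rowP/(_ i); rewrite !mxE.
  move=> v; rewrite Zspan_rowsE => vV; have /choice[f fP] i : exists c, lattice_point V c = v i.
    by have [c _ <-] := vV i; exists c.
  have [a [[i ai] aC]] := int_rows_dependent (\matrix_i f i).
  move=> /(_ a) H; move: ai; rewrite H ?eqxx//.
  transitivity (lattice_point V (\sum_i f i *~ a i)).
    rewrite /lattice_point raddf_sum mulmx_suml; apply: eq_bigr => k _.
    rewrite -fP /lattice_point -[LHS]scaler_int scalemxAl; congr (_ *m _).
    by rewrite scaler_int; apply/esym; exact: (raddfMz (map_mx (intr : int -> R))).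
  suff -> : \sum_i f i *~ a i = 0 by exact: lattice_point0.
  apply/rowP => j; rewrite summxE [RHS]mxE -[RHS](aC j); apply: eq_bigr => k _.
  by rewrite -[f k *~ a k]scaler_int !mxE mulrC intz.
Qed.

Lemma covolume_Zspan_rows V : \det V != 0 -> covolume (Zspan_rows V) = `|\det V|.
Proof.
move=> dV; apply: Zspan_rows_det => //.
exact: (@getPex _ [set W | Zspan_rows W = Zspan_rows V] (ex_intro _ V erefl)).
Qed.

(* The library's default matrix is zero, so a positive covolume forces the
   existence of a generating matrix. *)
Lemma lattices_of_volumeP (m : R) (G : set 'rV[R]_N) : (0 < N)%N -> 0 < m ->
  lattices_of_volume m G -> exists2 V, Zspan_rows V = G & `|\det V| = m.
Proof.
move=> N0 m0 [_ cG]; pose A := [set V | Zspan_rows V = G].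
have [[V VG]|A0] := pselect (exists V, A V).
  by exists (get A) => //; exact: (@getPex _ A (ex_intro _ V VG)).
move: cG; rewrite /covolume -/A.
have -> : get A = 0.
  have -> : A = set0 by apply/seteqP; split => // V AV; case: A0; exists V.
  have -> : get (set0 : set 'M[R]_N) = point by apply: xgetPN => ? [].
  apply/matrixP => i j; rewrite [RHS]mxE /point/= mxE.
  by [].
have -> : \det (0 : 'M[R]_N) = 0 by rewrite -(scale0r 0) detZ expr0n eqn0Ngt N0 mul0r.
by rewrite normr0 => m00; move: m0; rewrite -m00 ltxx.
Qed.

(* If the rows of [A *m V] generate a proper sublattice, some lattice vector has
   non-integral coordinates [s] in them; exchanging it for one of the rows, after
   reducing [s] modulo 1, strictly decreases the index. *)
Lemma sublattice_exchange (A : 'M[int]_N) V : (1 < `|\det A|)%N ->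
  exists A' : 'M[int]_N, [/\ (0 < `|\det A'|)%N, (`|\det A'| < `|\det A|)%N &
    `|map_mx intr A' *m V| <= N%:R * `|map_mx intr A *m V|].
Proof.
move=> A1; pose B : 'M[R]_N := map_mx intr A.
have dB : \det B != 0.
  by rewrite -normr_eq0 det_map_intr pnatr_eq0 -lt0n (ltn_trans _ A1).
have [i iA] : exists i, forall d, d *m A != delta_mx ord0 i.
  apply/not_existsP => H.
  have /choice[f fP] i : exists d, d *m A = delta_mx ord0 i.
    by have /existsNP[d /negP] := H i; rewrite negbK => /eqP dA; exists d.
  have : (\matrix_i f i) *m A = 1%:M.
    by apply/row_matrixP => i; rewrite row_mul rowK fP row1.
  move=> /(congr1 (absz \o determinant)) /=; rewrite det_mulmx det1 abszM => /eqP.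
  by rewrite muln_eq1 => /andP[_ /eqP E]; rewrite E in A1.
pose s : 'rV[R]_N := delta_mx ord0 i *m invmx B.
pose z : 'rV[int]_N := map_mx Num.floor s.
pose t : 'rV[R]_N := s - map_mx intr z.
have t01 j : 0 <= t ord0 j < 1.
  by rewrite !mxE subr_ge0 ltrBlDl -intrD1; exact: floor_itv.
pose c : 'rV[int]_N := delta_mx ord0 i - z *m A.
have ct : map_mx intr c = t *m B.
  rewrite map_mxB map_mxM mulmxBl /s mulmxKV ?unitmxE ?unitfE//; congr (_ - _).
  by apply/rowP => j; rewrite !mxE; case: (_ && _).
have [j tj] : exists j, t ord0 j != 0.
  apply/rV0Pn; apply: contra (iA z) => /eqP t0; rewrite eq_sym -subr_eq0 -/c.
  apply/eqP/rowP => j; apply: (@intr_inj R); have /rowP/(_ j) := ct.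
  by rewrite t0 mul0mx !mxE.
pose A' : 'M[int]_N := \matrix_l (if l == j then c else row l A).
have A'E : map_mx intr A' = (\matrix_l (if l == j then t else delta_mx ord0 l)) *m B.
  apply/row_matrixP => l; rewrite row_mul rowK.
  transitivity (map_mx intr (row l A') : 'rV[R]_N); first by apply/rowP => k; rewrite !mxE.
  rewrite rowK; case: eqP => _; first exact: ct.
  by rewrite -rowE; apply/rowP => k; rewrite !mxE.
have dA' : (`|\det A'|%N)%:R = t ord0 j * (`|\det A|%N)%:R :> R.
  rewrite -!det_map_intr A'E det_mulmx det_row_replace normrM ger0_norm//.
  by have /andP[] := t01 j.
have tj0 : 0 < t ord0 j by rewrite lt_def tj; have /andP[] := t01 j.
have A0 : 0 < (`|\det A|%N)%:R :> R by rewrite ltr0n (ltn_trans _ A1).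
exists A'; split.
- by rewrite -(ltr_nat R) dA' mulr_gt0.
- by rewrite -(ltr_nat R) dA' gtr_pMl//; have /andP[] := t01 j.
rewrite A'E -mulmxA; set W := B *m V.
have N1 : 1 <= N%:R :> R by rewrite ler1n (leq_ltn_trans _ (ltn_ord i)).
apply: norm_le_entries => [|k l]; first by rewrite mulr_ge0.
apply: (@le_trans _ _ `|row k (\matrix_l (if l == j then t else delta_mx ord0 l) *m W)|).
  by have := entry_le_norm (row k (\matrix_l (if l == j then t else delta_mx ord0 l) *m W)) ord0 l; rewrite [row _ _ _ _]mxE.
rewrite row_mul rowK (le_trans (norm_mulmx_le _ _))// ler_wpM2l// ler_piMl//.
apply: norm_le_entries => // u v; rewrite ord1; case: ifP => _.
  rewrite (_ : u = ord0); last by rewrite ord1.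
  by have /andP[t0 /ltW] := t01 v; rewrite ger0_norm.
by rewrite !mxE; case: (_ && _); rewrite ?normr1 ?normr0.
Qed.

(** Each exchange lowers the index [|\det A|] and costs a factor [N] in norm, so the index bounds
    the number of exchanges. *)
Lemma sublattice_basis (A : 'M[int]_N) V : (0 < N)%N -> (0 < `|\det A|)%N ->
  exists2 A' : 'M[int]_N, `|\det A'|%N = 1%N &
    `|map_mx intr A' *m V| <= N%:R ^+ `|\det A|%N * `|map_mx intr A *m V|.
Proof.
move=> N0; have [k] := ubnP `|\det A|%N; elim: k => // k IH in A *; rewrite ltnS => Ak A0.
have N1 : 1 <= N%:R :> R by rewrite ler1n.
have [A1|A1] := leqP `|\det A|%N 1.
  exists A; first by apply/eqP; rewrite eqn_leq A1.
  by rewrite ler_peMl// exprn_ege1.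
have [A' [A'0 A'A A'n]] := sublattice_exchange V A1.
have [A2 A21 A2n] := IH A' (leq_trans A'A Ak) A'0.
exists A2 => //; apply: (le_trans A2n).
apply: (@le_trans _ _ (N%:R ^+ `|\det A'|%N * (N%:R * `|map_mx intr A *m V|))).
  by rewrite ler_wpM2l// exprn_ge0.
by rewrite mulrA -exprSr ler_wpM2r// ler_weXn2l.
Qed.

Definition covers_within V (r : R) := forall x, exists c, `|x - lattice_point V c| <= r.

(** Lattice points near [L] times the unit vectors are independent when [L] is large. They generate
    a sublattice of bounded index, which [sublattice_basis] turns into a basis at bounded cost. *)
Lemma reduced_basis (rho m : R) : (0 < N)%N -> 0 <= rho -> 0 < m -> exists M, forall V,
  `|\det V| = m -> covers_within V rho ->
  exists W, [/\ Zspan_rows W = Zspan_rows V, `|\det W| = m & `|W| <= M].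
Proof.
move=> N0 rho0 m0; pose L := N%:R * rho + 1; pose B := rho + L.
have L0 : 0 <= L by rewrite addr_ge0// mulr_ge0.
have B0 : 0 <= B by rewrite addr_ge0.
(* [q] bounds the index: [N! B^N] bounds the determinant of the chosen vectors, and [m] is the
   covolume of the whole lattice. *)
pose q := #|{: 'S_N}|%:R * B ^+ N / m; pose K := Num.bound `|q|.
exists (N.+1%:R ^+ K * B) => V dV cV.
have dV0 : \det V != 0 by rewrite -normr_eq0 dV gt_eqF.
have /choice[f fP] i := cV (row i L%:M).
pose A : 'M[int]_N := \matrix_i f i.
have AV i : row i (map_mx intr A *m V) = lattice_point V (f i).
  by rewrite row_mul; congr (_ *m _); apply/rowP => j; rewrite !mxE.
have AL : `|map_mx intr A *m V - L%:M| <= rho.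
  apply: norm_le_entries => // i j; apply: le_trans (fP i).
  rewrite -normrN; apply: le_trans (entry_le_norm _ ord0 j).
  by rewrite -AV !mxE opprB.
have AB : `|map_mx intr A *m V| <= B.
  rewrite -[X in `|X|](subrK L%:M) (le_trans (ler_normD _ _))// lerD//.
  apply: norm_le_entries => // i j; rewrite mxE.
  by case: eqP => _; rewrite ?mulr1n ?mulr0n ?normr0// ger0_norm.
have dAV : \det (map_mx intr A *m V) != 0.
  by apply: (det_near_scalar_neq0 AL); rewrite ltrDl.
have A0 : (0 < `|\det A|)%N.
  rewrite lt0n -(pnatr_eq0 R) -det_map_intr normr_eq0.
  by apply: contraNneq dAV => dA; rewrite det_mulmx dA mul0r.
have AK : (`|\det A| <= K)%N.
  rewrite -(ler_nat R); apply: (@le_trans _ _ q); last first.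
    by rewrite ltW// (le_lt_trans (ler_norm _))// /K archi_boundP.
  rewrite ler_pdivlMr// -dV -det_map_intr -normrM -det_mulmx.
  by rewrite (le_trans (det_le_norm _))// ler_wpM2l// lerXn2r// nnegrE.
have [A' A'1 A'n] := sublattice_basis V N0 A0.
exists (map_mx intr A' *m V); split; first exact: Zspan_rows_unimodular.
  by rewrite det_mulmx normrM det_map_intr A'1 mul1r.
apply: (le_trans A'n); rewrite ler_pM ?exprn_ge0//.
apply: (@le_trans _ _ (N.+1%:R ^+ `|\det A|%N)).
  by rewrite lerXn2r ?nnegrE// ler_nat.
by rewrite ler_weXn2l// ler1n.
Qed.

End lattice_points.

(** * Lebesgue and Borel sets *)

Section completion.
Variables (R : realType) (n : nat).
Local Open Scope ereal_scope.

Local Notation T := 'rV[R]_n.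
Local Notation mu := (@borel_lebesgue_measure R n).
Local Notation lam := (@lebesgue_rV R n).
Local Notation lebesgue_measurable := (measurable : set (set (lebesgueRV R n))).

Lemma borel_lebesgue_measurable (A : set T) : measurable A -> lebesgue_measurable A.
Proof. exact: caratheodory_measurable_mu_ext. Qed.

Lemma lebesgue_rV_borel (A : set T) : measurable A -> lam A = mu A.
Proof. by move=> mA; exact: measurable_mu_extE. Qed.

Lemma le_lebesgue_rV (A B : set T) : A `<=` B -> lam A <= lam B.
Proof. exact: le_mu_ext. Qed.

Lemma lebesgue_rV_hull (X : set T) :
  exists H : set T, [/\ measurable H, X `<=` H & mu H = lam X].
Proof.
have [Xoo|] := eqVneq (lam X) +oo.
  exists setT; split => //; apply/eqP; rewrite eq_le [X in _ <= X]Xoo leey/=.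
  by rewrite -lebesgue_rV_borel//; exact: le_lebesgue_rV.
rewrite -ltey => Xoo; have Xfin : lam X \is a fin_num.
  by rewrite ge0_fin_numE//; exact: mu_ext_ge0.
have /choice[F FP] k : exists F : (set T)^nat, measurable_cover X F /\
    \sum_(i <oo) mu (F i) < lam X + k.+1%:R^-1%:E.
  have : ereal_inf [set \sum_(k <oo) mu (A k) | A in measurable_cover X] <
      lam X + k.+1%:R^-1%:E by rewrite -[ltLHS]/(lam X) lteDl// lte_fin invr_gt0.
  by move=> /ereal_inf_lt[_ [F cF <-] Flt]; exists F.
pose U k := \bigcup_i F k i.
have mU k : measurable (U k) by apply: bigcupT_measurable => i; have [[]] := FP k.
have mH : measurable (\bigcap_k U k) by exact: bigcapT_measurable.
have XH : X `<=` \bigcap_k U k.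
  by move=> x Xx k _; have [[_ +] _] := FP k; exact.
exists (\bigcap_k U k); split => //; apply/eqP; rewrite eq_le; apply/andP; split; last first.
  by rewrite -(lebesgue_rV_borel mH) le_lebesgue_rV.
apply/lee_addgt0Pr => e e0.
have [k ke] : exists k, (k.+1%:R^-1 < e :> R)%R by exists (Num.bound e^-1); rewrite invf_plt ?posrE// (lt_trans (archi_boundP _))// ?invr_ge0 ?ltW// ltr_nat.
apply: (@le_trans _ _ (mu (U k))).
  by apply: le_measure; rewrite ?inE//; exact: bigcap_inf.
apply: (@le_trans _ _ (\sum_(i <oo) mu (F k i))).
  by apply: (measure_sigma_subadditive mu) => // i; have [[]] := FP k.
have [_ /ltW H] := FP k; apply: (le_trans H).
by rewrite leeD2l// lee_fin ltW.
Qed.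

(** On a piece of finite measure the excess of the Borel hull over the set is null. Removing from
    the hull a Borel null set that covers the excess leaves a Borel subset. *)
Lemma lebesgue_rV_core (A : set T) : lebesgue_measurable A ->
  exists B Z : set T, [/\ measurable B, measurable Z, mu Z = 0, B `<=` A & A `<=` B `|` Z].
Proof.
move=> mA; have /sigma_finiteP[F [FT _ Foo]] := sigma_finiteT mu.
have mAF k : lebesgue_measurable (A `&` F k).
  apply: (@measurableI _ (lebesgueRV R n)) => //.
  by have [mF _] := Foo k; exact: borel_lebesgue_measurable.
have /choice[H HP] k := lebesgue_rV_hull (A `&` F k).
have D0 k : lam (H k `\` (A `&` F k)) = 0.
  have [mH sH eH] := HP k.
  have fin : lam (A `&` F k) \is a fin_num.
    rewrite ge0_fin_numE; last exact: mu_ext_ge0.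
    have [mF F_oo] := Foo k; apply: (le_lt_trans (le_lebesgue_rV (@subIsetr _ _ _))).
    by rewrite lebesgue_rV_borel.
  rewrite (@measureD _ (lebesgueRV R n) _ lam)//; last 2 first.
    exact: borel_lebesgue_measurable.
    by rewrite -[ltLHS]/(lam (H k)) lebesgue_rV_borel// eH -ge0_fin_numE//.
  rewrite setIidr// -[LHS]/(lam (H k) - lam (A `&` F k)).
  by rewrite lebesgue_rV_borel// eH subee.
have /choice[Z ZP] k := lebesgue_rV_hull (H k `\` (A `&` F k)).
exists (\bigcup_k (H k `\` Z k)), (\bigcup_k Z k); split.
- apply: bigcupT_measurable => k; have [? _ _] := HP k; have [? _ _] := ZP k.
  exact: measurableD.
- by apply: bigcupT_measurable => k; have [] := ZP k.
- have mZ : measurable (\bigcup_k Z k) by apply: bigcupT_measurable => k; have [] := ZP k.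
  apply/negligibleP => //; apply: negligible_bigcup => k.
  by have [mZk _ eZ] := ZP k; apply/negligibleP => //; rewrite -[LHS]/(mu (Z k)) eZ D0.
- move=> x [k _ [Hx nZx]]; have [_ sZ _] := ZP k.
  by have [|nA] := pselect ((A `&` F k) x); [case|case: nZx; exact: sZ].
- move=> x Ax; have [k _ Fx] : (\bigcup_i F i) x by rewrite -FT.
  have [_ sH _] := HP k; have [Zx|nZx] := pselect (Z k x); [right|left]; exists k => //.
  by split => //; exact: sH.
Qed.

Lemma measurable_id_lebesgue :
  measurable_fun [set: lebesgueRV R n] (fun x : lebesgueRV R n => x : T).
Proof. by move=> _ A mA; rewrite setTI; exact: borel_lebesgue_measurable. Qed.

Lemma measurable_fun_lebesgue d (S : measurableType d) (f : T -> S) :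
  measurable_fun setT f -> measurable_fun setT (f : lebesgueRV R n -> S).
Proof. by move=> mf; exact: (measurableT_comp mf measurable_id_lebesgue). Qed.

Lemma ge0_integral_lebesgue_rV (f : T -> \bar R) :
  measurable_fun setT f -> (forall x, 0 <= f x) ->
  \int[lam]_x f x = \int[mu]_x f x.
Proof.
move=> mf f0; transitivity (\int[image_measure lam measurable_id_lebesgue]_x f x).
  by rewrite (@ge0_integral_pushforward _ _ _ _ _ _ measurable_id_lebesgue)// preimage_setT.
by apply: eq_measure_integral => A mA _; exact: lebesgue_rV_borel.
Qed.

(* [K' x] is the supremum of the rationals [q] such that [x] lies in a Borel subset of full
   measure of the superlevel set of [q]. *)
Lemma borel_representative (K : T -> R) :
  measurable_fun setT (K : lebesgueRV R n -> R) -> (forall x, (0 <= K x)%R) ->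
  exists K' : T -> \bar R, exists Z : set T,
    [/\ measurable_fun setT K', forall x, 0 <= K' x, measurable Z, mu Z = 0 &
      forall x, ~ Z x -> K' x = (K x)%:E].
Proof.
move=> mK K0.
have mL (q : R) : lebesgue_measurable (K @^-1` `[q, +oo[).
  by rewrite -[X in _ X]setTI; exact: mK.
have /choice[f fP] (q : rat) : exists BZ : set T * set T, [/\ measurable BZ.1, measurable BZ.2,
    mu BZ.2 = 0, BZ.1 `<=` K @^-1` `[ratr q, +oo[ & K @^-1` `[ratr q, +oo[ `<=` BZ.1 `|` BZ.2].
  by have [B [Z P]] := lebesgue_rV_core (mL (ratr q)); exists (B, Z).
pose h k x : \bar R := if unpickle k is Some q then
  (Num.max 0 (ratr q) * \1_((f q).1) x)%:E else 0.
pose Z := \bigcup_q (f q).2.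
have mZ : measurable Z by apply: bigcupT_measurable_rat => q; have [] := fP q.
have mh k : measurable_fun setT (h k).
  rewrite /h; case: (unpickle k) => [q|]; last exact: measurable_cst.
  apply/measurable_EFinP; apply: measurable_funM => //.
  by apply: measurable_indic; have [] := fP q.
have h0 k x : 0 <= h k x.
  rewrite /h; case: (unpickle k) => // q.
  by rewrite lee_fin mulr_ge0// le_max lexx.
exists (fun x => esups (h ^~ x) 0%N), Z; split => //.
- exact: measurable_fun_esups.
- by move=> x; apply: (@le_trans _ _ (h 0%N x)) => //; apply: ereal_sup_ubound; exists 0%N.
- apply/negligibleP => //; apply: (negligibleS (A := \bigcup_k (if unpickle k is Some q then (f q).2 else set0))).
    by move=> x [q _ fx]; refine (ex_intro2 _ _ (pickle q) I _); rewrite pickleK.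
  apply: negligible_bigcup => k; case: (unpickle k) => [q|]; last exact: negligible_set0.
  by have [_ ? ? _ _] := fP q; exact/negligibleP.
move=> x nZx; apply/eqP; rewrite eq_le; apply/andP; split.
  apply: ge_ereal_sup => _ [k _ <-]; rewrite /h.
  case: (unpickle k) => [q|]; last by rewrite lee_fin.
  rewrite lee_fin indicE; case: (boolP (x \in _)) => [|_]; last by rewrite mulr0.
  rewrite inE mulr1 ge_max K0/=; have [_ _ _ s _] := fP q => /s /=.
  by rewrite in_itv/= andbT.
apply/lee_addgt0Pr => e e0.
have [Ke|Ke] := leP (K x) e.
  apply: (@le_trans _ _ (0 + e%:E)); first by rewrite add0e lee_fin.
  by rewrite leeD2r//; apply: (@le_trans _ _ (h 0%N x)) => //; apply: ereal_sup_ubound; exists 0%N.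
have [q] := @rat_in_itvoo R (K x - e)%R (K x) (ltac:(by rewrite ltrBlDr ltrDl)).
rewrite in_itv/= => /andP[q1 q2].
apply: (@le_trans _ _ (h (pickle q) x + e%:E)).
  have -> : h (pickle q) x = (Num.max 0 (ratr q))%:E.
    rewrite /h pickleK indicE mem_set ?mulr1//; have [_ _ _ _ s] := fP q.
    by case: (s x) => //=; [rewrite in_itv/= andbT ltW|move=> Zx; case: nZx; exists q].
  by rewrite -EFinD lee_fin -lerBlDr le_max (ltW q1) orbT.
rewrite leeD2r//; apply: ereal_sup_ubound.
by refine (ex_intro2 _ _ (pickle q) _ _).
Qed.

(** The bilinear form behind both energies, in the integration order of [nonlocal_perimeter]: J is
    the case [g = f] and the perimeter the case [g = 1 - f]. *)
Definition interaction (k : T -> \bar R) (f g : T -> R) : \bar R :=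
  \int[mu]_y ((f y)%:E * \int[mu]_x ((g x)%:E * k (x - y)%R)).

Lemma measurable_interaction_integrand (k : T -> \bar R) (g : T -> R) :
  measurable_fun setT k -> (forall x, 0 <= k x) ->
  measurable_fun setT g -> (forall x, 0 <= g x)%R ->
  measurable_fun setT (fun y : T => \int[mu]_x ((g x)%:E * k (x - y)%R)).
Proof.
move=> mk k0 mg g0.
apply: (@measurable_fun_fubini_tonelli_F _ _ _ _ _ mu (fun p : T * T => (g p.2)%:E * k (p.2 - p.1)%R)).
  apply: emeasurable_funM.
    by apply/measurable_EFinP; apply: measurableT_comp => //; exact: measurable_snd.
  apply: (measurableT_comp mk).
  by apply: measurable_funB_rV; [exact: measurable_snd|exact: measurable_fst].
by move=> x; rewrite mule_ge0// lee_fin.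
Qed.

Lemma integral_lebesgue_ae_borel (D B Z : set T) (F G : T -> \bar R) :
  measurable B -> measurable Z -> mu Z = 0 -> B `<=` D -> D `<=` B `|` Z ->
  (forall x, 0 <= F x) -> (forall x, 0 <= G x) -> measurable_fun setT G ->
  (forall x, ~ Z x -> F x = G x) ->
  \int[lam]_(x in D) F x = \int[mu]_x ((\1_B x)%:E * G x).
Proof.
move=> mB mZ Z0 BD DBZ F0 G0 mG FG.
have mBG : measurable_fun setT (fun x => (\1_B x)%:E * G x).
  by apply: emeasurable_funM => //; apply/measurable_EFinP; exact: measurable_indic.
have BG0 x : 0 <= (\1_B x)%:E * G x by rewrite mule_ge0// lee_fin.
rewrite -ge0_integral_lebesgue_rV// integral_mkcond.
have E : ae_eq lam setT (fun x => (\1_B x)%:E * G x) (F \_ D).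
  exists Z; split; first exact: borel_lebesgue_measurable.
    by rewrite -[LHS]/(lam Z) lebesgue_rV_borel.
  move=> x /= /not_implyP[_ H]; apply: contrapT => nZ; apply: H.
  rewrite patchE indicE FG//; have [xB|xB] := boolP (x \in B).
    by rewrite mul1e mem_set//; apply: BD; rewrite inE in xB.
  rewrite mul0e memNset// => /DBZ[]//; move: xB; rewrite notin_setE.
  by [].
have mL : measurable_fun setT ((fun x => (\1_B x)%:E * G x) : lebesgueRV R n -> \bar R).
  exact: measurable_fun_lebesgue.
apply: ge0_ae_eq_integral; [by []| |exact: mL| |by []|exact: ae_eq_sym].
- apply: (@ae_measurable_fun _ (lebesgueRV R n) _ lam _ setT _ _ E mL).
  exact: measure_is_complete_caratheodory.
- by move=> x _; rewrite patchE; case: ifP.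
Qed.

(** Leaves the completed measure for good: changing the set and the kernel on null sets changes
    neither integral. *)
Lemma nonlocal_perimeter_borel (K : T -> R) (K' : T -> \bar R) (ZK E B Z : set T) :
  (forall x, (0 <= K x)%R) ->
  measurable_fun setT K' -> (forall x, 0 <= K' x) -> measurable ZK -> mu ZK = 0 ->
  (forall x, ~ ZK x -> K' x = (K x)%:E) ->
  measurable B -> measurable Z -> mu Z = 0 -> B `<=` E -> E `<=` B `|` Z ->
  nonlocal_perimeter K E = interaction K' (\1_B) (\1_(~` B)).
Proof.
move=> K0 mK' K'0 mZK ZK0 KK' mB mZ Z0 BE EBZ.
have inner y : \int[lam]_(x in ~` E) (K (x - y))%:E = \int[mu]_x ((\1_(~` B) x)%:E * K' (x - y)%R).
  have mZy : measurable ((fun x : T => (x - y)%R) @^-1` ZK).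
    by apply: measurable_preimageT => //; exact: measurable_addr_rV.
  transitivity (\int[mu]_x ((\1_(~` (B `|` Z)) x)%:E * K' (x - y)%R)).
    (* The kernel is evaluated at [x - y], so its exceptional set enters translated by [y], anew for
       each inner integral. *)
    apply: (@integral_lebesgue_ae_borel _ _ (Z `|` ((fun x : T => (x - y)%R) @^-1` ZK))) => //.
    - by apply: measurableC; exact: measurableU.
    - exact: measurableU.
    - by rewrite measureU0// -[LHS]/(mu _) borel_lebesgue_translate.
    - exact: subsetC.
    - move=> x nE; have [Zx|nZx] := pselect (Z x); first by right; left.
      by left => -[/BE|].
    - by move=> x; rewrite lee_fin.
    - apply: (measurableT_comp mK'); exact: measurable_addr_rV.
    - by move=> x nZ; rewrite KK'// => ZKx; apply: nZ; right.
  have mI (A : set T) : measurable A -> measurable_fun setT (fun x => (\1_A x)%:E * K' (x - y)%R).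
    move=> mA; apply: emeasurable_funM; first by apply/measurable_EFinP; exact: measurable_indic.
    by apply: (measurableT_comp mK'); exact: measurable_addr_rV.
  apply: ge0_ae_eq_integral => //.
  - by apply: mI; apply: measurableC; exact: measurableU.
  - by apply: mI; exact: measurableC.
  - by move=> x _; rewrite mule_ge0// lee_fin.
  - by move=> x _; rewrite mule_ge0// lee_fin.
  exists Z; split => // x /= /not_implyP[_ H]; apply: contrapT => nZ; apply: H.
  rewrite !indicE; congr ((_ : bool)%:R%:E * _); apply/idP/idP; rewrite !inE => //.
    by move=> h Bx; apply: h; left.
  by move=> nB [].
rewrite /nonlocal_perimeter; under eq_integral do rewrite inner.
apply: (@integral_lebesgue_ae_borel _ _ Z) => //.
- by move=> y; apply: integral_ge0 => x _; rewrite mule_ge0// lee_fin.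
- by move=> y; apply: integral_ge0 => x _; rewrite mule_ge0// lee_fin.
- apply: measurable_interaction_integrand => //.
  by apply: measurable_indic; exact: measurableC.
Qed.

End completion.

(** * Periodization and relaxed fundamental domains *)

Section countable_sums.
Context d (T : measurableType d) (R : realType) (m : {measure set T -> \bar R}).
Local Open Scope ereal_scope.

(** Turns a sum over a countable type into a series, to which measurability of limits and monotone
    convergence apply; sums over the lattice are handled in this way. *)
Lemma esum_pickle (I : countType) (a : I -> \bar R) : (forall i, 0 <= a i) ->
  \esum_(i in [set: I]) a i = \sum_(0 <= k <oo) oapp a 0 (pickle_inv k).
Proof.
move=> a0; rewrite nneseries_esumT; last by move=> k; case: (pickle_inv k).
rewrite [RHS](esumID [set k | isSome (@pickle_inv I k)])//; last first.
  by move=> k _; case: (pickle_inv k).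
rewrite [X in _ + X]esum1 ?adde0; last first.
  by move=> k [_ /=]; case: (pickle_inv k).
rewrite setTI (@reindex_esum _ _ _ [set: I] _ pickle).
  by apply: eq_esum => i _; rewrite pickleK_inv.
split => [k /= _|i j _ _|k /=]; first by rewrite pickleK_inv.
  exact: (pcan_inj pickleK_inv).
case E: (pickle_inv k) => [i|]// _; exists i => //.
by have := @pickle_invK I k; rewrite E.
Qed.

Lemma esum_unique (I : choiceType) (a : I -> \bar R) i0 : 0 <= a i0 ->
  (forall i, i != i0 -> a i = 0) -> \esum_(i in [set: I]) a i = a i0.
Proof.
move=> a0 ai; rewrite (esumID [set i0]); last first.
  by move=> i _; have [->|/ai ->] := eqVneq i i0.
rewrite setTI esum_set1// esum1 ?adde0// => i [_ /= ii0].
by apply: ai; apply/eqP.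
Qed.

Lemma esum_ge_seq (I : choiceType) (a : I -> \bar R) (s : seq I) : uniq s ->
  (forall i, 0 <= a i) -> \sum_(i <- s) a i <= \esum_(i in [set: I]) a i.
Proof.
move=> us a0; apply: esum_ge; exists [set` s]; first by split.
by rewrite fsbig_seq//.
Qed.

Lemma measurable_esum (I : countType) (F : I -> T -> \bar R) :
  (forall i, measurable_fun setT (F i)) -> (forall i x, 0 <= F i x) ->
  measurable_fun setT (fun x => \esum_(i in [set: I]) F i x).
Proof.
move=> mF F0.
rewrite (_ : (fun _ => _) = fun x => \sum_(0 <= k <oo) oapp (F ^~ x) 0 (pickle_inv k)); last first.
  by apply/funext => x; exact: esum_pickle.
apply: (@ge0_emeasurable_sum _ _ _ setT (fun k x => oapp (F ^~ x) 0 (@pickle_inv I k)) predT).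
  by move=> k x _ _; case: (pickle_inv k) => [i|]/=.
by move=> k _; case: (pickle_inv k) => [i|]/=.
Qed.

Lemma ge0_integral_esum (I : countType) (F : I -> T -> \bar R) (D : set T) : measurable D ->
  (forall i, measurable_fun setT (F i)) -> (forall i x, 0 <= F i x) ->
  \int[m]_(x in D) (\esum_(i in [set: I]) F i x) = \esum_(i in [set: I]) \int[m]_(x in D) F i x.
Proof.
move=> mD mF F0; under eq_integral do rewrite esum_pickle//.
rewrite (integral_nneseries m mD (f := fun k x => oapp (F ^~ x) 0 (@pickle_inv I k))).
- rewrite esum_pickle; last by move=> i; apply: integral_ge0.
  by apply: eq_eseriesr => k _; case: (pickle_inv k) => [i|]//=; rewrite integral0.
- move=> k; case: (pickle_inv k) => [i|]/=; last exact: measurable_cst.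
  exact: measurable_funTS.
- by move=> k x _; case: (pickle_inv k) => [i|]/=.
Qed.

Lemma eq_lee (x y : \bar R) : x = y -> x <= y.
Proof. by move=> ->. Qed.

Lemma integral_indicE (D : set T) (F : T -> \bar R) :
  \int[m]_(x in D) F x = \int[m]_x ((\1_D x)%:E * F x).
Proof.
by rewrite integral_mkcond epatch_indic; apply: eq_integral => x _; rewrite /= muleC.
Qed.

Lemma measurable_indicM (D : set T) (F : T -> \bar R) : measurable D ->
  measurable_fun setT F -> measurable_fun setT (fun x => (\1_D x)%:E * F x).
Proof.
by move=> mD mF; apply: emeasurable_funM => //; apply/measurable_EFinP; exact: measurable_indic.
Qed.

End countable_sums.

Section cells.
Variables (R : realType) (N : nat) (V : 'M[R]_N).
Hypothesis V0 : \det V != 0.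
Local Open Scope ereal_scope.

Local Notation T := 'rV[R]_N.
Local Notation mu := (@borel_lebesgue_measure R N).
Local Notation lp := (lattice_point V).

Definition cell : set T := (fun x : T => x *m invmx V) @^-1` @unit_box R N.

Definition cell_index (x : T) : 'rV[int]_N := map_mx Num.floor (x *m invmx V).

Lemma cellP (x : T) c : cell (x - lp c)%R <-> c = cell_index x.
Proof.
have uV : V \in unitmx by rewrite unitmxE unitfE.
rewrite /cell /= mulmxBl /lattice_point mulmxK//; split.
  move=> H; apply/rowP => i; have := H i; rewrite /cell_index !mxE => /andP[h1 h2].
  by apply/esym/floor_def; rewrite intrD; apply/andP; split; lra.
move=> -> i; rewrite !mxE subr_ge0 ltrBlDl -intrD1; exact: floor_itv.
Qed.

Lemma measurable_cell : measurable cell.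
Proof.
by apply: measurable_preimageT; [exact: measurable_mulmx_rV|exact: measurable_unit_box].
Qed.

Lemma borel_lebesgue_cell : mu cell = `|\det V|%:E.
Proof.
have dV' : (\det (invmx V) != 0)%R by rewrite det_inv invr_eq0.
have := scales_lebesgue_unit dV' (@measurable_unit_box R N).
rewrite det_inv borel_lebesgue_unit_box => E.
have dV : (`|\det V| != 0)%R by rewrite normr_eq0.
rewrite -[LHS]mul1e -[X in X%:E * _](mulfV dV) EFinM -muleA.
by rewrite -normfV [X in _ * X]E mule1.
Qed.

Lemma measurable_funD_rV (v : T) : measurable_fun setT (fun x : T => (x + v)%R).
Proof. exact: measurable_addr_rV. Qed.

Lemma integral_translate (F : T -> \bar R) (v : T) :
  measurable_fun setT F -> (forall x, 0 <= F x) ->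
  \int[mu]_x F (x + v)%R = \int[mu]_x F x.
Proof.
move=> mF F0.
transitivity (\int[image_measure mu (measurable_addr_rV v)]_x F x).
  by rewrite (@ge0_integral_pushforward _ _ _ _ _ _ (measurable_addr_rV v))// preimage_setT.
by apply: eq_measure_integral => A mA _; exact: borel_lebesgue_translate.
Qed.

(** Every point lies in exactly one lattice translate of the cell, so the indicators of these
    translates add up to 1 everywhere. *)
Lemma integral_fold (F : T -> \bar R) : measurable_fun setT F -> (forall x, 0 <= F x) ->
  \int[mu]_x F x = \int[mu]_(x in cell) \esum_(c in [set: 'rV[int]_N]) F (x + lp c)%R.
Proof.
move=> mF F0.
have mS c : measurable_fun setT (fun x : T => F (x + lp c)%R).
  by apply: (measurableT_comp mF); exact: measurable_funD_rV.
have mC c : measurable_fun setT (fun x : T => (\1_cell (x - lp c)%R)%:E * F x).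
  apply: emeasurable_funM => //; apply/measurable_EFinP.
  by apply: (measurableT_comp (measurable_indic measurable_cell)); exact: measurable_funD_rV.
rewrite ge0_integral_esum//; last exact: measurable_cell.
transitivity (\int[mu]_x \esum_(c in [set: 'rV[int]_N]) ((\1_cell (x - lp c)%R)%:E * F x)).
  apply: eq_integral => x _; rewrite (@esum_unique _ _ _ (cell_index x)).
  - by rewrite indicE mem_set ?mul1e//; apply/cellP.
  - by rewrite mule_ge0// lee_fin.
  - move=> c cx; rewrite indicE memNset ?mul0e// => /cellP; exact/eqP.
rewrite ge0_integral_esum//; last by move=> c x; rewrite mule_ge0// lee_fin.
apply: eq_esum => c _; rewrite -(integral_translate (lp c)) //.
  by rewrite [RHS]integral_indicE; apply: eq_integral => x _; rewrite addrK.
by move=> x; rewrite mule_ge0// lee_fin.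
Qed.

Definition periodic_set (W : set T) := forall c x, W (x + lp c)%R <-> W x.

Lemma indic_periodic W c x : periodic_set W -> \1_W (x + lp c)%R = \1_W x :> R.
Proof.
move=> pW; rewrite !indicE; congr (_%:R); apply: congr1.
by apply/idP/idP; rewrite !inE => /pW.
Qed.

Lemma integral_periodic W (F : T -> \bar R) : measurable W -> periodic_set W ->
  measurable_fun setT F -> (forall x, 0 <= F x) ->
  \int[mu]_(x in W) F x =
  \int[mu]_(x in W `&` cell) \esum_(c in [set: 'rV[int]_N]) F (x + lp c)%R.
Proof.
move=> mW pW mF F0; rewrite integral_indicE integral_fold; last 2 first.
- exact: measurable_indicM.
- by move=> x; rewrite mule_ge0// lee_fin.
rewrite [LHS]integral_indicE [RHS]integral_indicE; apply: eq_integral => x _.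
rewrite setIC indicI /= EFinM -muleA; congr (_ * _).
under eq_esum => c _ do rewrite indic_periodic//.
rewrite indicE; case: (_ \in _); last by rewrite mul0e esum1// => c _; rewrite mul0e.
by rewrite mul1e; apply: eq_esum => c _; rewrite mul1e.
Qed.

Definition saturation (B : set T) : set T := \bigcup_(c in [set: 'rV[int]_N])
  ((fun x : T => x + lp c)%R @^-1` B).

Lemma measurable_saturation B : measurable B -> measurable (saturation B).
Proof.
move=> mB; apply: countable_bigcupT_measurable => // c.
by apply: measurable_preimageT => //; exact: measurable_funD_rV.
Qed.

Lemma periodic_saturation B : periodic_set (saturation B).
Proof.
move=> c x; split => -[e _ Be].
  by exists (c + e)%R => //; rewrite /= lattice_pointD addrA.
by exists (e - c)%R => //=; rewrite lattice_pointB addrACA subrr addr0.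
Qed.

Lemma saturation_cell B : B `<=` cell -> saturation B `&` cell = B.
Proof.
move=> sB; apply/seteqP; split => [x [[c _ /= Bx] cx]|x Bx]; last first.
  by split; [exists 0%R => //=; rewrite lattice_point0 addr0|exact: sB].
suff -> : x = (x + lp c)%R by [].
have h1 : 0%R = cell_index x by apply/cellP; rewrite lattice_point0 subr0.
have h2 : (- c)%R = cell_index x by apply/cellP; rewrite lattice_pointN opprK; exact: sB.
have /eqP : (- c = 0 :> 'rV[int]_N)%R by rewrite h1 h2.
by rewrite oppr_eq0 => /eqP ->; rewrite lattice_point0 addr0.
Qed.

Lemma periodic_setC W : periodic_set W -> periodic_set (~` W).
Proof. by move=> pW c x; split => nW /(pW c x); apply: nW. Qed.

Lemma periodic_null W : measurable W -> periodic_set W -> mu (W `&` cell) = 0 -> mu W = 0.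
Proof.
move=> mW pW W0; rewrite -[LHS]mul1e -(integral_cst mu mW 1%:E).
rewrite integral_periodic//.
have mWc : measurable (W `&` cell) by apply: measurableI => //; exact: measurable_cell.
apply: null_set_integral => //.
by apply: measurable_funTS; apply: measurable_esum.
Qed.

(* A [0,1]-valued relaxation of a fundamental domain, resp. of a packing, for the
   lattice of [V]: the periodization is 1, resp. at most 1, tested on invariant sets. *)
Definition relaxed_packing (f : T -> R) :=
  [/\ measurable_fun setT f, forall x, (0 <= f x <= 1)%R &
    forall W, measurable W -> periodic_set W ->
      \int[mu]_(x in W) (f x)%:E <= mu (W `&` cell)].

Definition relaxed_domain (f : T -> R) :=
  [/\ measurable_fun setT f, forall x, (0 <= f x <= 1)%R &
    forall W, measurable W -> periodic_set W ->
      \int[mu]_(x in W) (f x)%:E = mu (W `&` cell)].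

Lemma relaxed_domain_packing f : relaxed_domain f -> relaxed_packing f.
Proof. by move=> [mf f01 H]; split => // W mW pW; rewrite H. Qed.

Definition periodization (f : T -> R) x := \esum_(c in [set: 'rV[int]_N]) (f (x + lp c)%R)%:E.

Lemma periodization_ge0 (f : T -> R) x : (forall x, 0 <= f x)%R -> 0 <= periodization f x.
Proof. by move=> f0; apply: esum_ge0 => c _; rewrite lee_fin. Qed.

Lemma measurable_periodization (f : T -> R) : (forall x, 0 <= f x)%R -> measurable_fun setT f ->
  measurable_fun setT (periodization f).
Proof.
move=> f0 mf; apply: measurable_esum => // c; last by move=> x; rewrite lee_fin.
apply/measurable_EFinP; apply: (measurableT_comp mf); exact: measurable_funD_rV.
Qed.

Lemma integral_periodization W (f : T -> R) : measurable W -> periodic_set W ->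
  measurable_fun setT f -> (forall x, 0 <= f x)%R ->
  \int[mu]_(x in W) (f x)%:E = \int[mu]_(x in W `&` cell) periodization f x.
Proof.
move=> mW pW mf f0; apply: integral_periodic => //; exact/measurable_EFinP.
Qed.

Lemma integral_relaxed_domain f : relaxed_domain f -> \int[mu]_x (f x)%:E = `|\det V|%:E.
Proof.
move=> [_ _ H]; have pT : periodic_set setT by [].
rewrite (H _ measurableT pT).
by rewrite setTI borel_lebesgue_cell.
Qed.

Lemma integral_relaxed_packing f : relaxed_packing f -> \int[mu]_x (f x)%:E <= `|\det V|%:E.
Proof.
move=> [_ _ H]; rewrite -borel_lebesgue_cell -[X in mu X](setTI cell).
by apply: H.
Qed.

(** An integrated form of the statement that distinct translates of [f] add up to at most 1. It
    holds on arbitrary, not only invariant, sets [A], and is the form in which the packing condition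
    is used later. *)
Lemma relaxed_packing_sum f (s : seq 'rV[int]_N) (A : set T) : relaxed_packing f ->
  uniq s -> measurable A -> \sum_(c <- s) \int[mu]_(x in A) (f (x + lp c)%R)%:E <= mu A.
Proof.
move=> [mf f01 H] us mA.
have mfc c : measurable_fun setT (fun x : T => (f (x + lp c)%R)%:E).
  by apply/measurable_EFinP; apply: (measurableT_comp mf); exact: measurable_funD_rV.
have f0 x : (0 <= f x)%R by have /andP[] := f01 x.
(* The saturation of a subset [B] of the cell is invariant and meets the cell exactly in [B]; this
   localises the bound on invariant sets. *)
have local (B : set T) : measurable B -> B `<=` cell ->
    \int[mu]_(x in B) periodization f x <= mu B.
  move=> mB sB; rewrite -{1 2}(saturation_cell sB) -integral_periodization//.
  - by apply: H; [exact: measurable_saturation|exact: periodic_saturation].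
  - exact: measurable_saturation.
  - exact: periodic_saturation.
rewrite -ge0_integral_sum//; last 2 first.
- by move=> c; exact: measurable_funTS.
- by move=> c x _; rewrite lee_fin.
have mP : measurable_fun setT (fun x : T => (\1_A x)%:E * periodization f x).
  by apply: measurable_indicM => //; exact: measurable_periodization.
have P0 x : 0 <= (\1_A x)%:E * periodization f x.
  by rewrite mule_ge0 ?periodization_ge0// lee_fin.
apply: (@le_trans _ _ (\int[mu]_(x in A) periodization f x)).
  apply: ge0_le_integral => //.
  - by move=> x _; apply: sume_ge0 => c _; rewrite lee_fin.
  - by apply: measurable_funTS; apply: emeasurable_sum.
  - by apply: measurable_funTS; exact: measurable_periodization.
  - by move=> x _; apply: esum_ge_seq => // c; rewrite lee_fin.
rewrite integral_indicE integral_fold// -[leRHS]mul1e -(integral_cst mu mA 1%:E).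
rewrite [leRHS]integral_indicE integral_fold; last 2 first.
- by apply: measurable_indicM.
- by move=> x; rewrite mule_ge0// lee_fin.
rewrite ge0_integral_esum//; last 2 first.
- exact: measurable_cell.
- by move=> c; apply: (measurableT_comp mP); exact: measurable_funD_rV.
rewrite ge0_integral_esum//; last 3 first.
- exact: measurable_cell.
- move=> c; apply: (@measurableT_comp _ _ _ _ _ _ (fun x : T => (\1_A x)%:E * 1%:E)).
    exact: measurable_indicM.
  exact: measurable_funD_rV.
- by move=> c x; rewrite mule_ge0// lee_fin.
apply: le_esum => c _.
pose B := cell `&` (fun x : T => x + lp c)%R @^-1` A.
have mB : measurable B.
  apply: measurableI; first exact: measurable_cell.
  by apply: measurable_preimageT => //; exact: measurable_funD_rV.
have BE (x : T) : \1_B x = (\1_cell x * \1_A (x + lp c))%R :> R by rewrite indicI.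
apply: (@le_trans _ _ (\int[mu]_(x in B) periodization f x)).
  rewrite [leRHS]integral_indicE [leLHS]integral_indicE.
  apply/eq_lee/eq_integral => x _; rewrite BE EFinM -muleA; congr (_ * (_ * _)).
  rewrite /periodization (@reindex_esum _ _ _ [set: 'rV[int]_N] setT (fun e => (e - c)%R)).
    by apply: eq_esum => e _; rewrite lattice_pointB addrA addrAC addrK.
  split => //; first by move=> e e' _ _ /addIr.
  by move=> e _; exists (e + c)%R => //; rewrite addrK.
apply: (@le_trans _ _ (mu B)); first by apply: local => // x [].
rewrite -[leLHS]mul1e -(integral_cst mu mB 1%:E) [leLHS]integral_indicE [leRHS]integral_indicE.
by apply/eq_lee/eq_integral => x _; rewrite BE EFinM -muleA.
Qed.

End cells.

Section relaxed_domains.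
Variables (R : realType) (N : nat).
Local Open Scope ereal_scope.

Local Notation T := 'rV[R]_N.
Local Notation mu := (@borel_lebesgue_measure R N).
Local Notation shift v := (fun x : T => (x + v)%R).

Lemma measurable_shift (A : set T) v : measurable A -> measurable (shift v @^-1` A).
Proof. by move=> mA; apply: measurable_preimageT => //; exact: measurable_addr_rV. Qed.

Lemma null_bigcup (J : countType) (F : J -> set T) :
  (forall i, measurable (F i)) -> (forall i, mu (F i) = 0) -> mu (\bigcup_i F i) = 0.
Proof.
move=> mF F0.
have mU : measurable (\bigcup_i F i) by apply: countable_bigcupT_measurable.
apply/negligibleP => //; apply: (negligibleS (A := \bigcup_k (oapp F set0 (@pickle_inv J k)))).
  by move=> x [i _ Fx]; refine (ex_intro2 _ _ (pickle i) I _); rewrite pickleK_inv.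
apply: negligible_bigcup => k; case: (pickle_inv k) => [i|]/=; last exact: negligible_set0.
by apply/negligibleP => //; exact: F0.
Qed.

Lemma integral_gt0_null d (S : measurableType d) (m : {measure set S -> \bar R})
    (D : set S) (h : S -> \bar R) : measurable D -> measurable_fun D h ->
  (forall x, D x -> 0 < h x) -> \int[m]_(x in D) h x = 0 -> m D = 0.
Proof.
move=> mD mh h0 ih.
have : \int[m]_(x in D) `|h x| = 0.
  by rewrite -ih; apply: eq_integral => x; rewrite inE => /h0 hx; rewrite gee0_abs// ltW.
move=> /(ae_eq_integral_abs m mD mh)[M [mM M0 sM]].
apply: (subset_measure0 mD mM _ M0) => x Dx; apply: sM => /= /(_ Dx) hx.
by have := h0 x Dx; rewrite hx ltxx.
Qed.

(** The positive function [g - 1] has nonpositive integral over [D]; finiteness of [m D] allows the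
    subtraction. *)
Lemma integral_le_measure_null d (S : measurableType d) (m : {measure set S -> \bar R})
    (D : set S) (g : S -> \bar R) : measurable D -> m D < +oo -> measurable_fun D g ->
  (forall x, D x -> 1 < g x) -> \int[m]_(x in D) g x <= m D -> m D = 0.
Proof.
move=> mD Dfin mg g1; have mDfin : m D \is a fin_num by rewrite ge0_fin_numE.
have mh : measurable_fun D (fun x => g x - 1) by exact: emeasurable_funB.
have h0 x : D x -> 0 < g x - 1 by move=> /g1 gx; rewrite sube_gt0.
have -> : \int[m]_(x in D) g x = \int[m]_(x in D) (g x - 1) + m D.
  rewrite -[X in _ + X]mul1e -(integral_cst m mD 1%:E) -ge0_integralD//.
  - by apply: eq_integral => x _; rewrite subeK.
  - by move=> x /h0 /ltW.
rewrite -[leRHS]add0e leeD2rE// => le0; apply: (integral_gt0_null mD mh h0).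
by apply/eqP; rewrite eq_le le0; apply: integral_ge0 => x /h0 /ltW.
Qed.

Section tiles.
Variable V : 'M[R]_N.
Hypothesis V0 : \det V != 0%R.
Local Notation lp := (lattice_point V).

Definition packs (E : set T) := forall c, c != 0%R -> mu (E `&` shift (lp c) @^-1` E) = 0.

Lemma packs_overlap_null (E : set T) : measurable E -> packs E ->
  mu (\bigcup_(p in [set: 'rV[int]_N * 'rV[int]_N])
    if p.1 == p.2 then set0 else shift (lp p.1) @^-1` E `&` shift (lp p.2) @^-1` E) = 0.
Proof.
move=> mE pE; apply: null_bigcup => -[c e] /=; case: eqP => [//|ce].
- by apply: measurableI; exact: measurable_shift.
- have -> : shift (lp c) @^-1` E `&` shift (lp e) @^-1` E =
      shift (lp c) @^-1` (E `&` shift (lp (e - c)) @^-1` E).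
    rewrite preimage_setI; congr (_ `&` _); apply/funext => x.
    by rewrite /preimage /= lattice_pointB [(lp e - lp c)%R]addrC addrA addrK.
  rewrite borel_lebesgue_translate; last by apply: measurableI => //; exact: measurable_shift.
  by apply: pE; rewrite subr_eq0; apply/eqP => ec; apply: ce.
Qed.

Lemma periodization_indic (E : set T) x :
  (forall c e, c != e -> ~ (E (x + lp c)%R /\ E (x + lp e)%R)) ->
  periodization V (\1_E) x = (\1_(saturation V E) x)%:E.
Proof.
move=> H; rewrite [in RHS]indicE; have [|nE] := boolP (x \in saturation V E).
  rewrite inE => -[c _ Ec]; rewrite /periodization (@esum_unique _ _ _ c).
  - by rewrite indicE mem_set.
  - by rewrite lee_fin.
  - by move=> e ec; rewrite indicE memNset// => Ee; exact: (H e c ec).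
rewrite /periodization esum1// => c _; rewrite indicE memNset// => Ec.
by move: nE; rewrite notin_setE; apply; exists c.
Qed.

(** Off the null set of overlaps, the periodization of the indicator of [E] is the indicator of the
    saturation of [E]. *)
Lemma integral_indic_periodic W (E : set T) : measurable W -> periodic_set V W ->
  measurable E -> packs E ->
  \int[mu]_(x in W) (\1_E x)%:E = mu (W `&` cell V `&` saturation V E).
Proof.
move=> mW pW mE pE; rewrite (integral_periodization V0 mW pW (measurable_indic mE))//.
have mc := measurable_cell V; have mS := measurable_saturation V mE.
have mWc : measurable (W `&` cell V) by exact: measurableI.
rewrite -[RHS]mul1e -(integral_cst mu _ 1%:E)//; last exact: measurableI.
rewrite [RHS]integral_mkcondr.
have -> : (cst 1 : T -> \bar R) \_ (saturation V E) = (fun x => (\1_(saturation V E) x)%:E).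
  by apply/funext => x; rewrite epatch_indic /= mul1e.
have := packs_overlap_null mE pE; set Z := \bigcup_(_ in _) _ => Z0.
have mZ : measurable Z.
  apply: countable_bigcupT_measurable => // -[c e] /=; case: eqP => // _.
  by apply: measurableI; exact: measurable_shift.
apply: ge0_ae_eq_integral => //.
- by apply: measurable_funTS; apply: measurable_periodization => //; exact: measurable_indic.
- by apply: measurable_funTS; apply/measurable_EFinP; exact: measurable_indic.
- by move=> x _; apply: periodization_ge0.
exists Z; split => // x /= /not_implyP[_ H]; apply: contrapT => nZ; apply: H.
rewrite periodization_indic// => c e ce [Ec Ee]; apply: nZ.
by exists (c, e) => //=; rewrite (negbTE ce).
Qed.

Lemma relaxed_packing_indic (E : set T) : measurable E -> packs E ->
  relaxed_packing V (\1_E).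
Proof.
move=> mE pE; split; first exact: measurable_indic.
  by move=> x; rewrite indicE; case: (_ \in _); rewrite lexx ler01.
move=> W mW pW; rewrite integral_indic_periodic//; apply: le_measure.
- rewrite inE; apply: measurableI; last exact: measurable_saturation.
  by apply: measurableI => //; exact: measurable_cell.
- by rewrite inE; apply: measurableI => //; exact: measurable_cell.
- by move=> x [].
Qed.

Lemma relaxed_domain_indic (E : set T) : measurable E -> packs E ->
  mu (~` saturation V E) = 0 -> relaxed_domain V (\1_E).
Proof.
move=> mE pE cE; split; first exact: measurable_indic.
  by move=> x; rewrite indicE; case: (_ \in _); rewrite lexx ler01.
move=> W mW pW; rewrite integral_indic_periodic//.
have mS := measurable_saturation V mE.
have mWc : measurable (W `&` cell V) by apply: measurableI => //; exact: measurable_cell.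
rewrite -[X in _ = mu X](setUIDK (W `&` cell V) (saturation V E)) setDE measureU0//.
- exact: measurableI.
- by apply: measurableI => //; exact: measurableC.
- apply: (subset_measure0 _ _ _ cE) => //; last exact: measurableC.
  by apply: measurableI => //; exact: measurableC.
Qed.

Lemma packing_measure_le (E : set T) : measurable E -> packs E -> mu E <= `|\det V|%:E.
Proof.
move=> mE pE; have := integral_relaxed_packing V0 (relaxed_packing_indic mE pE).
by rewrite integral_indic// setIT.
Qed.

(** The deficit [1 - s] of the periodization [s] is placed on the cell, which contains one point of
    each orbit. *)
Lemma relaxed_packing_fill (f : T -> R) : relaxed_packing V f ->
  exists r : T -> R, [/\ measurable_fun setT r, forall x, (0 <= r x)%R,
    relaxed_domain V (fun x => f x + r x)%R &
    \int[mu]_x (r x)%:E + \int[mu]_x (f x)%:E = `|\det V|%:E].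
Proof.
move=> [mf f01 Hf]; have f0 x : (0 <= f x)%R by have /andP[] := f01 x.
have mc := measurable_cell V.
pose s : T -> \bar R := periodization V f.
have ms : measurable_fun setT s by exact: measurable_periodization.
have s0 x : 0 <= s x by exact: periodization_ge0.
have fs x : (f x)%:E <= s x.
  apply: le_trans (@esum_ge_seq _ _ _ [:: 0%R] _ _) => //.
  - by rewrite big_seq1 lattice_point0 addr0.
  - by move=> c; rewrite lee_fin.
(* The maximum with 0 covers the points where [s] exceeds 1; if [s x] is infinite, [fine] returns 0
   and nothing is added. *)
pose r x : R := (\1_(cell V) x * Num.max 0 (fine (1%:E - s x)))%R.
have r0 x : (0 <= r x)%R by rewrite mulr_ge0// le_max lexx.
have mr : measurable_fun setT r.
  apply: measurable_funM; first exact: measurable_indic.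
  apply: measurable_maxr => //; apply: (measurableT_comp (@fine_measurable R setT measurableT)).
  exact: emeasurable_funB.
have fr1 x : (f x + r x <= 1)%R.
  have /andP[_ fx1] := f01 x.
  rewrite /r indicE; case: (_ \in _); rewrite ?mul0r ?addr0// mul1r.
  have := fs x; have := s0 x; case: (s x) => [t||]//=.
    by rewrite !lee_fin => t0 ft; rewrite addr_maxr addr0 ge_max fx1/= -lerBrDl lerB.
  by rewrite maxxx addr0.
pose B := cell V `&` [set x | 1 < s x].
have mB : measurable B.
  by apply: measurableI => //; rewrite -[X in measurable X]setTI; exact: emeasurable_fun_o_infty.
have B0 : mu B = 0.
  have mS := measurable_saturation V mB.
  have pS := periodic_saturation V B.
  have := Hf _ mS pS; rewrite (integral_periodization V0)// saturation_cell//; last by move=> x [].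
  have Bfin : mu B < +oo.
    apply: (@le_lt_trans _ _ (mu (cell V))).
      by apply: le_measure; rewrite ?inE// => x [].
    by rewrite borel_lebesgue_cell// ltry.
  by apply: integral_le_measure_null => //; [exact: measurable_funTS|move=> x []].
have E W : measurable W -> periodic_set V W ->
    \int[mu]_(x in W) (f x + r x)%:E = mu (W `&` cell V).
  move=> mW pW; have mWc : measurable (W `&` cell V) by exact: measurableI.
  under eq_integral do rewrite EFinD.
  rewrite ge0_integralD//; last 4 first.
  - by move=> x _; rewrite lee_fin.
  - by apply: measurable_funTS; exact/measurable_EFinP.
  - by move=> x _; rewrite lee_fin.
  - by apply: measurable_funTS; exact/measurable_EFinP.
  rewrite (integral_periodization V0)//.
  have -> : \int[mu]_(x in W) (r x)%:E = \int[mu]_(x in W `&` cell V) (r x)%:E.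
    rewrite [LHS]integral_indicE [RHS]integral_indicE; apply: eq_integral => x _.
    by rewrite -!EFinM indicI /= /r [(\1_(cell V) x)%R]indicE; case: (_ \in _); rewrite ?(mul0r,mulr0,mulr1).
  rewrite -ge0_integralD//; last 3 first.
  - by apply: measurable_funTS.
  - by move=> x _; rewrite lee_fin.
  - by apply: measurable_funTS; exact/measurable_EFinP.
  rewrite -[RHS]mul1e -(integral_cst mu mWc 1%:E); apply: ge0_ae_eq_integral => //.
  - by apply: measurable_funTS; apply: emeasurable_funD => //; exact/measurable_EFinP.
  - by move=> x _; rewrite adde_ge0// lee_fin.
  exists B; split => // x /= /not_implyP[[_ cx] H]; split => //=; rewrite ltNge; apply/negP => s1.
  apply: H; rewrite /r indicE mem_set// mul1r -/(s x).
  move: (s0 x) s1; case: (s x) => [t||]//=; rewrite !lee_fin => _ t1.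
  by rewrite max_r ?subr_ge0// -EFinD addrCA subrr addr0.
have f1 x : (0 <= f x + r x <= 1)%R by rewrite fr1 addr_ge0.
have mfr : measurable_fun setT (fun x => f x + r x)%R by exact: measurable_funD.
have DD : relaxed_domain V (fun x => f x + r x)%R by split.
exists r; split => //.
rewrite -(integral_relaxed_domain V0 DD) addeC -ge0_integralD//.
- by move=> x _; rewrite lee_fin.
- exact/measurable_EFinP.
- by move=> x _; rewrite lee_fin.
- exact/measurable_EFinP.
Qed.

(** The support [D] packs, so its measure is at most [|\det V|], which is the integral of [f]. As
    [f <= \1_D], the two functions agree almost everywhere. *)
Lemma relaxed_domain_support (f : T -> R) : relaxed_domain V f ->
  packs [set x | 0 < f x]%R ->
  mu (~` saturation V [set x | 0 < f x]%R) = 0 /\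
  ae_eq mu setT f (\1_[set x | 0 < f x]%R).
Proof.
move=> Df pD; have [mf f01 Hf] := Df; set D := [set x | _].
have mD : measurable D.
  have -> : D = setT `&` [set x | 0 < (EFin \o f) x].
    by rewrite setTI; apply/seteqP; split => x /=; rewrite lte_fin.
  by apply: emeasurable_fun_o_infty => //; exact/measurable_EFinP.
have mS : measurable (~` saturation V D) by apply: measurableC; exact: measurable_saturation.
have pS : periodic_set V (~` saturation V D).
  by apply: periodic_setC; exact: periodic_saturation.
have fD x : ~ D x -> f x = 0%R.
  by move=> /negP; rewrite -leNgt => fx; apply/eqP; rewrite eq_le fx; have /andP[] := f01 x.
split.
  apply: (periodic_null V0 mS pS); rewrite -Hf//; apply: integral0_eq => x /= nS.
  by rewrite fD// => Dx; apply: nS; exists 0%R => //=; rewrite lattice_point0 addr0.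
have f0 x : (0 <= f x)%R by have /andP[] := f01 x.
have h0 x : (0 <= \1_D x - f x)%R.
  rewrite indicE; case: (boolP (x \in D)) => [_|].
    by rewrite subr_ge0; have /andP[] := f01 x.
  by rewrite notin_setE => /fD ->; rewrite subrr.
have mI : measurable_fun setT (\1_D : T -> R) by exact: measurable_indic.
have mh : measurable_fun setT (fun x => (\1_D x - f x)%:E).
  by apply/measurable_EFinP; exact: measurable_funB.
have : \int[mu]_x (\1_D x)%:E <= \int[mu]_x (f x)%:E.
  by rewrite (integral_relaxed_domain V0 Df) integral_indic// setIT; exact: packing_measure_le.
have -> : \int[mu]_x (\1_D x)%:E = \int[mu]_x (\1_D x - f x)%:E + \int[mu]_x (f x)%:E.
  rewrite -ge0_integralD//.
  - by apply: eq_integral => x _; rewrite -EFinD subrK.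
  - by first [exact/measurable_EFinP | move=> x _; rewrite lee_fin].
  - by first [exact/measurable_EFinP | move=> x _; rewrite lee_fin].
  - exact/measurable_EFinP.
rewrite -[leRHS]add0e leeD2rE; last by rewrite (integral_relaxed_domain V0 Df).
move=> le0; have : \int[mu]_x `|(\1_D x - f x)%:E| = 0.
  apply/eqP; rewrite eq_le integral_ge0// andbT; apply: le_trans le0.
  by apply/eq_lee/eq_integral => x _; rewrite gee0_abs// lee_fin.
move=> /(ae_eq_integral_abs mu measurableT mh)[Z [mZ Z0 sZ]].
exists Z; split => // x /= H; apply: sZ => /= H'; apply: H => _.
by have /eqP := H' I; rewrite eqe subr_eq0 => /eqP ->.
Qed.

End tiles.

Section basis_change.
Variables V W : 'M[R]_N.
Hypotheses (V0 : \det V != 0%R) (W0 : \det W != 0%R) (VW : Zspan_rows W = Zspan_rows V).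

Lemma lattice_point_change c : exists e, lattice_point V c = lattice_point W e.
Proof.
have : Zspan_rows W (lattice_point V c) by rewrite VW Zspan_rowsE; exists c.
by rewrite Zspan_rowsE => -[e _ <-]; exists e.
Qed.

Lemma periodic_set_change A : periodic_set W A -> periodic_set V A.
Proof. by move=> pA c x; have [e ->] := lattice_point_change c. Qed.

(** The cell of [W] tiles under the lattice of [V], being the same lattice, so its indicator is a
    relaxed domain for [V]; testing that on [A] gives the equality. *)
Lemma measure_cell_change A : measurable A -> periodic_set V A ->
  mu (A `&` cell W) = mu (A `&` cell V).
Proof.
move=> mA pA; have mc := measurable_cell W.
have [_ _ <-//] : relaxed_domain V (\1_(cell W)).
  apply: relaxed_domain_indic => //.
    move=> c c0; have [e ce] := lattice_point_change c.
    rewrite (_ : _ `&` _ = set0) ?measure0//; apply/seteqP; split => // x [x1 /=].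
    rewrite ce => x2; have h1 : 0%R = cell_index W x by apply/(cellP W0); rewrite lattice_point0 subr0.
    have h2 : (- e)%R = cell_index W x by apply/(cellP W0); rewrite lattice_pointN opprK.
    have e0 : e = 0%R by apply/eqP; rewrite -oppr_eq0 h2 -h1.
    move: c0; rewrite -(inj_eq (lattice_point_inj V0)) ce e0 !lattice_point0.
    by rewrite eqxx.
  rewrite (_ : saturation V (cell W) = setT) ?setCT ?measure0//.
  apply/seteqP; split => // x _.
  have [e ex] : exists e, lattice_point V e = lattice_point W (- cell_index W x).
    have : Zspan_rows V (lattice_point W (- cell_index W x)%R).
      by rewrite -VW Zspan_rowsE; exists (- cell_index W x)%R.
    by rewrite Zspan_rowsE => -[e _ <-]; exists e.
  by exists e => //=; rewrite ex lattice_pointN; apply/(cellP W0).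
by rewrite integral_indic// setIC.
Qed.

End basis_change.

Lemma relaxed_domain_change (V W : 'M[R]_N) f : \det V != 0%R -> \det W != 0%R ->
  Zspan_rows W = Zspan_rows V -> relaxed_domain V f -> relaxed_domain W f.
Proof.
move=> V0 W0 VW [mf f01 H]; split => // A mA pA.
have pVA := periodic_set_change VW pA.
by rewrite H// (measure_cell_change V0 W0 VW).
Qed.

Lemma fundamental_domains_relaxed (V : 'M[R]_N) (E : set T) : \det V != 0%R ->
  fundamental_domains (Zspan_rows V) E -> exists B Z : set T,
    [/\ measurable B, measurable Z & mu Z = 0] /\
    [/\ B `<=` E, E `<=` B `|` Z & relaxed_domain V (\1_B)].
Proof.
move=> V0 [mE cE pE]; have [B [Z [mB mZ Z0 BE EBZ]]] := lebesgue_rV_core mE.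
exists B, Z; split => //; split => //; apply: relaxed_domain_indic => //.
  move=> c c0; apply/eqP; rewrite eq_le measure_ge0 andbT.
  have mBB : measurable (B `&` shift (lattice_point V c) @^-1` B).
    by apply: measurableI => //; exact: measurable_shift.
  rewrite -[leLHS]/(mu _) -lebesgue_rV_borel// -(pE (- lattice_point V c)%R).
  - apply: le_lebesgue_rV => x [/BE Ex /BE Ex']; split => //.
    by exists (x + lattice_point V c)%R; rewrite ?addrK.
  - by rewrite Zspan_rowsE; exists (- c)%R => //; rewrite lattice_pointN.
  - rewrite oppr_eq0; apply: contra c0 => /eqP lc; apply/eqP/(lattice_point_inj V0).
    by rewrite lc lattice_point0.
have [H [mH sH H0]] := lebesgue_rV_hull (~` \bigcup_(g in Zspan_rows V) translate E g).
(* [Y] collects the translates of the null part of [E] lost in passing to [B]: off [H] and [Y], a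
   point covered by a translate of [E] is covered by the same translate of [B]. *)
rewrite [RHS]cE in H0; pose Y := \bigcup_(c in [set: 'rV[int]_N]) shift (lattice_point V c) @^-1` Z.
have mY : measurable Y by exact: (measurable_saturation V mZ).
have Y0 : mu Y = 0.
  apply: null_bigcup => c; first exact: measurable_shift.
  by rewrite borel_lebesgue_translate.
have mHY : measurable (H `|` Y) by exact: measurableU.
have HY0 : mu (H `|` Y) = 0 by rewrite measureU0// -[LHS]/(mu H) H0.
apply: (subset_measure0 _ mHY _ HY0).
- by apply: measurableC; exact: measurable_saturation.
- move=> x nS; have [Hx|nH] := pselect (H x); [by left|right].
  have : (\bigcup_(g in Zspan_rows V) translate E g) x.
    by apply: contrapT => nU; apply: nH; exact: sH.
  rewrite Zspan_rowsE => -[_ [c _ <-] [y Ey yx]].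
  have xy : y = (x + lattice_point V (- c))%R by rewrite lattice_pointN -yx addrK.
  case: (EBZ _ Ey) => [By|Zy]; last by exists (- c)%R => //=; rewrite -xy.
  by case: nS; exists (- c)%R => //=; rewrite -xy.
Qed.

Lemma relaxed_fundamental_domain (V : 'M[R]_N) (D : set T) : \det V != 0%R ->
  measurable D -> packs V D -> mu (~` saturation V D) = 0 ->
  fundamental_domains (Zspan_rows V) D.
Proof.
move=> V0 mD pD cD; split; first exact: borel_lebesgue_measurable.
  have -> : \bigcup_(g in Zspan_rows V) translate D g = saturation V D.
    rewrite Zspan_rowsE; apply/seteqP; split => x.
      move=> [_ [c _ <-] [y Dy <-]]; exists (- c)%R => //=.
      by rewrite lattice_pointN addrK.
    move=> [c _ /= Dx]; exists (lattice_point V (- c)); first by exists (- c)%R.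
    by exists (x + lattice_point V c)%R => //; rewrite lattice_pointN addrK.
  by rewrite lebesgue_rV_borel//; apply: measurableC; exact: measurable_saturation.
move=> g; rewrite Zspan_rowsE => -[c _ <-] c0.
have -> : translate D (lattice_point V c) = shift (lattice_point V (- c)) @^-1` D.
  apply/seteqP; split => x.
    by move=> [y Dy <-]; rewrite /preimage/= lattice_pointN addrK.
  by move=> /= Dx; exists (x + lattice_point V (- c))%R => //; rewrite lattice_pointN subrK.
rewrite lebesgue_rV_borel; last by apply: measurableI => //; exact: measurable_shift.
apply: pD; rewrite oppr_eq0; apply: contra c0 => /eqP ->; rewrite lattice_point0.
by [].
Qed.

End relaxed_domains.

(** * Volume arguments with cubes: covering radius and short vectors *)

Section cubes.
Variables (R : realType) (N : nat).

Local Notation T := 'rV[R]_N.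
Local Notation mu := (@borel_lebesgue_measure R N).
Local Notation shift v := (fun x : T => x + v).

Definition cube (r : R) : set T := [set x | `|x| <= r].

Lemma measurable_cube r : measurable (cube r).
Proof.
have [r0|r0] := leP 0 r.
  rewrite (_ : cube r = [set x | forall i, x ord0 i \in `[- r, r]]); first exact: measurable_boxes.
  apply/seteqP; split => x /= H.
    move=> i; rewrite in_itv/= -ler_norml; apply: le_trans H.
    exact: entry_le_norm.
  by apply: norm_le_entries => // i j; rewrite ord1 ler_norml; have := H j; rewrite in_itv.
rewrite (_ : cube r = set0)//; apply/seteqP; split => // x /= xr.
by have := lt_le_trans (le_lt_trans xr r0) (normr_ge0 x); rewrite ltxx.
Qed.

Lemma measurable_shift_cube r v : measurable (shift v @^-1` cube r).
Proof. by apply: measurable_shift; exact: measurable_cube. Qed.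

Lemma borel_lebesgue_dilate (a : R) (A : set T) : 0 < a -> measurable A ->
  mu ((fun x : T => a^-1 *: x) @^-1` A) = ((a ^+ N)%:E * mu A)%E.
Proof.
move=> a0 mA; have aN : a ^+ N != 0 by rewrite expf_neq0// gt_eqF.
have d : \det ((a^-1)%:M : 'M[R]_N) != 0 by rewrite det_scalar expf_neq0// invr_eq0 gt_eqF.
rewrite -(scales_lebesgue_unit d mA) det_scalar muleA normrX normfV gtr0_norm//.
rewrite -EFinM exprVn mulfV// mul1e; congr (mu _).
by apply/funext => x; rewrite /preimage/= mul_mx_scalar.
Qed.

Lemma cube_lty r : (mu (cube r) < +oo)%E.
Proof.
pose a := `|r| + `|r| + 1; have a0 : 0 < a by rewrite ltr_wpDl// addr_ge0.
pose w : T := const_mx `|r|.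
pose A := shift w @^-1` ((fun x : T => a^-1 *: x) @^-1` @unit_box R N).
have mD : measurable ((fun x : T => a^-1 *: x) @^-1` @unit_box R N).
  rewrite (_ : _ @^-1` _ = (fun x : T => x *m (a^-1)%:M) @^-1` @unit_box R N).
    by apply: measurable_preimageT; [exact: measurable_mulmx_rV|exact: measurable_unit_box].
  by apply/funext => x; rewrite /preimage/= mul_mx_scalar.
apply: (@le_lt_trans _ _ (mu A)).
  apply: le_measure; rewrite ?inE; [exact: measurable_cube|exact: measurable_shift|].
  move=> x xr i; have : `|x ord0 i| <= `|r|.
    by apply: le_trans (ler_norm _); apply: le_trans xr; exact: entry_le_norm.
  rewrite /= !mxE ler_norml => /andP[h1 h2].
  by rewrite mulr_ge0 ?invr_ge0 ?(ltW a0)//= -?lerBlDr ?sub0r// mulrC ltr_pdivrMr// mul1r /a; lra.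
rewrite borel_lebesgue_translate// borel_lebesgue_dilate//; last exact: measurable_unit_box.
by rewrite borel_lebesgue_unit_box mule1 ltry.
Qed.

Lemma cube_gt0 r : 0 < r -> (0 < mu (cube r))%E.
Proof.
move=> r0; apply: (@lt_le_trans _ _ (mu ((fun x : T => r^-1 *: x) @^-1` @unit_box R N))).
  rewrite borel_lebesgue_dilate//; last exact: measurable_unit_box.
  by rewrite borel_lebesgue_unit_box mule1 lte_fin exprn_gt0.
apply: le_measure; rewrite ?inE; [|exact: measurable_cube|].
  rewrite (_ : _ @^-1` _ = (fun x : T => x *m (r^-1)%:M) @^-1` @unit_box R N).
    by apply: measurable_preimageT; [exact: measurable_mulmx_rV|exact: measurable_unit_box].
  by apply/funext => x; rewrite /preimage/= mul_mx_scalar.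
move=> x xr; apply: norm_le_entries => [|i j]; first exact: ltW.
have := xr j; rewrite !mxE mulrC => /andP[h1 h2].
rewrite [i]ord1 ger0_norm; first by rewrite -[leRHS]mul1r -ler_pdivrMr// ltW.
by move: h1; rewrite pmulr_lge0// invr_gt0.
Qed.

Lemma cube_fin_num r : mu (cube r) \is a fin_num.
Proof. by rewrite ge0_fin_numE// cube_lty. Qed.

Lemma bigcup_cube : \bigcup_k cube k%:R = setT.
Proof.
apply/seteqP; split => // x _; exists (Num.bound `|x|) => //=.
by rewrite /cube/= ltW// archi_boundP.
Qed.

(** If a point is very far from the lattice, the segment joining it to a nearly closest lattice
    point carries many cubes that are disjoint modulo the lattice. Together they exceed the covolume
    [m]. *)
Lemma covering_radius (rho m : R) : 0 < rho -> 0 < m -> exists2 r, 0 <= r &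
  forall V : 'M[R]_N, `|\det V| = m ->
    (forall c, c != 0 -> rho <= `|lattice_point V c|) -> covers_within V r.
Proof.
(* Two points of one cube of radius [r] differ by at most [2 r < rho], so no cube meets its own
   translates. *)
move=> rho0 m0; pose r := rho / 4; have r0 : 0 < r by rewrite divr_gt0.
have r4 : 0 <= 4 * r by rewrite mulr_ge0// ltW.
pose v := fine (mu (cube r)).
have vE : mu (cube r) = v%:E by rewrite fineK// cube_fin_num.
have v0 : 0 < v by rewrite -lte_fin -vE cube_gt0.
pose M := (Num.bound (m / v)).+1.
have Mm : m < M%:R * v.
  rewrite -ltr_pdivrMr//; apply: (@lt_trans _ _ (Num.bound (m / v))%:R); last by rewrite ltr_nat.
  by rewrite archi_boundP// divr_ge0// ltW.
exists (4 * r * M%:R); first by rewrite !mulr_ge0// ltW.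
move=> V dV Vrho x; apply: contrapT => /forallNP xc.
have V0 : \det V != 0 by rewrite -normr_eq0 dV gt_eqF.
pose S := range (fun c => `|x - lattice_point V c|).
have Slb : lbound S (4 * r * M%:R).
  by move=> _ [c _ <-]; have /negP := xc c; rewrite -ltNge => /ltW.
have Sinf : has_inf S.
  by split; [exists `|x - lattice_point V 0|, 0|exists (4 * r * M%:R)].
(* A lattice point that minimises the distance up to [r] is enough; seen from it, every lattice
   point is at distance more than [|y| - r] from [y]. *)
have [_ [c0 _ <-] c0d] : exists2 z, S z & z < inf S + r.
  exact: (inf_adherent r0 Sinf).
pose y := x - lattice_point V c0.
have yS c : `|y| - r < `|y - lattice_point V c|.
  rewrite ltrBlDr; apply: (lt_le_trans c0d); rewrite lerD2r; apply: (ge_inf Sinf.2).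
  by exists (c0 + c) => //; rewrite lattice_pointD opprD addrA.
have yM : 4 * r * M%:R <= `|y| by apply: Slb; exists c0.
have y0 : 0 < `|y| by apply: lt_le_trans yM; rewrite !mulr_gt0.
pose p (j : nat) : T := (j%:R * (4 * r) / `|y|) *: y.
(* A lattice point within [2 r] of [p k - p j], which has norm at least [4 r] on the segment towards
   [y], would be too close to [y]. *)
have pp (j k : nat) c : (j < k < M)%N -> 2 * r < `|p k - p j - lattice_point V c|.
  move=> /andP[jk kM]; rewrite -scalerBl; set t := (X in X *: y).
  have tE : t * `|y| = (k - j)%:R * (4 * r).
    by rewrite /t natrB 1?ltnW//; field; rewrite gt_eqF.
  have t1 : t <= 1.
    rewrite -(ler_pM2r y0) tE mul1r; apply: le_trans yM; rewrite mulrC ler_wpM2l//.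
    by rewrite ler_nat (leq_trans (leq_subr _ _))// ltnW.
  have : `|y - lattice_point V c| <= `|t *: y - lattice_point V c| + (1 - t) * `|y|.
    have -> : y - lattice_point V c = (t *: y - lattice_point V c) + (1 - t) *: y.
      by rewrite [(1 - t) *: y]scalerBl scale1r [RHS]addrC [RHS]addrA subrK.
    by rewrite (le_trans (ler_normD _ _))// normrZ ger0_norm// subr_ge0.
  have := yS c; rewrite mulrBl mul1r tE => h1 h2.
  have h3 : 4 * r <= (k - j)%:R * (4 * r) by rewrite ler_peMl// ler1n subn_gt0.
  by lra.
pose F (j : 'I_M) := shift (- p j) @^-1` cube r.
have mF j : measurable (F j) by exact: measurable_shift_cube.
pose E := \big[setU/set0]_(j < M) F j.
have mE : measurable E by apply: bigsetU_measurable => j _.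
have Fz (j k : 'I_M) z c : F j z -> F k (z + lattice_point V c) -> (j < k)%N -> False.
  rewrite /F /cube /= => jz kz jk; have := pp j k c; rewrite jk ltn_ord => /(_ isT).
  apply/negP; rewrite -leNgt.
  have -> : p k - p j - lattice_point V c = (z - p j) - (z + lattice_point V c - p k).
    by rewrite !opprD !opprK; apply/rowP => i; rewrite !mxE; ring.
  by rewrite (le_trans (ler_normB _ _))// mulr_natl mulr2n lerD.
have pE : packs V E.
  move=> c c0'; rewrite (_ : _ `&` _ = set0) ?measure0//; apply/seteqP; split => // z [].
  rewrite /E /= -!bigcup_seq => -[j _ jz] [k _ kz].
  have [jk|kj|jk] := ltngtP j k.
  - exact: (Fz j k z c).
  - apply: (Fz k j (z + lattice_point V c) (- c)) => //.
    by rewrite lattice_pointN addrK.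
  - have := Vrho _ c0'; apply/negP; rewrite -ltNge.
    have -> : lattice_point V c = (z + lattice_point V c - p k) - (z - p j).
      by rewrite jk; apply/rowP => i; rewrite !mxE; ring.
    apply: le_lt_trans (ler_normB _ _) _.
    apply: (@le_lt_trans _ _ (r + r)); first by apply: lerD.
    by rewrite /r; lra.
have := packing_measure_le V0 mE pE; rewrite dV; apply/negP; rewrite -ltNge.
rewrite /E measure_bigsetU_ord//.
  rewrite (eq_bigr (fun=> v%:E)); last first.
    move=> j _; rewrite -[LHS]/(mu (F j)) -vE.
    by apply: borel_lebesgue_translate; exact: measurable_cube.
  by rewrite sumEFin lte_fin sumr_const card_ord -mulr_natl.
apply/trivIsetP => j k _ _ jk; apply/seteqP; split => // z [jz kz].
have kz' : F k (z + lattice_point V 0) by rewrite lattice_point0 addr0.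
have jz' : F j (z + lattice_point V 0) by rewrite lattice_point0 addr0.
by have [h|h|/val_inj h] := ltngtP j k; [exact: (Fz j k z 0)|exact: (Fz k j z 0)|rewrite h eqxx in jk].
Qed.

(* A short vector makes many translates of [f] compete for the same cube. *)
Lemma short_vector_spreads (V : 'M[R]_N) (f : T -> R) (c : 'rV[int]_N) (M : nat) (r : R) y :
  \det V != 0 -> relaxed_packing V f -> c != 0 -> M%:R * `|lattice_point V c| <= r ->
  (M%:R%:E * \int[mu]_(x in shift (- y) @^-1` cube r) (f x)%:E <= mu (cube (r + r)))%E.
Proof.
move=> V0 Pf c0 cr; have [mf f01 _] := Pf.
have f0 x : 0 <= f x by have /andP[] := f01 x.
(* The multiples [c], ..., [M c] are distinct and give lattice vectors of norm at most [r], so each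
   translate carries the cube of radius [r] into that of radius [2 r]. *)
pose s := [seq c *~ (i.+1)%:Z | i <- iota 0 M].
have us : uniq s.
  rewrite map_inj_uniq ?iota_uniq// => i j ij.
  have /rV0Pn[k ck] := c0; have /rowP/(_ k) := ij.
  rewrite -!scaler_int !mxE !intz => /(mulIf ck) /eqP.
  by rewrite eqz_nat eqSS => /eqP.
pose A := shift (- y) @^-1` cube (r + r).
have mA : measurable A by exact: measurable_shift_cube.
have := relaxed_packing_sum V0 Pf us mA.
rewrite /A borel_lebesgue_translate; last exact: measurable_cube.
apply: le_trans; rewrite big_map.
have -> : (M%:R%:E * \int[mu]_(x in shift (- y) @^-1` cube r) (f x)%:E =
    \sum_(i <- iota 0 M) \int[mu]_(x in shift (- y) @^-1` cube r) (f x)%:E)%E.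
  rewrite (eq_bigr (fun=> 1%:E * \int[mu]_(x in shift (- y) @^-1` cube r) (f x)%:E)%E); last first.
    by move=> i _; rewrite mul1e.
  rewrite -ge0_sume_distrl// sumEFin; congr (_%:E * _)%E.
  by rewrite big_const_seq count_predT size_iota iter_addr_0.
rewrite big_seq [leRHS]big_seq; apply: lee_sum => i; rewrite mem_iota/= => iM.
set v := lattice_point V _.
have vr : `|v| <= r.
  apply: le_trans cr; rewrite /v /lattice_point.
  have -> : map_mx intr (c *~ i.+1%:Z) = i.+1%:R *: map_mx intr c :> 'rV[R]_N.
    by apply/rowP => k; rewrite -scaler_int !mxE intz intrM mulrC.
  by rewrite -scalemxAl normrZ ger0_norm// ler_wpM2r// ler_nat.
pose G z := ((\1_A (z - v))%:E * (f z)%:E)%E.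
have mG : measurable_fun setT G.
  apply: emeasurable_funM; last exact/measurable_EFinP.
  apply/measurable_EFinP; apply: (measurableT_comp (measurable_indic mA)).
  exact: measurable_addr_rV.
have G0 z : (0 <= G z)%E by rewrite mule_ge0// lee_fin.
rewrite [leRHS](_ : _ = \int[mu]_x G x)%E; last first.
  rewrite -(integral_translate v mG G0) integral_indicE.
  by apply: eq_integral => x _; rewrite /G addrK.
rewrite integral_indicE; apply: ge0_le_integral => //.
- by move=> x _; rewrite mule_ge0// lee_fin.
- by apply: measurable_indicM; [exact: measurable_shift_cube|exact/measurable_EFinP].
- move=> x _; rewrite /G lee_wpmul2r ?lee_fin// !indicE.
  case: (boolP (x \in _)) => // /set_mem/= xr; rewrite mem_set// /A /cube/=.
  by rewrite addrAC (le_trans (ler_normB _ _))// lerD.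
Qed.

End cubes.

Lemma finite_measure_pack d (T : measurableType d) (R : realType) (nu : {measure set T -> \bar R}) :
  (nu setT < +oo)%E -> exists nu' : {finite_measure set T -> \bar R}, forall A, nu' A = nu A.
Proof.
move=> nuT; have fin : fin_num_fun nu by exact: lty_fin_num_fun.
have sf : sigma_finite setT nu by apply: fin_num_fun_sigma_finite => //; rewrite measure0.
pose H1 := isFinite.Build _ _ _ _ fin.
pose H2 := isSFinite.Build _ _ _ _ (sfinite_measure_sigma_finite sf).
pose H3 := isSigmaFinite.Build _ _ _ _ sf.
by exists (HB.pack_for (FiniteMeasure.type T R) (Measure.sort nu) H1 H2 H3).
Qed.

(** * Limits along ultrafilters *)

Section ultralimits.
Variables (R : realType) (J : Type) (U : set_system J).
Context {UU : UltraFilter U}.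

Lemma ultra_cvg_compact (T : topologicalType) (A : set T) (u : J -> T) :
  compact A -> (forall i, A (u i)) -> exists2 l, A l & u @ U --> l.
Proof.
move=> cA Au; have FA : (u @ U) A by apply: (@filterE _ U) => i; exact: Au.
have [l [Al ul]] := cA (u @ U) _ FA; exists l => // B Bl.
have [|UnB] := in_ultra_setVsetC (u @^-1` B) UU; first by [].
have [x [+ Bx]] := ul (~` B) B UnB Bl.
by [].
Qed.

Lemma ultra_cvg_bounded (u : J -> R) a b : (forall i, a <= u i <= b) ->
  exists2 l, a <= l <= b & u @ U --> l.
Proof.
move=> ub; have [] := @ultra_cvg_compact R `[a, b] u (@segment_compact R a b).
  by move=> i; rewrite /= in_itv/=; exact: ub.
by move=> l; rewrite /= in_itv /= => lab ul; exists l.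
Qed.

Lemma ultra_cvg_le (u v : J -> R) (l k : R) : U [set i | u i <= v i] ->
  u @ U --> l -> v @ U --> k -> l <= k.
Proof. move=> uv ul vk; rewrite -subr_ge0.
have vul : (v - u) @ U --> k - l by exact: cvgB.
apply: (@closed_cvg J R U _ (v - u) [set x | 0 <= x] _ _ _ vul); first exact: closed_ge.
by apply: filterS uv => i; rewrite /= subr_ge0.
Qed.

(* Domination by a fixed finite measure makes the (a priori only finitely additive)
   ultralimit countably additive. *)
Lemma ultralimit_measure d (T : measurableType d) (theta : {measure set T -> \bar R})
    (th : J -> set T -> \bar R) :
  (theta setT < +oo)%E ->
  (forall i A, measurable A -> (0 <= th i A <= theta A)%E) ->
  (forall i A B, measurable A -> measurable B -> A `&` B = set0 ->
    th i (A `|` B) = (th i A + th i B)%E) ->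
  exists nu : {finite_measure set T -> \bar R}, forall A, measurable A ->
    (nu A <= theta A)%E /\ (fun i => fine (th i A)) @ U --> fine (nu A).
Proof.
move=> thT thb thD.
have tfin A : measurable A -> theta A \is a fin_num.
  by move=> mA; rewrite ge0_fin_numE//; apply: le_lt_trans thT; rewrite le_measure// inE.
have thfin i A : measurable A -> th i A \is a fin_num.
  move=> mA; have /andP[h0 h1] := thb i A mA; rewrite ge0_fin_numE//.
  by apply: (le_lt_trans h1); rewrite -ge0_fin_numE// tfin.
have /choice[f fP] (A : set T) : exists l : R, measurable A ->
    0 <= l <= fine (theta A) /\ (fun i => fine (th i A)) @ U --> l.
  have [mA|nA] := pselect (measurable A); last by exists 0.
  have [|l lb lc] := @ultra_cvg_bounded (fun i => fine (th i A)) 0 (fine (theta A)).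
    move=> i; have /andP[h0 h1] := thb i A mA; rewrite fine_ge0//=.
    by rewrite fine_le// ?thfin// tfin.
  by exists l.
pose g A : \bar R := if pselect (measurable A) then (f A)%:E else 0%E.
have gE A : measurable A -> g A = (f A)%:E by rewrite /g; case: pselect.
have g0 A : (0 <= g A)%E.
  by rewrite /g; case: pselect => // mA; rewrite lee_fin; have [/andP[]] := fP A mA.
have gle A : measurable A -> (g A <= theta A)%E.
  by move=> mA; rewrite gE// -(fineK (tfin A mA)) lee_fin; have [/andP[]] := fP A mA.
have gset0 : g set0 = 0%E.
  by apply/eqP; rewrite eq_le g0 andbT; apply: le_trans (gle _ measurable0) _; rewrite measure0.
have gD A B : measurable A -> measurable B -> A `&` B = set0 -> g (A `|` B) = (g A + g B)%E.
  move=> mA mB AB; have mAB : measurable (A `|` B) by exact: measurableU.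
  rewrite !gE// -EFinD; congr EFin.
  have [_ cA] := fP A mA; have [_ cB] := fP B mB; have [_ cAB] := fP _ mAB.
  apply: (cvg_unique _ cAB); first exact: norm_hausdorff.
  rewrite (_ : (fun i => _) = (fun i => fine (th i A)) \+ (fun i => fine (th i B))); last first.
    by apply/funext => i /=; rewrite thD// fineD// thfin.
  exact: cvgD.
have gsum (F : (set T)^nat) n : (forall i, measurable (F i)) -> trivIset setT F ->
    (\sum_(0 <= i < n) g (F i))%E = g (\big[setU/set0]_(i < n) F i).
  move=> mF tF; elim: n => [|n IH]; first by rewrite big_geq// big_ord0 gset0.
  rewrite big_nat_recr//= IH big_ord_recr/= gD//.
    exact: bigsetU_measurable.
  rewrite -bigcup_mkord; apply/seteqP; split => // x [[i /= i_n Fi] Fn].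
  have /trivIsetP/(_ i n I I) := tF; rewrite neq_ltn i_n /= => /(_ isT) E.
  by have : set0 x by rewrite -E.
have gsa : semi_sigma_additive g.
  move=> F mF tF mUF.
  (* Continuity from above of the finite measure [theta] makes the tails small, and [g <= theta]
     transfers this to [g]. *)
  have tail0 : theta (\bigcup_(i >= n) F i) @[n --> \oo] --> 0%E.
    have tF' : (forall n, measurable (\bigcup_(i >= n) F i)).
      by move=> n; apply: bigcup_measurable => i _.
    have cap0 : \bigcap_n (\bigcup_(i >= n) F i) = set0.
      apply/seteqP; split => // x H; have [i _ Fi] := H 0%N I.
      have [j /= ij Fj] := H i.+1 I.
      have /trivIsetP/(_ i j I I) := tF; rewrite neq_ltn ij /= => /(_ isT) E.
      by have : set0 x by rewrite -E.
    have : theta (\bigcup_(i >= n) F i) @[n --> \oo] --> theta (\bigcap_n (\bigcup_(i >= n) F i)).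
      apply: nonincreasing_cvg_mu => //.
      - by apply: le_lt_trans thT; rewrite le_measure// inE.
      - exact: bigcapT_measurable.
      - by move=> n m nm; apply/subsetPset => x [i /= mi Fx]; exists i => //=; exact: leq_trans mi.
    by rewrite cap0 measure0.
  have split_ n : g (\bigcup_i F i) = ((\sum_(0 <= i < n) g (F i)) + g (\bigcup_(i >= n) F i))%E.
    rewrite gsum// -gD//.
    - by rewrite -bigcup_mkord -bigcup_setU; congr g; apply/seteqP; split => // x [k _ Fx]; exists k => //=; have [h|h] := ltnP k n; [left|right].
    - exact: bigsetU_measurable.
    - by apply: bigcup_measurable => i _.
    - rewrite -bigcup_mkord; apply/seteqP; split => // x [[i /= i_n Fi] [j /= n_j Fj]].
      have /trivIsetP/(_ i j I I) := tF; rewrite neq_ltn (leq_trans i_n n_j) /= => /(_ isT) E.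
      by have : set0 x by rewrite -E.
  have gt0 : g (\bigcup_(i >= n) F i) @[n --> \oo] --> 0%E.
    apply: (@squeeze_cvge _ _ _ _ (cst 0%E) _ (fun n => theta (\bigcup_(i >= n) F i))) => //.
      by apply: nearW => n; rewrite g0 gle//; apply: bigcup_measurable => i _.
    exact: cvg_cst.
  have : (fun n => g (\bigcup_i F i) - g (\bigcup_(i >= n) F i))%E @ \oo --> (g (\bigcup_i F i) - 0)%E.
    apply: cvgeB => //; last exact: cvg_cst.
    by rewrite fin_num_adde_defl.
  rewrite sube0; apply: cvg_trans; apply: near_eq_cvg; apply: nearW => n.
  rewrite (split_ n) addeK// gE//.
  by apply: bigcup_measurable => i _.
pose M := isMeasure.Build _ _ _ g gset0 g0 gsa.
pose nu : {measure set T -> \bar R} := HB.pack g M.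
have [|nu' nu'E] := @finite_measure_pack _ _ _ nu.
  by apply: le_lt_trans thT; exact: gle.
exists nu' => A mA; rewrite nu'E; split; first exact: gle.
by rewrite -[nu A]/(g A) gE//=; have [] := fP A mA.
Qed.

End ultralimits.

Section densities.
Variables (R : realType) (n : nat).
Local Notation T := 'rV[R]_n.
Local Notation mu := (@borel_lebesgue_measure R n).
Local Open Scope ereal_scope.

(** The Radon-Nikodym density exceeds 1 only on a null set because [nu <= mu]; truncating it at 1
    makes the bound hold everywhere. *)
Lemma dominated_density (nu : {measure set T -> \bar R}) : nu setT < +oo ->
  (forall A, measurable A -> nu A <= mu A) ->
  exists f : T -> R, [/\ measurable_fun setT f, forall x, (0 <= f x <= 1)%R &
    forall A, measurable A -> nu A = \int[mu]_(x in A) (f x)%:E].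
Proof.
move=> nuT numu; have [nu' nu'E] := finite_measure_pack nuT.
have dom : nu' `<< mu.
  apply/null_content_dominatesP => A mA A0; apply/eqP; rewrite eq_le measure_ge0 andbT.
  by rewrite nu'E -[leRHS]A0; exact: numu.
pose g := Radon_Nikodym_SigmaFinite.f nu' mu.
have g0 x : 0 <= g x by exact: Radon_Nikodym_SigmaFinite.f_ge0.
have gfin x : g x \is a fin_num by exact: Radon_Nikodym_SigmaFinite.f_fin_num.
have gint := Radon_Nikodym_SigmaFinite.f_integrable dom.
have mg : measurable_fun setT g by exact: measurable_int gint.
have gE A : measurable A -> nu A = \int[mu]_(x in A) g x.
  by move=> mA; rewrite -nu'E; exact: Radon_Nikodym_SigmaFinite.f_integral.
pose B := setT `&` [set x | 1 < g x].
have mB : measurable B by exact: emeasurable_fun_o_infty.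
have mgB : measurable_fun B g by exact: measurable_funTS.
have B0 : mu B = 0.
  apply: (integral_le_measure_null mB _ mgB); last by rewrite -gE//; exact: numu.
    rewrite -[ltLHS]mul1e -(integral_cst mu mB 1%:E).
    apply: (@le_lt_trans _ _ (\int[mu]_(x in B) g x)).
      by apply: ge0_le_integral => // x [_ /ltW].
    by rewrite -gE//; apply: le_lt_trans nuT; apply: le_measure; rewrite ?inE.
  by move=> x [].
pose f x : R := (Num.min 1 (fine (g x)))%R.
have mf : measurable_fun setT f.
  apply: measurable_minr => //.
  exact: (measurableT_comp (@fine_measurable R setT measurableT)).
exists f; split => //.
  by move=> x; rewrite /f le_min ler01 fine_ge0//= ge_min lexx.
move=> A mA; rewrite gE//; apply: ge0_ae_eq_integral => //.
- exact: measurable_funTS.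
- by apply: measurable_funTS; exact/measurable_EFinP.
- by move=> x _; rewrite lee_fin /f le_min ler01 fine_ge0.
exists B; split => // x /= /not_implyP[_ H]; split => //=; rewrite ltNge; apply/negP => g1.
apply: H; rewrite /f min_r ?fineK//.
by rewrite -lee_fin fineK.
Qed.

End densities.

Section density_measures.
Context d (T : measurableType d) (R : realType).
Variables (m : {measure set T -> \bar R}) (w : T -> \bar R).
Hypotheses (mw : measurable_fun setT w) (w0 : forall x, (0 <= w x)%E).
Local Open Scope ereal_scope.

Definition density_measure of measurable_fun setT w & (forall x, 0 <= w x) :=
  fun A => \int[m]_(x in A) w x.

Let density0 : density_measure mw w0 set0 = 0.
Proof. exact: integral_set0. Qed.

Let density_ge0 A : 0 <= density_measure mw w0 A.
Proof. exact: integral_ge0. Qed.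

HB.instance Definition _ := isMeasure.Build _ _ _ (density_measure mw w0)
  density0 density_ge0 (semi_sigma_additive_nng_induced mw w0).

End density_measures.

(** * Weak limits tested on bounded sets *)

Section bounded_sets.
Variables (R : realType) (N : nat).
Local Notation T := 'rV[R]_N.
Local Notation mu := (@borel_lebesgue_measure R N).
Local Open Scope ereal_scope.

Lemma cubeS (r s : R) : (r <= s)%R -> @cube R N r `<=` @cube R N s.
Proof. by move=> rs x xr; exact: le_trans xr rs. Qed.

Lemma cube_nat_mono : nondecreasing_seq (fun j : nat => @cube R N j%:R).
Proof. by move=> i j ij; apply/subsetPset; apply: cubeS; rewrite ler_nat. Qed.

Lemma measure_cube_cvg (m1 : {measure set T -> \bar R}) (A : set T) : measurable A ->
  m1 (A `&` cube j%:R) @[j --> \oo] --> m1 A.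
Proof.
move=> mA; have mAj j : measurable (A `&` @cube R N j%:R).
  by apply: measurableI => //; exact: measurable_cube.
have UA : \bigcup_j (A `&` @cube R N j%:R) = A by rewrite -setI_bigcupr bigcup_cube setIT.
rewrite -[X in _ --> m1 X]UA.
apply: (nondecreasing_cvg_mu (F := fun j => A `&` @cube R N j%:R)) => //.
  by rewrite UA.
by move=> i j ij; apply/subsetPset; apply: setIS; apply: cubeS; rewrite ler_nat.
Qed.

Lemma le_measure_bounded (m1 m2 : {measure set T -> \bar R}) :
  (forall r A, measurable A -> A `<=` cube r -> m1 A <= m2 A) ->
  forall A, measurable A -> m1 A <= m2 A.
Proof.
move=> H A mA; have mAj j : measurable (A `&` @cube R N j%:R).
  by apply: measurableI => //; exact: measurable_cube.
have cA := @measure_cube_cvg m1 A mA.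
rewrite -(cvg_lim (@ereal_hausdorff R) cA); apply: lime_le; first exact: cvgP cA.
apply: nearW => j /=; apply: (@le_trans _ _ (m2 (A `&` cube j%:R))).
  by apply: (H j%:R) => // x [].
by apply: le_measure; rewrite ?inE.
Qed.

(** Real-valued so that limits are taken in [R]; [massE] ensures that [fine] loses nothing on
    bounded sets. *)
Definition mass (h : T -> R) (A : set T) : R := fine (\int[mu]_(x in A) (h x)%:E).

Lemma integral_le1 (h : T -> R) (A : set T) : measurable_fun setT h ->
  (forall x, 0 <= h x <= 1)%R -> measurable A -> \int[mu]_(x in A) (h x)%:E <= mu A.
Proof.
move=> mh h01 mA; rewrite -[leRHS]mul1e -(integral_cst mu mA 1%:E).
apply: ge0_le_integral => //.
- by move=> x _; rewrite lee_fin; have /andP[] := h01 x.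
- by apply: measurable_funTS; exact/measurable_EFinP.
- by move=> x _; rewrite lee_fin; have /andP[] := h01 x.
Qed.

Lemma bounded_measure_fin (A : set T) r : measurable A -> A `<=` cube r ->
  mu A \is a fin_num.
Proof.
move=> mA Ar; rewrite ge0_fin_numE//; apply: (le_lt_trans _ (cube_lty N r)).
by apply: le_measure; rewrite ?inE//; exact: measurable_cube.
Qed.

Lemma massE (h : T -> R) (A : set T) r : measurable_fun setT h ->
  (forall x, 0 <= h x <= 1)%R -> measurable A -> A `<=` cube r ->
  \int[mu]_(x in A) (h x)%:E = (mass h A)%:E.
Proof.
move=> mh h01 mA Ar; rewrite fineK// ge0_fin_numE.
  apply: (le_lt_trans (integral_le1 mh h01 mA)).
  by rewrite -ge0_fin_numE//; exact: bounded_measure_fin Ar.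
by apply: integral_ge0 => x _; rewrite lee_fin; have /andP[] := h01 x.
Qed.

Lemma integral_setU0 (h : T -> R) (A B : set T) : measurable_fun setT h ->
  (forall x, 0 <= h x)%R -> measurable A -> measurable B -> A `&` B = set0 ->
  \int[mu]_(x in A `|` B) (h x)%:E = \int[mu]_(x in A) (h x)%:E + \int[mu]_(x in B) (h x)%:E.
Proof.
move=> mh h0 mA mB AB; rewrite ge0_integral_setU//.
- by apply: measurable_funTS; exact/measurable_EFinP.
- by move=> x _; rewrite lee_fin.
- by apply/disj_setPS; rewrite AB.
Qed.

Section local_limits.
Variables (J : Type) (U : set_system J).
Context {UU : UltraFilter U}.

(** On each cube the ultralimit of the masses is a measure dominated by Lebesgue measure and has a
    density. A bounded set meets finitely many of the annuli along which these densities are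
    glued. *)
Lemma local_ultralimit (h : J -> T -> R) :
  (forall i, measurable_fun setT (h i)) -> (forall i x, 0 <= h i x <= 1)%R ->
  exists f : T -> R, [/\ measurable_fun setT f, forall x, (0 <= f x <= 1)%R &
    forall r A, measurable A -> A `<=` cube r ->
      (fun i => mass (h i) A) @ U --> mass f A].
Proof.
move=> mh h01; have h0 i x : (0 <= h i x)%R by have /andP[] := h01 i x.
have mc j : measurable (@cube R N j%:R) by exact: measurable_cube.
have /choice[F FP] (j : nat) : exists f : T -> R,
    [/\ measurable_fun setT f, forall x, (0 <= f x <= 1)%R &
     forall A, measurable A -> A `<=` cube j%:R -> (fun i => mass (h i) A) @ U --> mass f A].
  have restr_lty : mrestr mu (mc j) setT < +oo.
    apply: (le_lt_trans _ (cube_lty N j%:R)); apply: le_measure; rewrite ?inE//.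
    exact: measurableI.
  have [||i A B mA mB AB|nu nuP] := @ultralimit_measure R J U UU _ T
    (mrestr mu (mc j)) (fun i A => \int[mu]_(x in A `&` cube j%:R) (h i x)%:E).
  - exact: restr_lty.
  - move=> i A mA; rewrite integral_ge0; last by move=> x _; rewrite lee_fin.
    by apply: integral_le1 => //; exact: measurableI.
  - rewrite setIUl integral_setU0//; [exact: measurableI|exact: measurableI|].
    by rewrite setIACA AB set0I.
  have [||f [mf f01 fE]] := @dominated_density R N nu.
  - by apply: (le_lt_trans (nuP _ measurableT).1).
  - move=> A mA; apply: (le_trans (nuP _ mA).1); rewrite /mrestr.
    by apply: le_measure; rewrite ?inE//; exact: measurableI.
  exists f; split => // A mA Aj; have [_] := nuP A mA.
  rewrite fE//; apply: cvg_trans; apply: near_eq_cvg.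
  by apply: (@filterE _ U) => i; rewrite (setIidl Aj).
(* The densities obtained on different cubes need not agree pointwise, so each is kept only on its
   own annulus. *)
pose S j := seqD (fun j : nat => @cube R N j%:R) j.
have mS j : measurable (S j).
  by rewrite /S; case: j => [|j] /=; [exact: mc|apply: measurableD].
have S_uniq x i j : S i x -> S j x -> i = j.
  move=> Si Sj; apply: contrapT => /eqP ij.
  have /trivIsetP/(_ i j I I ij) := trivIset_seqD cube_nat_mono.
  by move/seteqP => [/(_ x)] + _; apply.
pose f x := F (get [set j | S j x]) x.
have fE j x : S j x -> f x = F j x.
  by move=> Sx; congr F; apply: (S_uniq x) => //; exact: (getPex (ex_intro (fun j => S j x) j Sx)).
have mf : measurable_fun setT f.
  have -> : setT = \bigcup_j S j by rewrite eq_bigcup_seqD bigcup_cube.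
  apply/measurable_fun_bigcup => // j; have [mFj _ _] := FP j.
  apply: (eq_measurable_fun (F j)); last exact: measurable_funTS.
  by move=> x; rewrite inE => /fE.
have f01 x : (0 <= f x <= 1)%R by have [_ + _] := FP (get [set j | S j x]); apply.
have f0 x : (0 <= f x)%R by have /andP[] := f01 x.
exists f; split => // r A mA Ar.
have fFS j B : B `<=` S j -> mass f B = mass (F j) B.
  by move=> BS; congr fine; apply: eq_integral => x; rewrite inE => /BS /fE ->.
have base j B : measurable B -> B `<=` S j -> (fun i => mass (h i) B) @ U --> mass f B.
  move=> mB BS; rewrite (fFS j)//; have [_ _] := FP j; apply => // x /BS.
  by rewrite /S; case: j BS => [|j] BS //= -[].
have step j B : measurable B -> B `<=` cube j%:R -> (fun i => mass (h i) B) @ U --> mass f B.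
  elim: j B => [|j IH] B mB Bj; first exact: (base 0%N).
  pose B1 := B `&` cube j%:R; pose B2 := B `\` cube j%:R.
  have mB1 : measurable B1 by exact: measurableI.
  have mB2 : measurable B2 by exact: measurableD.
  have massU (u : T -> R) : measurable_fun setT u -> (forall x, 0 <= u x <= 1)%R ->
      mass u B = (mass u B1 + mass u B2)%R.
    move=> mu' u01; have u0 x : (0 <= u x)%R by have /andP[] := u01 x.
    apply/EFin_inj; rewrite EFinD -(massE mu' u01 mB Bj).
    rewrite -(massE (r := j%:R) mu' u01 mB1); last by move=> x [].
    rewrite -(massE (r := j.+1%:R) mu' u01 mB2); last by move=> x [/Bj].
    rewrite -integral_setU0//; first by rewrite setUIDK.
    by apply/seteqP; split => // x [[_ ?] [_ ?]].
  rewrite massU// (_ : (fun i => _) = (fun i => mass (h i) B1) \+ (fun i => mass (h i) B2))%R.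
    apply: (@cvgD R R); first by apply: IH => // x [].
    by apply: (base j.+1) => // x [/Bj].
  by apply/funext => i; rewrite massU.
have [r0|r0] := leP 0%R r; last first.
  apply: (step 0%N) => // x /Ar; rewrite /cube/= => xr.
  by have := lt_le_trans (le_lt_trans xr r0) (normr_ge0 x); rewrite ltxx.
apply: (step (Num.bound r)) => //; apply: subset_trans Ar _; apply: cubeS.
by rewrite ltW// archi_boundP.
Qed.

End local_limits.

End bounded_sets.

(** * Interaction energies *)

Section interaction_calculus.
Variables (R : realType) (N : nat).
Local Notation T := 'rV[R]_N.
Local Notation mu := (@borel_lebesgue_measure R N).
Local Notation shift v := (fun x : T => x + v)%R.
Local Open Scope ereal_scope.
Implicit Types (k : T -> \bar R) (f g : T -> R).

Definition weight (f : T -> R) := measurable_fun setT f /\ forall x, (0 <= f x)%R.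
Definition kernel_function (k : T -> \bar R) := measurable_fun setT k /\ forall x, 0 <= k x.

Definition potential (k : T -> \bar R) (g : T -> R) (y : T) :=
  \int[mu]_x ((g x)%:E * k (x - y)%R).

Lemma interactionE k f g : interaction k f g = \int[mu]_y ((f y)%:E * potential k g y).
Proof. by []. Qed.

Lemma measurable_EFin_weight f : weight f -> measurable_fun setT (fun x => (f x)%:E).
Proof. by move=> [mf _]; exact/measurable_EFinP. Qed.

Lemma weightD f g : weight f -> weight g -> weight (fun x => f x + g x)%R.
Proof. by move=> [mf f0] [mg g0]; split; [exact: measurable_funD|move=> x; exact: addr_ge0]. Qed.

Lemma weightM f g : weight f -> weight g -> weight (fun x => f x * g x)%R.
Proof. by move=> [mf f0] [mg g0]; split; [exact: measurable_funM|move=> x; exact: mulr_ge0]. Qed.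

Lemma weight_indic A : measurable A -> weight (\1_A).
Proof. by move=> mA; split; [exact: measurable_indic|move=> x; rewrite indicE]. Qed.

Lemma weight_cst c : (0 <= c)%R -> weight (cst c).
Proof. by move=> c0; split. Qed.

Lemma weight_shift f v : weight f -> weight (fun x => f (x + v)%R).
Proof.
by move=> [mf f0]; split => //; apply: (measurableT_comp mf); exact: measurable_addr_rV.
Qed.

Lemma kernel_function_indic A : measurable A -> kernel_function (fun x => (\1_A x)%:E).
Proof.
move=> mA; split; first by apply/measurable_EFinP; exact: measurable_indic.
by move=> x; rewrite lee_fin.
Qed.

Lemma measurable_kernel_shift k y : kernel_function k -> measurable_fun setT (fun x : T => k (x - y)%R).
Proof. by move=> [mk _]; apply: (measurableT_comp mk); exact: measurable_addr_rV. Qed.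

Lemma potential_ge0 k g y : kernel_function k -> weight g -> 0 <= potential k g y.
Proof. by move=> [_ k0] [_ g0]; apply: integral_ge0 => x _; rewrite mule_ge0// lee_fin. Qed.

Lemma measurable_potential k g : kernel_function k -> weight g -> measurable_fun setT (potential k g).
Proof. by move=> [mk k0] [mg g0]; exact: measurable_interaction_integrand. Qed.

Lemma measurable_weightM f (F : T -> \bar R) : weight f -> measurable_fun setT F ->
  measurable_fun setT (fun x => (f x)%:E * F x).
Proof. by move=> wf mF; apply: emeasurable_funM => //; exact: measurable_EFin_weight. Qed.

Lemma interaction_ge0 k f g : kernel_function k -> weight f -> weight g -> 0 <= interaction k f g.
Proof.
move=> hk [mf f0] hg; apply: integral_ge0 => y _.
by rewrite mule_ge0 ?lee_fin//; exact: potential_ge0.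
Qed.

Lemma eq_potential k g g' : (forall x, g x = g' x) -> potential k g =1 potential k g'.
Proof. by move=> gg y; apply: eq_integral => x _; rewrite gg. Qed.

Lemma eq_interaction k f f' g g' : (forall x, f x = f' x) -> (forall x, g x = g' x) ->
  interaction k f g = interaction k f' g'.
Proof.
by move=> ff gg; apply: eq_integral => y _; rewrite ff; congr (_ * _); exact: eq_potential.
Qed.

Lemma le_weight_integral f f' (F : T -> \bar R) : weight f -> weight f' ->
  measurable_fun setT F -> (forall x, 0 <= F x) -> {ae mu, forall x, (f x <= f' x)%R} ->
  \int[mu]_x ((f x)%:E * F x) <= \int[mu]_x ((f' x)%:E * F x).
Proof.
move=> wf wf' mF F0 ff; apply: ae_ge0_le_integral => //.
- by move=> x _; rewrite mule_ge0// lee_fin; have [] := wf.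
- exact: measurable_weightM.
- by move=> x _; rewrite mule_ge0// lee_fin; have [] := wf'.
- exact: measurable_weightM.
by apply: filterS ff => x fx _; rewrite lee_wpmul2r// lee_fin.
Qed.

Lemma le_interactionl k f f' g : kernel_function k -> weight f -> weight f' -> weight g ->
  {ae mu, forall x, (f x <= f' x)%R} -> interaction k f g <= interaction k f' g.
Proof.
move=> hk wf wf' wg; apply: le_weight_integral => //; first exact: measurable_potential.
by move=> y; exact: potential_ge0.
Qed.

Lemma le_potential k g g' y : kernel_function k -> weight g -> weight g' ->
  {ae mu, forall x, (g x <= g' x)%R} -> potential k g y <= potential k g' y.
Proof.
move=> hk wg wg'; apply: le_weight_integral => //; first exact: measurable_kernel_shift.
by have [] := hk.
Qed.

Lemma le_interactionr k f g g' : kernel_function k -> weight f -> weight g -> weight g' ->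
  {ae mu, forall x, (g x <= g' x)%R} -> interaction k f g <= interaction k f g'.
Proof.
move=> hk wf wg wg' gg; have [mf f0] := wf; apply: ge0_le_integral => //.
- by move=> y _; rewrite mule_ge0 ?lee_fin//; exact: potential_ge0.
- by apply: measurable_weightM => //; exact: measurable_potential.
- by apply: measurable_weightM => //; exact: measurable_potential.
- by move=> y _; rewrite lee_wpmul2l ?lee_fin//; exact: le_potential.
Qed.

Lemma le_interactionk k k' f g : kernel_function k -> kernel_function k' -> weight f -> weight g ->
  (forall x, k x <= k' x) -> interaction k f g <= interaction k' f g.
Proof.
move=> hk hk' wf wg kk; have [mf f0] := wf; have [mg g0] := wg; apply: ge0_le_integral => //.
- by move=> y _; rewrite mule_ge0 ?lee_fin//; exact: potential_ge0.
- by apply: measurable_weightM => //; exact: measurable_potential.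
- by apply: measurable_weightM => //; exact: measurable_potential.
move=> y _; rewrite lee_wpmul2l ?lee_fin//; apply: ge0_le_integral => //.
- by move=> x _; rewrite mule_ge0 ?lee_fin//; have [] := hk.
- by apply: measurable_weightM => //; exact: measurable_kernel_shift.
- by apply: measurable_weightM => //; exact: measurable_kernel_shift.
- by move=> x _; rewrite lee_wpmul2l ?lee_fin.
Qed.

Lemma weight_integralD f f' (F : T -> \bar R) : weight f -> weight f' ->
  measurable_fun setT F -> (forall x, 0 <= F x) ->
  \int[mu]_x ((f x + f' x)%:E * F x) =
  \int[mu]_x ((f x)%:E * F x) + \int[mu]_x ((f' x)%:E * F x).
Proof.
move=> wf wf' mF F0; have [_ f0] := wf; have [_ f0'] := wf'; rewrite -ge0_integralD//.
- by apply: eq_integral => x _; rewrite EFinD ge0_muleDl// lee_fin.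
- by move=> x _; rewrite mule_ge0// lee_fin.
- exact: measurable_weightM.
- by move=> x _; rewrite mule_ge0// lee_fin.
- exact: measurable_weightM.
Qed.

Lemma interactionDl k f f' g : kernel_function k -> weight f -> weight f' -> weight g ->
  interaction k (fun x => f x + f' x)%R g = interaction k f g + interaction k f' g.
Proof.
move=> hk wf wf' wg; apply: weight_integralD => //; first exact: measurable_potential.
by move=> y; exact: potential_ge0.
Qed.

Lemma potentialD k g g' y : kernel_function k -> weight g -> weight g' ->
  potential k (fun x => g x + g' x)%R y = potential k g y + potential k g' y.
Proof.
move=> hk wg wg'; apply: weight_integralD => //; first exact: measurable_kernel_shift.
by have [] := hk.
Qed.

Lemma interactionDr k f g g' : kernel_function k -> weight f -> weight g -> weight g' ->
  interaction k f (fun x => g x + g' x)%R = interaction k f g + interaction k f g'.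
Proof.
move=> hk wf wg wg'; have [mf f0] := wf; rewrite /interaction -ge0_integralD//.
- apply: eq_integral => y _; rewrite -ge0_muleDr; last 2 first.
  + exact: potential_ge0.
  + exact: potential_ge0.
  by congr (_ * _); exact: potentialD.
- by move=> y _; rewrite mule_ge0 ?lee_fin//; exact: potential_ge0.
- by apply: measurable_weightM => //; exact: measurable_potential.
- by move=> y _; rewrite mule_ge0 ?lee_fin//; exact: potential_ge0.
- by apply: measurable_weightM => //; exact: measurable_potential.
Qed.

Lemma interactionDk k k' f g : kernel_function k -> kernel_function k' -> weight f -> weight g ->
  interaction (fun x => k x + k' x) f g = interaction k f g + interaction k' f g.
Proof.
move=> hk hk' wf wg; have [mf f0] := wf; have [mg g0] := wg.
rewrite /interaction -ge0_integralD//.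
- apply: eq_integral => y _; rewrite -ge0_muleDr; last 2 first.
  + exact: potential_ge0.
  + exact: potential_ge0.
  congr (_ * _); rewrite -ge0_integralD//.
  + by apply: eq_integral => x _; rewrite -ge0_muleDr//; [case: hk|case: hk'].
  + by move=> x _; rewrite mule_ge0 ?lee_fin//; case: hk.
  + by apply: measurable_weightM => //; exact: measurable_kernel_shift.
  + by move=> x _; rewrite mule_ge0 ?lee_fin//; case: hk'.
  + by apply: measurable_weightM => //; exact: measurable_kernel_shift.
- by move=> y _; rewrite mule_ge0 ?lee_fin//; exact: potential_ge0.
- by apply: measurable_weightM => //; exact: measurable_potential.
- by move=> y _; rewrite mule_ge0 ?lee_fin//; exact: potential_ge0.
- by apply: measurable_weightM => //; exact: measurable_potential.
Qed.

Lemma interactionZl k f g c : (0 <= c)%R -> kernel_function k -> weight f -> weight g ->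
  interaction k (fun x => c * f x)%R g = c%:E * interaction k f g.
Proof.
move=> c0 hk wf wg; have [mf f0] := wf; rewrite /interaction -ge0_integralZl//.
- by apply: eq_integral => y _; rewrite EFinM muleA.
- by apply: measurable_weightM => //; exact: measurable_potential.
- by move=> y _; rewrite mule_ge0 ?lee_fin//; exact: potential_ge0.
Qed.

Lemma potentialZ k g c y : (0 <= c)%R -> kernel_function k -> weight g ->
  potential k (fun x => c * g x)%R y = c%:E * potential k g y.
Proof.
move=> c0 hk wg; have [mg g0] := wg; rewrite /potential -ge0_integralZl//.
- by apply: eq_integral => x _; rewrite EFinM muleA.
- by apply: measurable_weightM => //; exact: measurable_kernel_shift.
- by move=> x _; rewrite mule_ge0 ?lee_fin//; case: hk.
Qed.

Lemma interactionZr k f g c : (0 <= c)%R -> kernel_function k -> weight f -> weight g ->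
  interaction k f (fun x => c * g x)%R = c%:E * interaction k f g.
Proof.
move=> c0 hk wf wg; have [mf f0] := wf; rewrite /interaction -ge0_integralZl//.
- apply: eq_integral => y _; rewrite muleCA; congr (_ * _).
  by rewrite -[LHS]/(potential k _ y) potentialZ.
- by apply: measurable_weightM => //; exact: measurable_potential.
- by move=> y _; rewrite mule_ge0 ?lee_fin//; exact: potential_ge0.
Qed.

Lemma interactionZk k f g c : (0 <= c)%R -> kernel_function k -> weight f -> weight g ->
  interaction (fun x => c%:E * k x) f g = c%:E * interaction k f g.
Proof.
move=> c0 hk wf wg; have [mf f0] := wf; have [mg g0] := wg.
rewrite /interaction -ge0_integralZl//.
- apply: eq_integral => y _; rewrite muleCA; congr (_ * _).
  rewrite -ge0_integralZl//.
  + by apply: eq_integral => x _; rewrite muleCA.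
  + by apply: measurable_weightM => //; exact: measurable_kernel_shift.
  + by move=> x _; rewrite mule_ge0 ?lee_fin//; case: hk.
- by apply: measurable_weightM => //; exact: measurable_potential.
- by move=> y _; rewrite mule_ge0 ?lee_fin//; exact: potential_ge0.
Qed.

Lemma interaction_cst1 k f : kernel_function k -> weight f ->
  interaction k f (cst 1%R) = \int[mu]_x (f x)%:E * \int[mu]_x k x.
Proof.
move=> hk wf; have [mk k0] := hk; have [mf f0] := wf.
rewrite muleC -ge0_integralZl//.
- apply: eq_integral => y _; rewrite [RHS]muleC; congr (_ * _).
  rewrite -(integral_translate (- y)%R mk k0).
  by apply: eq_integral => x _; rewrite mul1e.
- exact: measurable_EFin_weight.
- by move=> x _; rewrite lee_fin.
- by apply: integral_ge0.
Qed.

(** The relation between J and Per written as a sum, so that it also holds when the terms are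
    infinite. *)
Lemma interaction_complement k f : kernel_function k -> measurable_fun setT f ->
  (forall x, (0 <= f x <= 1)%R) ->
  interaction k f f + interaction k f (fun x => 1 - f x)%R =
  \int[mu]_x (f x)%:E * \int[mu]_x k x.
Proof.
move=> hk mf f01; have wf : weight f by split => // x; have /andP[] := f01 x.
have wf' : weight (fun x => 1 - f x)%R.
  split; first exact: measurable_funB.
  by move=> x; rewrite subr_ge0; have /andP[] := f01 x.
apply: (eq_trans (esym (interactionDr hk wf wf wf'))).
apply: eq_trans (interaction_cst1 hk wf); apply: eq_interaction; first by [].
by move=> x; rewrite addrC subrK.
Qed.

Lemma potential_shift k g v y : kernel_function k -> weight g ->
  potential k g (y + v)%R = potential k (fun x => g (x + v)%R) y.
Proof.
move=> hk wg; have [mg g0] := wg; rewrite /potential.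
rewrite -(integral_translate v).
- by apply: eq_integral => x _; rewrite opprD addrACA subrr addr0.
- by apply: measurable_weightM => //; exact: measurable_kernel_shift.
- by move=> x; rewrite mule_ge0 ?lee_fin//; case: hk.
Qed.

Lemma interaction_shift k f g v : kernel_function k -> weight f -> weight g ->
  interaction k (fun x => f (x + v)%R) (fun x => g (x + v)%R) = interaction k f g.
Proof.
move=> hk wf wg; have [mf f0] := wf; rewrite [RHS]interactionE -(integral_translate v).
- by apply: eq_integral => y _; rewrite potential_shift.
- by apply: measurable_weightM => //; exact: measurable_potential.
- by move=> y; rewrite mule_ge0 ?lee_fin//; exact: potential_ge0.
Qed.

Lemma potential_cube k g M r y : kernel_function k -> weight g -> (0 <= M)%R ->
  (forall x, k x <= M%:E * (\1_(cube r) x)%:E) ->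
  potential k g y <= M%:E * \int[mu]_(x in shift (- y) @^-1` cube r) (g x)%:E.
Proof.
move=> hk wg M0 kM; have [mg g0] := wg; rewrite integral_indicE -ge0_integralZl//.
- apply: ge0_le_integral => //.
  + by move=> x _; rewrite mule_ge0 ?lee_fin//; case: hk.
  + by apply: measurable_weightM => //; exact: measurable_kernel_shift.
  + apply: measurable_funeM; apply: measurable_indicM; first exact: measurable_shift_cube.
    exact: measurable_EFin_weight.
  + move=> x _; rewrite muleA muleC lee_wpmul2r ?lee_fin//; exact: kM.
- apply: measurable_indicM; first exact: measurable_shift_cube.
  exact: measurable_EFin_weight.
- by move=> x _; rewrite mule_ge0 ?lee_fin.
Qed.

Lemma ae_le_integral (f g : T -> R) : weight f -> weight g ->
  \int[mu]_x (f x)%:E < +oo ->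
  (forall A, measurable A -> \int[mu]_(x in A) (f x)%:E <= \int[mu]_(x in A) (g x)%:E) ->
  {ae mu, forall x, (f x <= g x)%R}.
Proof.
move=> wf wg foo fg; have [mf f0] := wf; have [mg g0] := wg.
pose A : set T := [set x | g x < f x]%R.
have mA : measurable A.
  have mlt := measurable_fun_ltr mg mf.
  by have := mlt measurableT [set true] I; rewrite setTI.
have mfA : measurable_fun A (fun x => (f x)%:E) by apply: measurable_funTS; exact/measurable_EFinP.
have mgA : measurable_fun A (fun x => (g x)%:E) by apply: measurable_funTS; exact/measurable_EFinP.
have fAoo : \int[mu]_(x in A) (f x)%:E < +oo.
  apply: le_lt_trans foo; apply: ge0_subset_integral => //.
  + exact: measurable_EFin_weight.
  + by move=> x _; rewrite lee_fin.
have fgA : \int[mu]_(x in A) (f x - g x)%:E + \int[mu]_(x in A) (g x)%:E = \int[mu]_(x in A) (f x)%:E.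
  rewrite -ge0_integralD//.
  - by apply: eq_integral => x _; rewrite -EFinD subrK.
  - by move=> x /ltW; rewrite lee_fin subr_ge0.
  - by apply/measurable_EFinP; apply: measurable_funB; exact: measurable_funTS.
  - by move=> x _; rewrite lee_fin.
have gle : \int[mu]_(x in A) (g x)%:E <= \int[mu]_(x in A) (f x)%:E.
  by apply: ge0_le_integral => // [x _|x /ltW]; rewrite lee_fin.
have gfin : \int[mu]_(x in A) (g x)%:E \is a fin_num.
  rewrite ge0_fin_numE; first exact: le_lt_trans gle fAoo.
  by apply: integral_ge0 => x _; rewrite lee_fin.
exists A; split => //; last by move=> x /= /negP; rewrite -ltNge.
apply: (@integral_gt0_null _ _ _ mu A (fun x => (f x - g x)%:E)) => //.
- by apply/measurable_EFinP; apply: measurable_funB; exact: measurable_funTS.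
- by move=> x; rewrite lte_fin subr_gt0.
apply/eqP; rewrite eq_le integral_ge0 ?andbT; last first.
  by move=> x /ltW; rewrite lee_fin subr_ge0.
by have := fg A mA; rewrite -fgA -[leRHS]add0e leeD2rE.
Qed.

Lemma cvg_interaction (k : nat -> T -> \bar R) (K : T -> \bar R) f g :
  (forall n, kernel_function (k n)) -> (forall x, nondecreasing_seq (k ^~ x)) ->
  (forall x, k n x @[n --> \oo] --> K x) -> weight f -> weight g ->
  interaction (k n) f g @[n --> \oo] --> interaction K f g.
Proof.
move=> hk kmono kK wf wg; have [mf f0] := wf; have [mg g0] := wg.
have kn0 n x : 0 <= k n x by case: (hk n).
have pK y : potential (k n) g y @[n --> \oo] --> potential K g y.
  have -> : potential K g y = \int[mu]_x (limn (fun n => (g x)%:E * k n (x - y)%R)).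
    apply: eq_integral => x _; apply/esym/cvg_lim => //.
    by apply: cvgeZl => //; exact: kK.
  apply: cvg_monotone_convergence => //.
  - by move=> n; apply: measurable_weightM => //; exact: measurable_kernel_shift.
  - by move=> n x _; rewrite mule_ge0 ?lee_fin.
  - by move=> x _ i j ij; rewrite lee_wpmul2l ?lee_fin//; exact: kmono.
have -> : interaction K f g = \int[mu]_y (limn (fun n => (f y)%:E * potential (k n) g y)).
  by apply: eq_integral => y _; apply/esym/cvg_lim => //; apply: cvgeZl => //; exact: pK.
apply: cvg_monotone_convergence => //.
- by move=> n; apply: measurable_weightM => //; exact: measurable_potential.
- by move=> n y _; rewrite mule_ge0 ?lee_fin//; exact: potential_ge0.
- move=> y _ i j ij; rewrite lee_wpmul2l ?lee_fin//; apply: ge0_le_integral => //.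
  + by move=> x _; rewrite mule_ge0 ?lee_fin.
  + by apply: measurable_weightM => //; exact: measurable_kernel_shift.
  + by apply: measurable_weightM => //; exact: measurable_kernel_shift.
  + by move=> x _; rewrite lee_wpmul2l ?lee_fin//; exact: kmono.
Qed.

Lemma cvg_kernel_integral (k : nat -> T -> \bar R) (K : T -> \bar R) :
  (forall n, kernel_function (k n)) -> (forall x, nondecreasing_seq (k ^~ x)) ->
  (forall x, k n x @[n --> \oo] --> K x) ->
  \int[mu]_x k n x @[n --> \oo] --> \int[mu]_x K x.
Proof.
move=> hk kmono kK.
have -> : \int[mu]_x K x = \int[mu]_x (limn (fun n => k n x)).
  by apply: eq_integral => x _; apply/esym/cvg_lim => //; exact: kK.
apply: cvg_monotone_convergence => //; first by move=> n; case: (hk n).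
- by move=> n x _; case: (hk n).
Qed.

End interaction_calculus.

(** * Weak limits of the quadratic energy *)

Section pair_limits.
Variables (R : realType) (N : nat).
Local Notation T := 'rV[R]_N.
Local Notation mu := (@borel_lebesgue_measure R N).
Local Open Scope ereal_scope.
Implicit Types (u f : T -> R).

Definition pair_weight u (p : T * T) : \bar R := (u p.1 * u p.2)%:E.

Lemma measurable_pair_weight u : weight u -> measurable_fun setT (pair_weight u).
Proof.
move=> [mu_ u0]; apply/measurable_EFinP; apply: measurable_funM.
  by apply: measurableT_comp => //; exact: measurable_fst.
by apply: measurableT_comp => //; exact: measurable_snd.
Qed.

Lemma pair_weight_ge0 u p : weight u -> 0 <= pair_weight u p.
Proof. by move=> [_ u0]; rewrite lee_fin mulr_ge0. Qed.

Definition pair_mass u (W : set (T * T)) := \int[mu \x mu]_(p in W) pair_weight u p.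

Lemma pair_massE u W : weight u -> measurable W ->
  pair_mass u W = \int[mu]_x ((u x)%:E * \int[mu]_y ((u y)%:E * (\1_W (x, y))%:E)).
Proof.
move=> wu mW; have [mu_ u0] := wu; rewrite /pair_mass integral_indicE.
have mF := measurable_indicM mW (measurable_pair_weight wu).
have F0 p : 0 <= (\1_W p)%:E * pair_weight u p by rewrite mule_ge0 ?pair_weight_ge0// lee_fin.
rewrite fubini_tonelli1//; apply: eq_integral => x _.
rewrite /fubini_F -ge0_integralZl//.
- by apply: eq_integral => y _; rewrite /pair_weight/= EFinM muleC muleA.
- apply: measurable_weightM => //; apply/measurable_EFinP.
  by apply: (measurableT_comp (measurable_indic mW)); exact: measurable_pair1.
- by move=> y _; rewrite mule_ge0 ?lee_fin.
- by rewrite lee_fin.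
Qed.

Lemma pair_mass_rect u A B : weight u -> measurable A -> measurable B ->
  pair_mass u (A `*` B) = \int[mu]_(x in A) (u x)%:E * \int[mu]_(x in B) (u x)%:E.
Proof.
move=> wu mA mB; have [mu_ u0] := wu; rewrite pair_massE//; last exact: measurableX.
have IB0 : 0 <= \int[mu]_(x in B) (u x)%:E by apply: integral_ge0 => x _; rewrite lee_fin.
rewrite muleC [X in _ = _ * X]integral_indicE -ge0_integralZl//; last 2 first.
- by apply: measurable_indicM => //; exact: measurable_EFin_weight.
- by move=> x _; rewrite mule_ge0 ?lee_fin.
apply: eq_integral => x _; rewrite [RHS]muleC -[RHS]muleA [RHS]muleCA; congr (_ * _).
rewrite [in RHS]integral_indicE -ge0_integralZl//.
- apply: eq_integral => y _; transitivity ((\1_A x * \1_B y)%:E * (u y)%:E).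
    by rewrite muleC; congr (_%:E * _); rewrite !indicE in_setX -natrM mulnb.
  by rewrite EFinM muleA.
- by apply: measurable_indicM => //; exact: measurable_EFin_weight.
- by move=> y _; rewrite mule_ge0 ?lee_fin.
Qed.

Lemma le_pair_mass u f W : weight u -> weight f -> (forall x, u x <= f x)%R ->
  measurable W -> pair_mass u W <= pair_mass f W.
Proof.
move=> wu wf uf mW; apply: ge0_le_integral => //.
- by move=> p _; exact: pair_weight_ge0.
- by apply: measurable_funTS; exact: measurable_pair_weight.
- by apply: measurable_funTS; exact: measurable_pair_weight.
- by move=> p _; rewrite lee_fin ler_pM//; [case: wu|case: wu].
Qed.

Definition difference_set (C : set T) : set (T * T) := [set p | C (p.2 - p.1)%R].

Lemma measurable_difference_set C : measurable C -> measurable (difference_set C).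
Proof.
move=> mC; rewrite -[difference_set C]setTI.
have mD : measurable_fun setT (fun p : T * T => (p.2 - p.1)%R).
  by apply: measurable_funB_rV; [exact: measurable_snd|exact: measurable_fst].
exact: mD.
Qed.

(** Turns a quadratic energy into the mass of a subset of the product space, where measures can be
    compared on rectangles. *)
Lemma interaction_pair_mass C u : measurable C -> weight u ->
  interaction (fun x => (\1_C x)%:E) u u = pair_mass u (difference_set C).
Proof.
move=> mC wu; rewrite pair_massE//; last exact: measurable_difference_set.
Qed.

Section ultralimits.
Variables (J : Type) (U : set_system J).
Context {UU : UltraFilter U}.

(** Weak convergence does not in general pass to products evaluated on the same points, but here the
    products are in independent variables. Their ultralimit is a measure, dominated on the square of
    the cube, and on rectangles it is the product of the limits of the masses; hence it is the
    product measure. *)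
Lemma pair_ultralimit (h : J -> T -> R) (f : T -> R) (r : R) :
  (forall i, measurable_fun setT (h i)) -> (forall i x, 0 <= h i x <= 1)%R ->
  measurable_fun setT f -> (forall x, 0 <= f x <= 1)%R ->
  (forall A, measurable A -> A `<=` cube r -> (fun i => mass (h i) A) @ U --> mass f A) ->
  forall W, measurable W -> (fun i => fine (pair_mass (fun x => h i x * \1_(cube r) x)%R W)) @ U -->
    fine (pair_mass (fun x => f x * \1_(cube r) x)%R W).
Proof.
move=> mh h01 mf f01 hf W mW.
have mQ : measurable (@cube R N r) by exact: measurable_cube.
have cutw (u : T -> R) : measurable_fun setT u -> (forall x, 0 <= u x <= 1)%R ->
    weight (fun x => u x * \1_(cube r) x)%R.
  move=> mu_ u01; apply: weightM; last exact: weight_indic.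
  by split => // x; have /andP[] := u01 x.
have cutle (u : T -> R) : (forall x, 0 <= u x <= 1)%R ->
    forall x, (u x * \1_(cube r) x <= \1_(cube r) x)%R.
  by move=> u01 x; rewrite ler_piMl//; have /andP[] := u01 x.
have cutI (u : T -> R) (A : set T) :
    \int[mu]_(x in A) (u x * \1_(cube r) x)%:E = \int[mu]_(x in A `&` cube r) (u x)%:E.
  rewrite [LHS]integral_indicE [RHS]integral_indicE; apply: eq_integral => x _.
  by rewrite indicI /= -!EFinM -mulrA; congr EFin; ring.
have mAQ (A : set T) : measurable A -> measurable (A `&` cube r) by move=> mA; apply: measurableI.
have sAQ (A : set T) : A `&` cube r `<=` cube r by move=> x [].
have mI (u : T -> R) (A : set T) : measurable_fun setT u -> (forall x, 0 <= u x <= 1)%R -> measurable A ->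
    \int[mu]_(x in A) (u x * \1_(cube r) x)%:E = (mass u (A `&` cube r))%:E.
  by move=> mu_ u01 mA; rewrite cutI (massE (r := r))//; exact: mAQ.
have rect (u : T -> R) (A B : set T) : measurable_fun setT u -> (forall x, 0 <= u x <= 1)%R ->
    measurable A -> measurable B -> pair_mass (fun x => u x * \1_(cube r) x)%R (A `*` B) =
    (mass u (A `&` cube r) * mass u (B `&` cube r))%:E.
  by move=> mu_ u01 mA mB; rewrite pair_mass_rect ?mI//; exact: cutw.
have w1 := weight_indic mQ.
pose D u (wu : weight u) : {measure set (T * T) -> \bar R} :=
  density_measure (mu \x mu) (measurable_pair_weight wu) (fun p => pair_weight_ge0 p wu).
have [|i A mA|i A B mA mB AB|nu nuP] := @ultralimit_measure R J U UU _ (T * T)%type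
    (D _ w1) (fun i W => pair_mass (fun x => h i x * \1_(cube r) x)%R W).
- rewrite -[ltLHS]/(pair_mass (\1_(cube r)) setT) -setXTT pair_mass_rect//.
  have -> : \int[mu]_x (\1_(cube r) x)%:E = mu (cube r) by rewrite integral_indic// setIT.
  by rewrite lte_mul_pinfty// ?cube_lty// cube_fin_num.
- apply/andP; split; first by apply: integral_ge0 => p _; apply: pair_weight_ge0; exact: cutw.
  by apply: le_pair_mass => //; [exact: cutw|exact: cutle].
- exact: (measureU (D _ (cutw _ (mh i) (h01 i))) mA mB AB).
have [_ nuW] := nuP W mW.
suff -> : pair_mass (fun x => f x * \1_(cube r) x)%R W = nu W by [].
pose pi : {measure set T -> \bar R} := density_measure mu
  (measurable_EFin_weight (cutw _ mf f01)) (fun x => (cutw _ mf f01).2 x).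
have [|pi' pi'E] := @finite_measure_pack _ _ _ pi.
  by rewrite -[ltLHS]/(\int[mu]_(x in setT) (f x * \1_(cube r) x)%:E) mI// ltry.
have piE A : measurable A -> pi' A = (mass f (A `&` cube r))%:E.
  by move=> mA; rewrite pi'E -mI.
transitivity ((pi' \x pi') W).
  rewrite -[LHS]/(D _ (cutw _ mf f01) W); apply/esym/product_measure_unique => // A B mA mB.
  by rewrite -[LHS]/(pair_mass _ _) rect// EFinM; congr (_ * _); apply/esym; exact: piE.
apply: product_measure_unique => // A B mA mB.
have -> : pi' A * pi' B = (mass f (A `&` cube r) * mass f (B `&` cube r))%:E.
  by rewrite EFinM; congr (_ * _); exact: piE.
have mAB : measurable (A `*` B) by exact: measurableX.
have [_ nuAB] := nuP _ mAB.
rewrite -[LHS]fineK; last exact: fin_num_measure.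
congr EFin; apply: (cvg_unique (@norm_hausdorff _ R) nuAB).
rewrite (_ : (fun i => _) = (fun i => mass (h i) (A `&` cube r) * mass (h i) (B `&` cube r)))%R.
  by apply: cvgM; apply: hf => //; exact: mAQ.
by apply/funext => i; rewrite rect.
Qed.

End ultralimits.

End pair_limits.

(** * Concentration along lattice points *)

Section esum_seq.
Variables (R : realType) (I : choiceType) (S : set I) (a : I -> \bar R).
Local Open Scope ereal_scope.

Lemma fsets_seq (X : set I) : fsets S X -> exists s : seq I,
  [/\ uniq s, forall x, x \in s -> S x & \sum_(x \in X) a x = \sum_(x <- s) a x].
Proof.
move=> [finX XS]; exists (finmap.enum_fset (fset_set X)); split.
- exact: finmap.fset_uniq.
- by move=> x; rewrite in_fset_set// inE => /XS.
- by rewrite fsbig_finite.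
Qed.

Lemma esum_le_seq b : (forall s : seq I, uniq s -> (forall x, x \in s -> S x) ->
  \sum_(x <- s) a x <= b) -> \esum_(x in S) a x <= b.
Proof.
by move=> H; apply: ge_ereal_sup => _ /= [X /fsets_seq[s [us sS ->]] <-]; exact: H.
Qed.

Lemma esum_ge_seq_in (s : seq I) : uniq s -> (forall x, x \in s -> S x) ->
  \sum_(x <- s) a x <= \esum_(x in S) a x.
Proof.
move=> us sS; apply: esum_ge; exists [set` s]; first by split => // x /= /sS.
by rewrite fsbig_seq.
Qed.

Lemma esum_seq_adherent e : (0 < e)%R -> \esum_(x in S) a x \is a fin_num ->
  exists s : seq I, [/\ uniq s, forall x, x \in s -> S x &
    \esum_(x in S) a x < \sum_(x <- s) a x + e%:E].
Proof.
move=> e0 fin; have [_ /= [X /fsets_seq[s [us sS ->]] <-] H] := ub_ereal_sup_adherent e0 fin.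
by exists s; split => //; rewrite -lteBlDr.
Qed.

End esum_seq.

Section bubbles.
Variables (R : realType) (N : nat) (V : 'M[R]_N).
Hypothesis V0 : \det V != 0.
Variables (J : Type) (U : set_system J).
Context {UU : UltraFilter U}.
Variable g : J -> 'rV[R]_N -> R.
Hypothesis gP : forall i, relaxed_packing V (g i).

Local Notation T := 'rV[R]_N.
Local Notation mu := (@borel_lebesgue_measure R N).
Local Notation lp := (lattice_point V).
Local Notation shift v := (fun x : T => x + v)%R.
Local Notation chain := (J -> 'rV[int]_N).

Lemma cell_cube : cell V `<=` cube (N%:R * `|V|).
Proof.
move=> x cx; have uV : V \in unitmx by rewrite unitmxE unitfE.
rewrite /cube/= -(mulmxKV uV x); apply: le_trans (norm_mulmx_le _ _) _.
rewrite ler_wpM2l// -[leRHS]mul1r ler_wpM2r//.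
apply: norm_le_entries => // i j; have := cx j; rewrite [i]ord1 => /andP[x0 /ltW x1].
by rewrite ger0_norm.
Qed.

Lemma near_seq (I0 : eqType) (s : seq I0) (P : I0 -> set J) :
  (forall x, x \in s -> U (P x)) -> U [set i | forall x, x \in s -> P x i].
Proof.
elim: s => [|a s IH] H; first by apply: filterS filterT => i.
have Ua : U (P a) by apply: H; rewrite mem_head.
have Us : U [set i | forall x, x \in s -> P x i].
  by apply: IH => x xs; apply: H; rewrite in_cons xs orbT.
apply: filterS2 Ua Us => i Pa Ps x; rewrite in_cons => /orP[/eqP->//|]; exact: Ps.
Qed.

Lemma integral_shift_set (F : T -> \bar R) (A : set T) v : measurable A ->
  measurable_fun setT F -> (forall x, (0 <= F x)%E) ->
  (\int[mu]_(x in A) F (x + v)%R = \int[mu]_(x in shift (- v)%R @^-1` A) F x)%E.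
Proof.
move=> mA mF F0; have mA' : measurable (shift (- v) @^-1` A) by exact: measurable_shift.
rewrite [RHS]integral_indicE -(integral_translate v).
- by rewrite integral_indicE; apply: eq_integral => x _; rewrite !indicE; congr ((_ : bool)%:R%:E * _)%E;
    apply/idP/idP; rewrite !inE /= addrK.
- exact: measurable_indicM.
- by move=> x; rewrite mule_ge0// lee_fin.
Qed.

Definition recenter (k : chain) i (x : T) := g i (x + lp (k i)).

Let g_meas i : measurable_fun setT (g i). Proof. by have [] := gP i. Qed.
Let g01 i x : 0 <= g i x <= 1. Proof. by have [] := gP i. Qed.
Let g_ge0 i x : 0 <= g i x. Proof. by have /andP[] := g01 i x. Qed.

Lemma recenter_meas k i : measurable_fun setT (recenter k i).
Proof. by apply: (measurableT_comp (g_meas i)); exact: measurable_addr_rV. Qed.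

Lemma recenter01 k i x : 0 <= recenter k i x <= 1.
Proof. exact: g01. Qed.

Definition is_profile (k : chain) (f : T -> R) :=
  [/\ measurable_fun setT f, forall x, 0 <= f x <= 1 &
    forall r A, measurable A -> A `<=` cube r ->
      (fun i => mass (recenter k i) A) @ U --> mass f A].

(* The part of the family that travels with the lattice points [lp (k i)]. *)
Definition profile (k : chain) : T -> R := get (is_profile k).

Lemma profileP k : is_profile k (profile k).
Proof.
have [f fP] := @local_ultralimit R N J U UU (recenter k) (recenter_meas k) (recenter01 k).
exact: (getPex (ex_intro (is_profile k) f fP)).
Qed.

Lemma profile_meas k : measurable_fun setT (profile k). Proof. by have [] := profileP k. Qed.
Lemma profile01 k x : 0 <= profile k x <= 1. Proof. by have [] := profileP k. Qed.
Lemma profile_ge0 k x : 0 <= profile k x. Proof. by have /andP[] := profile01 k x. Qed.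
Lemma weight_profile k : weight (profile k).
Proof. by split; [exact: profile_meas|exact: profile_ge0]. Qed.

(** Chains at a constant lattice offset, for almost all indices in the sense of [U], see translates
    of one profile. Each class must be counted once. *)
Definition comoving (k l : chain) := exists c, U [set i | k i - l i = c].

Lemma comoving_refl k : comoving k k.
Proof. by exists 0; apply: filterS filterT => i _ /=; rewrite subrr. Qed.

Lemma comoving_sym k l : comoving k l -> comoving l k.
Proof. by move=> [c Uc]; exists (- c); apply: filterS Uc => i /= <-; rewrite opprB. Qed.

Lemma comoving_trans k l m : comoving k l -> comoving l m -> comoving k m.
Proof.
move=> [c Uc] [e Ue]; exists (c + e); apply: filterS2 Uc Ue => i /= <- <-.
by rewrite addrA subrK.
Qed.

(** A canonical representative: [xget] depends only on the class as a set, so comoving chains have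
    equal leaders. Its default value never occurs, since a chain comoves with itself. *)
Definition leader (k : chain) : chain := xget (fun=> 0) (comoving k).

Lemma leader_comoving k : comoving k (leader k).
Proof. exact: (xgetPex _ (ex_intro (comoving k) k (comoving_refl k))). Qed.

Lemma eq_leader k l : comoving k l -> leader k = leader l.
Proof.
move=> kl; congr xget; apply/seteqP; split => m.
  by apply: comoving_trans; exact: comoving_sym.
exact: comoving_trans.
Qed.

Definition leaders : set chain := range leader.

Lemma leaders_far k l : leaders k -> leaders l -> comoving k l -> k = l.
Proof.
move=> [k' _ <-] [l' _ <-] kl; apply: eq_leader.
apply: comoving_trans (leader_comoving k') _; apply: comoving_trans kl _.
exact/comoving_sym/leader_comoving.
Qed.

Local Open Scope ereal_scope.

(** For different leaders or different offsets the lattice points are eventually distinct, so the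
    packing inequality for [g i] applies to them and passes to the limit. *)
Lemma profile_packing (P : seq (chain * 'rV[int]_N)) (A : set T) (r : R) :
  uniq P -> (forall p, p \in P -> leaders p.1) -> measurable A -> A `<=` cube r ->
  \sum_(p <- P) \int[mu]_(x in A) (profile p.1 (x + lp p.2)%R)%:E <= mu A.
Proof.
move=> uP PS mA Ar.
pose B (p : chain * 'rV[int]_N) := shift (- lp p.2)%R @^-1` A.
have mB p : measurable (B p) by exact: measurable_shift.
have Br p : B p `<=` cube (r + `|lp p.2|).
  move=> x /Ar; rewrite /cube/= => xr; rewrite -(subrK (lp p.2) x).
  by rewrite (le_trans (ler_normD _ _))// lerD2r.
have IB p (h : T -> R) : measurable_fun setT h -> (forall x, 0 <= h x <= 1)%R ->
    \int[mu]_(x in A) (h (x + lp p.2)%R)%:E = (mass h (B p))%:E.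
  move=> mh h01; rewrite -(massE mh h01 (mB p) (@Br p)).
  rewrite (@integral_shift_set (fun x => (h x)%:E))//; first exact/measurable_EFinP.
  by move=> x; rewrite lee_fin; have /andP[] := h01 x.
rewrite (eq_bigr (fun p => (mass (profile p.1) (B p))%:E)); last first.
  by move=> p _; rewrite IB//; [exact: profile_meas|exact: profile01].
have muA : mu A \is a fin_num by exact: bounded_measure_fin Ar.
rewrite sumEFin -(fineK muA) lee_fin.
apply: (@ultra_cvg_le R J U UU (fun i => \sum_(p <- P) mass (recenter p.1 i) (B p))%R
  (fun=> fine (mu A))).
(* If two of the lattice points coincide on a set of [U], the leaders differ by a constant there,
   hence are equal, and then so are the offsets. *)
- have : U [set i | forall p, p \in P -> forall q, q \in P -> p != q -> p.1 i + p.2 != q.1 i + q.2]%R.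
    apply: near_seq => p pP; apply: near_seq => q qP.
    have [->|pq] := eqVneq p q; first by apply: filterS filterT => i.
    have [//|Upq] := in_ultra_setVsetC [set i | p.1 i + p.2 != q.1 i + q.2]%R UU.
      by move=> H; apply: filterS H.
    have Ueq : U [set i | p.1 i - q.1 i = q.2 - p.2]%R.
      apply: filterS Upq => i /= /negP; rewrite negbK => /eqP E.
      by rewrite -[q.2](addKr (q.1 i)) -E addrA addrK addrC.
    have pq1 : p.1 = q.1 by apply: leaders_far; [exact: PS|exact: PS|exists (q.2 - p.2)%R].
    have [i /= iE] := filter_ex Ueq.
    move: pq iE; rewrite pq1 subrr => /negP pq /esym /eqP; rewrite subr_eq0 => /eqP pq2.
    by case: pq; apply/eqP; case: (p) (q) pq1 pq2 => [p1 p2] [q1 q2] /= -> ->.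
  apply: filterS => i /= Hi; rewrite -lee_fin -sumEFin fineK//.
  rewrite (eq_bigr (fun p => \int[mu]_(x in A) (g i (x + lp (p.1 i + p.2))%R)%:E)); last first.
    move=> p _; rewrite -(IB p (recenter p.1 i) (recenter_meas _ _) (recenter01 _ _)).
    apply: eq_integral => x _; rewrite /recenter lattice_pointD -addrA; congr (g i (_ + _))%:E.
    by rewrite addrC.
  rewrite -(big_map (fun p => p.1 i + p.2)%R xpredT
    (fun c => \int[mu]_(x in A) (g i (x + lp c)%R)%:E)).
  apply: relaxed_packing_sum => //; rewrite map_inj_in_uniq// => p q pP qP E.
  by apply/eqP; apply: contraT => pq; have := Hi p pP q qP pq; rewrite E eqxx.
- have sum_cvg (s : seq (chain * 'rV[int]_N)) :
      (fun i => \sum_(p <- s) mass (recenter p.1 i) (B p))%R @ U --> (\sum_(p <- s) mass (profile p.1) (B p))%R.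
    elim: s => [|p s IH].
      rewrite big_nil (_ : (fun _ => _) = fun=> 0%R); first exact: cvg_cst.
      by apply/funext => i; rewrite big_nil.
    rewrite big_cons (_ : (fun _ => _) = (fun i => mass (recenter p.1 i) (B p) +
      \sum_(p <- s) mass (recenter p.1 i) (B p))%R); last by apply/funext => i; rewrite big_cons.
    apply: cvgD => //; have [_ _] := profileP p.1; apply; [exact: mB|exact: Br].
  exact: sum_cvg.
- exact: cvg_cst.
Qed.

(** The leaders may be uncountably many. Their contributions are summed set by set, and the total is
    bounded by the packing inequality, so only countably many profiles carry mass. *)
Definition total_profile (A : set T) := \esum_(k in leaders) \int[mu]_(x in A) (profile k x)%:E.

Let IP0 k A : 0 <= \int[mu]_(x in A) (profile k x)%:E.
Proof. by apply: integral_ge0 => x _; rewrite lee_fin profile_ge0. Qed.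

Lemma total_profile_measure : exists nu : {measure set T -> \bar R}, forall A, nu A = total_profile A.
Proof.
have n0 : total_profile set0 = 0 by apply: esum1 => k _; rewrite integral_set0.
have nge0 A : 0 <= total_profile A by apply: esum_ge0 => k _; exact: IP0.
have nsa : semi_sigma_additive total_profile.
  move=> F mF tF mUF.
  have -> : total_profile (\bigcup_n F n) = \sum_(n <oo) total_profile (F n).
    rewrite nneseries_esumT// /total_profile.
    transitivity (\esum_(k in leaders) \esum_(n in [set: nat]) \int[mu]_(x in F n) (profile k x)%:E).
      apply: eq_esum => k _; rewrite -nneseries_esumT// ge0_integral_bigcup//.
      - by apply: measurable_funTS; apply: measurable_EFin_weight; exact: weight_profile.
      - by move=> x _; rewrite lee_fin profile_ge0.
    rewrite !esum_esum//.
    rewrite (@reindex_esum _ _ _ (leaders `*`` (fun=> setT)) _ (fun p => (p.2, p.1)))//.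
    split => [[k n] //= [lk _]|[k n] [k' n'] _ _ /= [-> ->]//|[n k] [_ /= lk]].
    - by split.
    - by exists (k, n).
  by apply: is_cvg_ereal_nneg_natsum_cond => n _ _; exact: nge0.
pose M := isMeasure.Build _ _ _ total_profile n0 nge0 nsa.
pose nu : {measure set T -> \bar R} := HB.pack total_profile M.
by exists nu.
Qed.

Lemma sum_leaders_le (A : set T) r : measurable A -> A `<=` cube r -> total_profile A <= mu A.
Proof.
move=> mA Ar; apply: esum_le_seq => s us sS.
have := @profile_packing [seq (k, 0%R) | k <- s] A r.
rewrite big_map /= => H; apply: le_trans (H _ _ mA Ar).
- by apply: lee_sum => k _; apply/eq_lee/eq_integral => x _; rewrite lattice_point0 addr0.
- by rewrite map_inj_uniq// => k l [].
- by move=> p /mapP[k ks ->] /=; exact: sS.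
Qed.

Lemma total_profile_periodic W : measurable W -> periodic_set V W ->
  total_profile W <= mu (W `&` cell V).
Proof.
move=> mW pW; have mC : measurable (W `&` cell V) by apply: measurableI => //; exact: measurable_cell.
have -> : total_profile W = \esum_(k in leaders) \esum_(c in [set: 'rV[int]_N])
    \int[mu]_(x in W `&` cell V) (profile k (x + lp c)%R)%:E.
  apply: eq_esum => k _; rewrite (integral_periodization V0 mW pW); last 2 first.
  - exact: profile_meas.
  - exact: profile_ge0.
  rewrite ge0_integral_esum//.
  - by move=> c; apply: measurable_EFin_weight; apply: weight_shift; exact: weight_profile.
  - by move=> c x; rewrite lee_fin profile_ge0.
rewrite esum_esum; last first.
  by move=> k c _ _; apply: integral_ge0 => x _; rewrite lee_fin profile_ge0.
apply: esum_le_seq => P uP PS; apply: (profile_packing (r := N%:R * `|V|)) => //.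
- by move=> p /PS [].
- by move=> x [_]; exact: cell_cube.
Qed.

(** The sum of the profiles is obtained as the density of the measure [total_profile], not
    pointwise; the two bounds on that measure make the density at most 1 and a packing. *)
Lemma bubble_sum : exists f : T -> R, relaxed_packing V f /\
  forall A, measurable A -> \int[mu]_(x in A) (f x)%:E = total_profile A.
Proof.
have [nu nuE] := total_profile_measure.
have [||f [mf f01 fE]] := @dominated_density R N nu.
- rewrite nuE; apply: le_lt_trans (total_profile_periodic measurableT _) _; first by [].
  by rewrite setTI borel_lebesgue_cell// ltry.
- apply: le_measure_bounded => r A mA Ar; rewrite nuE; exact: sum_leaders_le Ar.
have fE' A : measurable A -> \int[mu]_(x in A) (f x)%:E = total_profile A.
  by move=> mA; rewrite -nuE fE.
exists f; split => //; split => // W mW pW.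
by rewrite fE'//; exact: total_profile_periodic.
Qed.

Lemma total_profile_fin : total_profile setT \is a fin_num.
Proof.
rewrite ge0_fin_numE; last by apply: esum_ge0 => k _; exact: IP0.
apply: le_lt_trans (total_profile_periodic measurableT _) _; first by [].
by rewrite setTI borel_lebesgue_cell// ltry.
Qed.

Lemma few_leaders (e : R) : (0 < e)%R -> exists s : seq chain, [/\ uniq s,
  forall k, k \in s -> leaders k &
  forall k, leaders k -> k \notin s -> \int[mu]_x (profile k x)%:E < e%:E].
Proof.
move=> e0; have [s [us sS He]] := esum_seq_adherent e0 total_profile_fin.
exists s; split => // k lk nk; move: He; set t := (X in X < _); set S := (X in _ < X + _) => He.
have tfin : t \is a fin_num by exact: total_profile_fin.
have Sfin : S \is a fin_num.
  rewrite ge0_fin_numE; last by apply: sume_ge0.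
  apply: (@le_lt_trans _ _ t); first exact: esum_ge_seq_in.
  by rewrite -ge0_fin_numE//; apply: esum_ge0.
suff: S + \int[mu]_x (profile k x)%:E < S + e%:E by rewrite lteD2lE.
apply: le_lt_trans He; rewrite addeC.
have := @esum_ge_seq_in R _ leaders (fun k => \int[mu]_x (profile k x)%:E) (k :: s).
rewrite big_cons; apply; first by rewrite /= nk.
by move=> l; rewrite in_cons => /orP[/eqP->//|/sS].
Qed.

Lemma weight_sum (I0 : eqType) (s : seq I0) (h : I0 -> T -> R) : (forall k, weight (h k)) ->
  weight (fun x => \sum_(k <- s) h k x)%R.
Proof.
move=> wh; split; first by apply: measurable_sum => k; case: (wh k).
by move=> x; apply: sumr_ge0 => k _; case: (wh k).
Qed.

Lemma interaction_suml (I0 : eqType) (s : seq I0) (h : I0 -> T -> R) k f :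
  kernel_function k -> (forall j, weight (h j)) -> weight f ->
  interaction k (fun x => \sum_(j <- s) h j x)%R f = \sum_(j <- s) interaction k (h j) f.
Proof.
move=> hk wh wf; elim: s => [|j s IH].
  rewrite big_nil [LHS](@eq_interaction _ _ _ _ (cst 0%R) f f)//; last by move=> x; rewrite big_nil.
  by apply: integral0_eq => y _; rewrite mul0e.
rewrite big_cons -IH -interactionDl//; last exact: weight_sum.
by apply: eq_interaction => // x; rewrite big_cons.
Qed.

Lemma integral_tail (h : T -> R) (e : R) : weight h -> \int[mu]_x (h x)%:E < +oo -> (0 < e)%R ->
  exists2 rho, (0 <= rho)%R & \int[mu]_(x in ~` cube rho) (h x)%:E < e%:E.
Proof.
move=> wh hoo e0; have [mh h0] := wh.
have h0' x : 0 <= (h x)%:E by rewrite lee_fin.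
pose D : {measure set T -> \bar R} := density_measure mu (measurable_EFin_weight wh) h0'.
have DE A : D A = \int[mu]_(x in A) (h x)%:E by [].
have Dfin : D setT \is a fin_num by rewrite ge0_fin_numE.
have cD := @measure_cube_cvg R N D setT measurableT.
have [j Hj] : exists j : nat, D setT - e%:E < D (setT `&` cube j%:R).
  apply: contrapT => /forallNP H.
  have : D setT <= D setT - e%:E.
    rewrite -{1}(cvg_lim (@ereal_hausdorff R) cD); apply: lime_le; first exact: cvgP cD.
    by apply: nearW => j; rewrite leNgt; exact/negP.
  by rewrite leNgt lteBlDr// lteDl// lte_fin e0.
exists j%:R => //; rewrite -DE.
have mC : measurable (@cube R N j%:R) by exact: measurable_cube.
have DT : D setT = D (cube j%:R) + D (~` cube j%:R).
  by rewrite -measureU//; [rewrite setUv|exact: measurableC|rewrite setICr].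
have Dj : D (cube j%:R) \is a fin_num.
  by rewrite ge0_fin_numE//; apply: le_lt_trans hoo; apply: le_measure; rewrite ?inE.
by move: Hj; rewrite setTI lteBlDr// [X in X < _]DT lteD2lE.
Qed.

Lemma integral_tail_seq (s : seq chain) (e : R) : (0 < e)%R ->
  (forall k, k \in s -> \int[mu]_x (profile k x)%:E < +oo) ->
  exists2 rho, (0 <= rho)%R &
    forall k, k \in s -> \int[mu]_(x in ~` cube rho) (profile k x)%:E < e%:E.
Proof.
move=> e0; elim: s => [|k s IH] soo; first by exists 0%R.
have [|rho1 rho10 H1] := IH; first by move=> l ls; apply: soo; rewrite in_cons ls orbT.
have [|rho2 rho20 H2] := integral_tail (weight_profile k) _ e0.
  by apply: soo; rewrite mem_head.
have sub (l : chain) (a b : R) : (a <= b)%R ->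
    \int[mu]_(x in ~` cube b) (profile l x)%:E <= \int[mu]_(x in ~` cube a) (profile l x)%:E.
  move=> ab; have mC c : measurable (~` @cube R N c) by apply: measurableC; exact: measurable_cube.
  apply: ge0_subset_integral => //.
  - by apply: measurable_funTS; apply: measurable_EFin_weight; exact: weight_profile.
  - by move=> x _; rewrite lee_fin profile_ge0.
  - by apply: subsetC; exact: cubeS.
exists (Num.max rho1 rho2); first by rewrite le_max rho10.
move=> l; rewrite in_cons => /orP[/eqP->|ls].
  by apply: le_lt_trans H2; apply: sub; rewrite le_max lexx orbT.
by apply: le_lt_trans (H1 l ls); apply: sub; rewrite le_max lexx.
Qed.

(* Otherwise recentring at the points of concentration would produce one more profile. *)
Lemma vanishing (s : seq chain) (e rho r : R) :
  (forall k, leaders k -> k \notin s -> \int[mu]_x (profile k x)%:E < e%:E) ->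
  (forall k, k \in s -> \int[mu]_(x in ~` cube rho) (profile k x)%:E < e%:E) ->
  U [set i | forall y, (forall k, k \in s -> (rho + r < `|y - lp (k i)|)%R) ->
    \int[mu]_(x in shift (- y)%R @^-1` cube r) (g i x)%:E <= e%:E].
Proof.
move=> small tail; set G := [set i | _].
have [//|UG] := in_ultra_setVsetC G UU.
have /choice[y yP] i : exists y, (~` G) i -> (forall k, k \in s -> (rho + r < `|y - lp (k i)|)%R) /\
    e%:E < \int[mu]_(x in shift (- y)%R @^-1` cube r) (g i x)%:E.
  have [Gi|/existsNP[y /not_implyP[H1 /negP H2]]] := pselect (G i); first by exists 0%R.
  by exists y => _; split => //; rewrite ltNge.
(* The lattice point whose cell contains the point of concentration; it stays within a bounded
   distance of it. *)
pose k : chain := fun i => cell_index V (y i).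
have kb i : (`|y i - lp (k i)| <= N%:R * `|V|)%R.
  by apply: cell_cube; apply/cellP.
have [c Uc] := leader_comoving k; set l := leader k in Uc.
have ll : leaders l by exists k.
(* Seen from the leader, the cube around [y i] lies in a fixed large cube. If the leader belongs to
   [s], the cube also avoids [cube rho], so only the small tail of that profile can be met. *)
pose A : set T := cube (`|lp c| + N%:R * `|V| + r) `\` (if l \in s then cube rho else set0).
have mA : measurable A.
  by apply: measurableD; [exact: measurable_cube|case: ifP => _; [exact: measurable_cube|]].
have Ar : A `<=` cube (`|lp c| + N%:R * `|V| + r) by move=> x [].
have [_ _ /(_ _ _ mA Ar) limA] := profileP l.
have pA : \int[mu]_(x in A) (profile l x)%:E < e%:E.
  have [ls|ls] := boolP (l \in s).
    apply: le_lt_trans (tail _ ls); apply: ge0_subset_integral => //.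
    - by apply: measurableC; exact: measurable_cube.
    - by apply: measurable_funTS; apply: measurable_EFin_weight; exact: weight_profile.
    - by move=> x _; rewrite lee_fin profile_ge0.
    - by move=> x [_]; rewrite ls.
  apply: le_lt_trans (small _ ll ls); apply: ge0_subset_integral => //.
  - by apply: measurable_EFin_weight; exact: weight_profile.
  - by move=> x _; rewrite lee_fin profile_ge0.
have : (e <= mass (profile l) A)%R.
  apply: (@ultra_cvg_le R J U UU (fun=> e) (fun i => mass (recenter l i) A)) => //; last exact: cvg_cst.
  apply: filterS2 UG Uc => i /= /yP[yfar ybig] kl.
  rewrite -lee_fin -(massE (recenter_meas l i) (recenter01 l i) mA Ar).
  apply: (le_trans (ltW ybig)).
  have [mgi _ _] := gP i.
  rewrite (@integral_shift_set (fun x => (g i x)%:E))//; last 2 first.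
  - exact/measurable_EFinP.
  - by move=> x; rewrite lee_fin g_ge0.
  apply: ge0_subset_integral.
  - exact: measurable_shift_cube.
  - exact: measurable_shift.
  - by apply: measurable_funTS; exact/measurable_EFinP.
  - by move=> x _; rewrite lee_fin g_ge0.
  move=> x /= xy; split.
    rewrite /cube/=; have -> : (x - lp (l i) = (x - y i) + (y i - lp (k i)) + (lp (k i) - lp (l i)))%R.
      by rewrite !addrA !subrK.
    rewrite -lattice_pointB kl; apply: (le_trans (ler_normD _ _)).
    have := ler_normD (x - y i)%R (y i - lp (k i))%R; have := kb i; move: xy; rewrite /cube/=.
    by move: `|lp c|%R `|x - y i|%R `|y i - lp (k i)|%R `|_ + _|%R => *; lra.
  have [ls|_] := boolP (l \in s); last by move=> [].
  have := yfar _ ls; rewrite /cube/= => yl xl.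
  have : (`|y i - lp (l i)| <= rho + r)%R.
    have -> : (y i - lp (l i) = (x - lp (l i)) - (x - y i))%R.
      by rewrite opprB [RHS]addrC addrA subrK.
    by rewrite (le_trans (ler_normB _ _))// lerD.
  by rewrite leNgt yl.
rewrite -lee_fin -(massE (profile_meas l) (profile01 l) mA Ar).
by rewrite leNgt pA.
Qed.

Lemma profile_sum_le (f : T -> R) (s : seq chain) : weight f ->
  (forall A, measurable A -> \int[mu]_(x in A) (f x)%:E = total_profile A) ->
  uniq s -> (forall k, k \in s -> leaders k) ->
  {ae mu, forall x, (\sum_(k <- s) profile k x <= f x)%R}.
Proof.
move=> wf fE us sS.
have wp := weight_sum s weight_profile.
have le A : measurable A ->
    \int[mu]_(x in A) (\sum_(k <- s) profile k x)%:E <= \int[mu]_(x in A) (f x)%:E.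
  move=> mA; rewrite fE//; under eq_integral => x _ do rewrite -sumEFin.
  rewrite ge0_integral_sum//; first exact: esum_ge_seq_in.
    by move=> k; apply: measurable_funTS; apply: measurable_EFin_weight; exact: weight_profile.
  by move=> k x _; rewrite lee_fin profile_ge0.
apply: ae_le_integral => //; apply: le_lt_trans (le _ measurableT) _.
by rewrite fE// -ge0_fin_numE ?total_profile_fin//; apply: esum_ge0.
Qed.

(** A point within [rho + r] of one of finitely many chosen lattice points has its whole
    neighbourhood of interaction in a region where the weak limit is controlled. At any other point,
    [vanishing] makes the potential small. *)
Lemma energy_usc (f : T -> R) (C : set T) (r e : R) : relaxed_packing V f ->
  (forall A, measurable A -> \int[mu]_(x in A) (f x)%:E = total_profile A) ->
  measurable C -> C `<=` cube r -> (0 <= r)%R -> (0 < e)%R ->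
  U [set i | interaction (fun x : T => (\1_C x)%:E) (g i) (g i) <=
             interaction (fun x : T => (\1_C x)%:E) f f + e%:E].
Proof.
move=> [mf f01 fpack] fE mC Cr r0 e0.
have wf : weight f by split => // x; have /andP[] := f01 x.
have wg i : weight (g i) by split; [exact: g_meas|exact: g_ge0].
set k := (fun x : T => (\1_C x)%:E); have hk : kernel_function k by exact: kernel_function_indic.
have kM x : k x <= 1%:E * (\1_(cube r) x)%:E.
  rewrite mul1e lee_fin !indicE; have [/set_mem/Cr xr|//] := boolP (x \in C).
  by rewrite mem_set.
pose m := `|\det V|%R; have m0 : (0 < m)%R by rewrite normr_gt0.
(* The total mass is at most [m], so points far from all chosen lattice points contribute at most
   [m * e1 = e / 2]. *)
pose e1 := (e / (2 * m))%R; have e10 : (0 < e1)%R by rewrite divr_gt0// mulr_gt0.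
have [s [us sS small]] := few_leaders e10.
have pfin l : leaders l -> \int[mu]_x (profile l x)%:E < +oo.
  move=> ll; apply: (@le_lt_trans _ _ (total_profile setT)); last first.
    by rewrite -ge0_fin_numE ?total_profile_fin//; apply: esum_ge0.
  have := @esum_ge_seq_in R _ leaders (fun k => \int[mu]_x (profile k x)%:E) [:: l].
  by rewrite big_seq1; apply => // ?; rewrite inE => /eqP ->.
have [|rho rho0 tail] := integral_tail_seq e10 (s := s); first by move=> l /sS; exact: pfin.
pose e2 := (e / (2 * (size s).+1%:R))%R; have e20 : (0 < e2)%R by rewrite divr_gt0// mulr_gt0.
(* A point at distance at most [rho + r] and its partners at range [r] all lie in the cube of radius
   [q]. *)
pose q := (rho + r + r)%R; pose cut (h : T -> R) x := (h x * \1_(cube q) x)%R.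
have mQ : measurable (@cube R N q) by exact: measurable_cube.
have wcut h : weight h -> weight (cut h) by move=> wh; apply: weightM => //; exact: weight_indic.
have cutfin (h : T -> R) : measurable_fun setT h -> (forall x, 0 <= h x <= 1)%R ->
    interaction k (cut h) (cut h) \is a fin_num.
  move=> mh h01; have wh : weight h by split => // x; have /andP[] := h01 x.
  rewrite ge0_fin_numE; last by apply: interaction_ge0 => //; exact: wcut.
  rewrite interaction_pair_mass//; last exact: wcut.
  apply: (@le_lt_trans _ _ (pair_mass (\1_(cube q)) setT)).
    apply: (@le_trans _ _ (pair_mass (\1_(cube q)) (difference_set C))).
      apply: le_pair_mass; [exact: wcut|exact: weight_indic| |exact: measurable_difference_set].
      by move=> x; rewrite /cut ler_piMl//; have /andP[] := h01 x.
    apply: ge0_subset_integral => //; first exact: measurable_difference_set.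
      by apply: measurable_pair_weight; exact: weight_indic.
    by move=> p _; apply: pair_weight_ge0; exact: weight_indic.
  rewrite -setXTT (pair_mass_rect (weight_indic mQ) measurableT measurableT).
  have -> : \int[mu]_x (\1_(cube q) x)%:E = mu (cube q) by rewrite integral_indic// setIT.
  by rewrite lte_mul_pinfty// ?cube_lty// cube_fin_num.
have Uvan := vanishing r small tail.
(* Each profile is paired with the whole of [f], which dominates it almost everywhere. Summed over
   the profiles, the first arguments are again dominated by [f], so cross terms only help. *)
have Ulim : U [set i | forall l, l \in s -> interaction k (cut (recenter l i)) (cut (recenter l i)) <=
    interaction k (profile l) f + e2%:E].
  apply: near_seq => l ls.
  have [pm p01 plim] := profileP l.
  have wr i : weight (recenter l i) by split; [exact: recenter_meas|move=> x; exact: g_ge0].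
  have := @pair_ultralimit R N J U UU (recenter l) (profile l) q (recenter_meas l) (recenter01 l) pm p01 (plim q) _ (measurable_difference_set mC).
  move/cvgrPdist_le => /(_ _ e20); apply: filterS => i /= Hi.
  apply: (@le_trans _ _ (interaction k (cut (profile l)) (cut (profile l)) + e2%:E)); last first.
    rewrite leeD2r//; apply: (@le_trans _ _ (interaction k (profile l) (cut (profile l)))).
      apply: le_interactionl => //; [exact/wcut/weight_profile|exact: weight_profile|exact/wcut/weight_profile|].
      apply: aeW => x; rewrite /cut ler_piMr ?profile_ge0// indicE; case: (_ \in _) => //; exact: lexx.
    apply: le_interactionr => //; [exact: weight_profile|exact/wcut/weight_profile|].
    have : {ae mu, forall x, (\sum_(k <- [:: l]) profile k x <= f x)%R}.
      by apply: profile_sum_le => // ?; rewrite inE => /eqP ->; exact: sS.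
    apply: filterS => x; rewrite big_seq1; apply: le_trans.
    by rewrite /cut ler_piMr ?profile_ge0// indicE; case: (_ \in _).
  have cf := cutfin _ pm p01; have cr := cutfin _ (recenter_meas l i) (recenter01 l i).
  rewrite -(fineK cf) -(fineK cr) -EFinD lee_fin.
  rewrite !interaction_pair_mass//; [|exact/wcut/weight_profile|exact: wcut].
  by move: Hi; rewrite distrC ler_distl => /andP[_].
apply: filterS2 Uvan Ulim => i /= van lim.
have gm : \int[mu]_x (g i x)%:E <= m%:E by exact: integral_relaxed_packing.
pose P l := shift (- lp (l i))%R @^-1` @cube R N (rho + r).
have mP l : measurable (P l) by exact: measurable_shift_cube.
have pot0 y : 0 <= potential k (g i) y by exact: potential_ge0.
have mpot : measurable_fun setT (potential k (g i)) by exact: measurable_potential.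
pose F l y := (\1_(P l) y)%:E * ((g i y)%:E * potential k (g i) y).
have F0 l y : 0 <= F l y by rewrite !mule_ge0// lee_fin g_ge0.
have mF l : measurable_fun setT (F l) by apply: measurable_indicM => //; exact: measurable_weightM.
have mge : measurable_fun setT (fun y => (g i y)%:E * e1%:E).
  by apply: measurable_weightM => //; exact: measurable_cst.
have split_y y : (g i y)%:E * potential k (g i) y <= (g i y)%:E * e1%:E + \sum_(l <- s) F l y.
  have [[l ls yl]|far] := pselect (exists2 l, l \in s & P l y).
    apply: (@le_trans _ _ (F l y)); first by rewrite /F indicE mem_set// mul1e.
    rewrite (big_rem l)//= addeCA leeDl// adde_ge0//.
      by rewrite mule_ge0// ?lee_fin ?g_ge0// ltW.
    exact: sume_ge0.
  apply: (@le_trans _ _ ((g i y)%:E * e1%:E)); last by rewrite leeDl//; exact: sume_ge0.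
  rewrite lee_wpmul2l ?lee_fin ?g_ge0//.
  apply: (le_trans (potential_cube y hk (wg i) ler01 kM)); rewrite mul1e; apply: van => l ls.
  by rewrite ltNge; apply/negP => yl; apply: far; exists l.
have Fle l : l \in s -> \int[mu]_y F l y <= interaction k (profile l) f + e2%:E.
  move=> ls; apply: le_trans (lim _ ls).
  have wr : weight (recenter l i) by split; [exact: recenter_meas|move=> x; exact: g_ge0].
  have wc := wcut _ wr.
  rewrite -(integral_translate (lp (l i)))//; apply: ge0_le_integral => //.
  - by apply: (measurableT_comp (mF l)); exact: measurable_addr_rV.
  - by apply: measurable_weightM => //; exact: measurable_potential.
  move=> y _; rewrite /F potential_shift// indicE.
  have [/set_mem|_] := boolP (_ \in _); last first.
    by rewrite mul0e mule_ge0//; [rewrite lee_fin; case: wc|exact: potential_ge0].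
  rewrite /P/= addrK mul1e => yr.
  have yq : cube q y by apply: cubeS yr; rewrite lerDl.
  have -> : cut (recenter l i) y = g i (y + lp (l i)) by rewrite /cut indicE mem_set// mulr1.
  rewrite lee_wpmul2l ?lee_fin ?g_ge0//.
  apply: ge0_le_integral => //.
  - by move=> x _; rewrite mule_ge0 ?lee_fin ?g_ge0.
  - by apply: measurable_weightM => //; exact: measurable_kernel_shift.
  - by apply: measurable_weightM => //; exact: measurable_kernel_shift.
  move=> x _; rewrite /k indicE; have [/set_mem/Cr xy|_] := boolP (_ \in _); last by rewrite !mule0.
  have xq : cube q x.
    rewrite /cube/= -(subrK y x) (le_trans (ler_normD _ _))// addrC; exact: lerD.
  by rewrite /cut indicE mem_set// mulr1.
apply: (@le_trans _ _ (\int[mu]_y ((g i y)%:E * e1%:E + \sum_(l <- s) F l y))).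
  apply: ge0_le_integral => //.
  - by move=> y _; rewrite mule_ge0 ?lee_fin ?g_ge0//; exact: pot0.
  - exact: measurable_weightM.
  - by apply: emeasurable_funD => //; apply: emeasurable_sum.
rewrite ge0_integralD//; last 3 first.
- by move=> y _; rewrite mule_ge0// lee_fin ?g_ge0// ltW.
- by move=> y _; exact: sume_ge0.
- exact: emeasurable_sum.
rewrite ge0_integral_sum//.
have A1 : \int[mu]_y ((g i y)%:E * e1%:E) <= (e / 2)%:E.
  rewrite ge0_integralZr//; last 3 first.
  - exact: measurable_EFin_weight.
  - by move=> y _; rewrite lee_fin g_ge0.
  - by rewrite lee_fin ltW.
  apply: (@le_trans _ _ (m%:E * e1%:E)); first by rewrite lee_wpmul2r// lee_fin ltW.
  by rewrite -EFinM lee_fin /e1 le_eqVlt; apply/orP; left; apply/eqP; field; rewrite gt_eqF.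
have A2 : \sum_(l <- s) \int[mu]_y F l y <= interaction k f f + (e / 2)%:E.
  apply: (@le_trans _ _ (\sum_(l <- s) (interaction k (profile l) f + e2%:E))).
    by rewrite big_seq [leRHS]big_seq; apply: lee_sum => l; exact: Fle.
  rewrite big_split/= leeD//.
    rewrite -interaction_suml//; last exact: weight_profile.
    apply: le_interactionl => //; first exact/weight_sum/weight_profile.
    exact: profile_sum_le.
  have -> : (e / 2 = e2 *+ (size s).+1)%R.
    rewrite /e2 -[RHS]mulr_natr; field.
    by rewrite nat1r pnatr_eq0.
  by rewrite sumEFin lee_fin big_const_seq count_predT iter_addr_0 mulrSr lerDl ltW.
apply: (le_trans (leeD A1 A2)); rewrite addeCA -EFinD leeD2l// lee_fin; lra.
Qed.

End bubbles.

(** * Converging lattices *)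

Section linear_maps.
Variables (R : realType) (N : nat).
Local Notation T := 'rV[R]_N.
Local Notation mu := (@borel_lebesgue_measure R N).
Local Notation shift v := (fun x : T => x + v)%R.
Local Notation lin A := (fun x : T => x *m A).

Lemma measurable_lin (A : 'M[R]_N) (B : set T) : measurable B -> measurable (lin A @^-1` B).
Proof. by move=> mB; apply: measurable_preimageT => //; exact: measurable_mulmx_rV. Qed.

Lemma measure_unimodular (A : 'M[R]_N) (B : set T) : `|\det A| = 1 -> measurable B ->
  mu (lin A @^-1` B) = mu B.
Proof.
move=> dA mB; have A0 : \det A != 0 by rewrite -normr_eq0 dA oner_eq0.
by have := scales_lebesgue_unit A0 mB; rewrite dA mul1e.
Qed.

Lemma integral_unimodular (A : 'M[R]_N) (F : T -> \bar R) : `|\det A| = 1 ->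
  measurable_fun setT F -> (forall x, (0 <= F x)%E) ->
  (\int[mu]_x F (x *m A) = \int[mu]_x F x)%E.
Proof.
move=> dA mF F0; have mA := @measurable_mulmx_rV R N N A.
transitivity (\int[image_measure mu mA]_x F x)%E.
  by rewrite (@ge0_integral_pushforward _ _ _ _ _ _ mA)// preimage_setT.
by apply: eq_measure_integral => B mB _; exact: measure_unimodular.
Qed.

Definition slab i (a eta rho : R) : set T :=
  [set x : T | `|x ord0 i - a| <= eta /\ `|x| <= rho].

(** The slab is contained in a translate of the image of [cube rho] under the diagonal matrix that
    scales coordinate [i] by [eta / rho]. *)
Lemma slab_small i a eta rho : 0 < eta -> 0 < rho ->
  exists2 B, measurable B & slab i a eta rho `<=` B /\ (mu B <= (eta / rho)%:E * mu (cube rho))%E.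
Proof.
move=> eta0 rho0; pose D : 'M[R]_N := diag_mx (\row_j if j == i then eta / rho else 1).
have dD : \det D = eta / rho.
  rewrite det_diag (bigD1 i)//= !mxE eqxx big1 ?mulr1// => j /negPf ji.
  by rewrite !mxE ji.
have dD0 : \det D != 0 by rewrite dD gt_eqF// divr_gt0.
have dD0' : \det (invmx D) != 0 by rewrite det_inv invr_eq0.
have uD : D \in unitmx by rewrite unitmxE unitfE.
pose w : T := - (a *: delta_mx ord0 i).
exists (shift w @^-1` (lin (invmx D) @^-1` cube rho)).
  by apply: measurable_shift; apply: measurable_lin; exact: measurable_cube.
split; last first.
  rewrite borel_lebesgue_translate; last by apply: measurable_lin; exact: measurable_cube.
  have := scales_lebesgue_unit dD0' (@measurable_cube R N rho).
  rewrite det_inv dD normfV gtr0_norm ?divr_gt0// => <-.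
  rewrite muleA -EFinM mulfV ?mul1e//.
  by rewrite gt_eqF// divr_gt0.
move=> x [xi xr]; rewrite /cube/=.
have -> : (x + w) *m invmx D = \row_j ((x + w) ord0 j / (if j == i then eta / rho else 1)).
  apply: (can_inj (mulmxK uD)); rewrite mulmxKV// mul_mx_diag.
  apply/rowP => j; rewrite [RHS]mxE [X in _ = X * _]mxE [X in _ = _ * X]mxE.
  case: eqP => _; last by rewrite divr1 mulr1.
  by rewrite divfK// gt_eqF// divr_gt0.
apply: norm_le_entries => [|k j]; first exact: ltW.
rewrite !mxE !eqxx /= eq_sym; case: eqVneq => [<-|ji].
  rewrite mulr1 normrM normfV (gtr0_norm (divr_gt0 eta0 rho0)) ler_pdivrMr ?divr_gt0//.
  by rewrite mulrC divfK ?gt_eqF// ?divr_gt0// ; exact: xi.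
rewrite mulr0 oppr0 addr0 divr1; apply: le_trans xr; exact: entry_le_norm.
Qed.

Section continuity.
Variables (J : Type) (U : set_system J).
Context {FU : Filter U}.
Variable phi : J -> T -> T.
Hypothesis mphi : forall i, measurable_fun setT (phi i).
Hypothesis phi_preserves : forall i B, measurable B -> mu (phi i @^-1` B) = mu B.
Hypothesis phi_near : forall rho d, 0 < rho -> 0 < d ->
  U [set i | forall x, cube rho x -> `|phi i x - x| <= d].

Let mpre i B : measurable B -> measurable (phi i @^-1` B).
Proof. by move=> mB; apply: measurable_preimageT. Qed.

Definition symdiff i (C : set T) : set T := (phi i @^-1` C `\` C) `|` (C `\` phi i @^-1` C).

Lemma measurable_symdiff i C : measurable C -> measurable (symdiff i C).
Proof. by move=> mC; apply: measurableU; apply: measurableD => //; exact: mpre. Qed.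

(** Local continuity in measure of the preimage of [C] under measure-preserving maps tending to the
    identity. These sets form a sigma-algebra containing the coordinate half-spaces; the maps are
    later linear ones and small translations. *)
Definition vanishing_symdiff (C : set T) := measurable C /\ forall rho e, 0 < rho -> 0 < e ->
  U [set i | (mu (symdiff i C `&` cube rho) <= e%:E)%E].

Lemma vanishing_symdiff_halfspace k a : vanishing_symdiff [set x : T | x ord0 k < a].
Proof.
have mC : measurable [set x : T | x ord0 k < a].
  rewrite -[X in measurable X]setTI.
  exact: (@measurable_coord_rV R N k measurableT `]-oo, a[%classic).
split => // rho e rho0 e0.
pose c := fine (mu (cube rho)); have c0 : 0 <= c by rewrite fine_ge0.
pose eta := e * rho / (c + 1).
have eta0 : 0 < eta by rewrite divr_gt0 ?mulr_gt0// ltr_wpDl.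
apply: filterS (phi_near rho0 eta0) => i /= Ai.
have [B mB [sB lB]] := slab_small k a eta0 rho0.
apply: (@le_trans _ _ (mu B)).
  apply: le_measure; rewrite ?inE//.
    by apply: measurableI; [exact: measurable_symdiff|exact: measurable_cube].
  move=> x [+ xr]; have /ler_normlP[h1 h2] : `|(phi i x) ord0 k - x ord0 k| <= eta.
    apply: le_trans (Ai x xr); have -> : (phi i x) ord0 k - x ord0 k = (phi i x - x) ord0 k.
      by rewrite !mxE.
    exact: entry_le_norm.
  move=> H; apply: sB; split => //; apply/ler_normlP; move: h1 h2 H.
  rewrite /symdiff /=; move: ((phi i x) ord0 k) (x ord0 k) => s t h1 h2.
  by case=> -[h3 /negP]; rewrite -leNgt => h4; split; lra.
apply: (le_trans lB); rewrite -[mu _]fineK ?cube_fin_num// -/c -EFinM lee_fin.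
have -> : eta / rho * c = e * (c / (c + 1)).
  by rewrite /eta; field; rewrite !gt_eqF// ltr_wpDl.
by rewrite ler_piMr ?(ltW e0)// ler_pdivrMr ?ltr_wpDl// mul1r lerDl.
Qed.

Lemma vanishing_symdiffC C : vanishing_symdiff C -> vanishing_symdiff (~` C).
Proof.
move=> [mC H]; split; first exact: measurableC.
move=> rho e rho0 e0; have := H rho e rho0 e0; apply: filterS => i /=.
suff -> : symdiff i (~` C) = symdiff i C by [].
rewrite /symdiff preimage_setC !setDE !setCK setUC; congr (_ `|` _); exact: setIC.
Qed.

Lemma vanishing_symdiffU C D : vanishing_symdiff C -> vanishing_symdiff D ->
  vanishing_symdiff (C `|` D).
Proof.
move=> [mC HC] [mD HD]; split; first exact: measurableU.
move=> rho e rho0 e0; have e20 : 0 < e / 2 by rewrite divr_gt0.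
apply: filterS2 (HC rho _ rho0 e20) (HD rho _ rho0 e20) => i /= h1 h2.
apply: (@le_trans _ _ (mu (symdiff i C `&` cube rho) + mu (symdiff i D `&` cube rho))%E).
  have mcut E : measurable E -> measurable (symdiff i E `&` cube rho).
    by move=> mE; apply: measurableI; [exact: measurable_symdiff|exact: measurable_cube].
  apply: (@le_trans _ _ (mu ((symdiff i C `&` cube rho) `|` (symdiff i D `&` cube rho)))); last first.
    by apply: measureU2; exact: mcut.
  apply: le_measure; rewrite ?inE.
  - by apply: mcut; exact: measurableU.
  - by apply: measurableU; exact: mcut.
  rewrite /symdiff => x [+ xr] /=; case=> -[].
    by case=> xA /not_orP[nC nD]; [left|right]; split=> //; left.
  by case=> xA /not_orP[nC nD]; [left|right]; split=> //; right.
by apply: (le_trans (leeD h1 h2)); rewrite -EFinD lee_fin; lra.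
Qed.

Lemma vanishing_symdiff_bigcup (F : (set T)^nat) : (forall n, vanishing_symdiff (F n)) ->
  vanishing_symdiff (\bigcup_n F n).
Proof.
move=> HF; have mF n : measurable (F n) by case: (HF n).
have mC : measurable (\bigcup_n F n) by exact: bigcupT_measurable.
split => // rho e rho0 e0; have e40 : 0 < e / 4 by rewrite divr_gt0.
pose G n := \bigcup_(j < n) F j.
have HG n : vanishing_symdiff (G n).
  rewrite /G bigcup_mkord; elim: n => [|n IH].
    rewrite big_ord0; split => // ? ? _ ?; apply: filterS filterT => i _ /=.
    by rewrite /symdiff preimage_set0 !set0D setU0 set0I measure0 lee_fin ltW.
  by rewrite big_ord_recr/=; exact: vanishing_symdiffU.
have mG n : measurable (G n) by case: (HG n).
(* Eventually the maps move points of [cube rho] by at most 1, so the tails need to be small only on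
   [Q]; as measure is preserved, their preimages are then small too. *)
pose Q := @cube R N (rho + 1).
have mQ : measurable Q by exact: measurable_cube.
pose E n := (\bigcup_n F n) `\` G n.
have mE n : measurable (E n) by exact: measurableD.
have EQ : mu (E n `&` Q) @[n --> \oo] --> 0%E.
  have cap0 : \bigcap_n (E n `&` Q) = set0.
    apply/seteqP; split => // x H; have [[[j _ Fj] _] _] := H 0%N I.
    by have [[_ nG] _] := H j.+1 I; apply: nG; exists j => /=.
  rewrite -(measure0 mu) -cap0; apply: nonincreasing_cvg_mu.
  - apply: (@le_lt_trans _ _ (mu Q)); last exact: cube_lty.
    by apply: le_measure; rewrite ?inE//; exact: measurableI.
  - by move=> n; exact: measurableI.
  - by rewrite cap0.
  - move=> n k nk; apply/subsetPset => x [[xF nG] xQ]; split => //; split => // -[j /= jn Fj].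
    by apply: nG; exists j => //=; exact: leq_trans nk.
have [n En] : exists n, (mu (E n `&` Q) <= (e / 4)%:E)%E.
  have /fine_cvgP[Efin /cvgrPdist_le/(_ _ e40)] := EQ.
  move=> Ecvg; have [n _ Hn] := filterI Efin Ecvg; exists n.
  have [/= f1 f2] := Hn n (leqnn n).
  by rewrite -(fineK f1) lee_fin; apply: le_trans (ler_norm _) _; rewrite -normrN -sub0r.
have [_ /(_ rho _ rho0 e40) UG] := HG n.
apply: filterS2 UG (phi_near rho0 ltr01) => i /= Gi Ai.
have mE' : measurable (phi i @^-1` (E n `&` Q)) by apply: mpre; exact: measurableI.
have mGi : measurable (symdiff i (G n) `&` cube rho).
  by apply: measurableI; [exact: measurable_symdiff|exact: measurable_cube].
apply: (@le_trans _ _ (mu (symdiff i (G n) `&` cube rho) + (mu (E n `&` Q) +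
    mu (phi i @^-1` (E n `&` Q))))%E).
  have mEU : measurable ((E n `&` Q) `|` phi i @^-1` (E n `&` Q)).
    by apply: measurableU => //; exact: measurableI.
  apply: (@le_trans _ _ (mu (symdiff i (G n) `&` cube rho) +
      mu ((E n `&` Q) `|` phi i @^-1` (E n `&` Q)))%E); last first.
    by rewrite leeD2l//; apply: measureU2 => //; exact: measurableI.
  apply: (@le_trans _ _ (mu ((symdiff i (G n) `&` cube rho) `|`
      ((E n `&` Q) `|` phi i @^-1` (E n `&` Q))))); last by apply: measureU2.
  apply: le_measure; rewrite ?inE.
  - by apply: measurableI; [exact: measurable_symdiff|exact: measurable_cube].
  - exact: measurableU.
  move=> x [+ xr].
  have xQ : Q x by apply: cubeS xr; rewrite lerDl.
  have xAQ : Q (phi i x).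
    rewrite /Q /cube/= -(subrK x (phi i x)) (le_trans (ler_normD _ _))// addrC.
    by apply: lerD => //; exact: Ai.
  have [Gx|nGx] := pselect (G n x); have [GAx|nGAx] := pselect (G n (phi i x)).
  - move=> [[_ nF]|[_ nF]]; exfalso; apply: nF.
      by have [j _ Fj] := Gx; exists j.
    by have [j _ Fj] := GAx; exists j.
  - by move=> _; left; split => //; right.
  - by move=> _; left; split => //; left.
  - by case=> -[xF nF]; right; [right|left].
rewrite phi_preserves//; last exact: measurableI.
apply: (le_trans (leeD Gi (leeD En En))); rewrite -!EFinD lee_fin; lra.
Qed.

Lemma vanishing_symdiff_measurable C : measurable C -> vanishing_symdiff C.
Proof.
have v0 : vanishing_symdiff set0.
  split => // ? ? _ ?; apply: filterS filterT => i _ /=.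
  by rewrite /symdiff preimage_set0 !set0D setU0 set0I measure0 lee_fin ltW.
move: C; apply: smallest_sub.
  split => //; first by move=> C; rewrite setTD; exact: vanishing_symdiffC.
  exact: vanishing_symdiff_bigcup.
move=> C; rewrite -bigcup_seq => -[k _ [B mB <-]]; rewrite setTI.
rewrite RGenInftyO.measurableE in mB; move: B mB.
apply: smallest_sub => //.
  split; first by rewrite /= preimage_set0.
    by move=> B; rewrite /= setTD preimage_setC; exact: vanishing_symdiffC.
  by move=> F HF; rewrite /= preimage_bigcup; exact: vanishing_symdiff_bigcup.
move=> _ [a ->] /=; have := vanishing_symdiff_halfspace k a.
by congr vanishing_symdiff; apply/seteqP; split => x /=; rewrite in_itv.
Qed.

End continuity.

Lemma lin_symdiff (J : Type) (U : set_system J) (FU : Filter U) (A : J -> 'M[R]_N) C :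
  (forall i, `|\det (A i)| = 1) -> (forall d, 0 < d -> U [set i | `|A i - 1%:M| <= d]) ->
  measurable C -> vanishing_symdiff U (fun i x => x *m A i) C.
Proof.
move=> detA cvgA; apply: vanishing_symdiff_measurable.
- by move=> i; exact: measurable_mulmx_rV.
- by move=> i B; exact: measure_unimodular.
- move=> rho d rho0 d0; have N0 : 0 < (N.+1)%:R * rho by rewrite mulr_gt0.
  apply: filterS (cvgA _ (divr_gt0 d0 N0)) => i /= Ai x xr.
  have -> : x *m A i - x = x *m (A i - 1%:M) by rewrite mulmxBr mulmx1.
  apply: le_trans (norm_mulmx_le _ _) _.
  apply: (@le_trans _ _ (N.+1%:R * (rho * (d / (N.+1%:R * rho))))).
    apply: ler_pM; rewrite ?mulr_ge0 ?ler_nat//; exact: ler_pM.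
  by rewrite mulrA mulrC divfK// gt_eqF.
Qed.

Definition small_vectors : set_system T := filter_from [set d : R | 0 < d] (@cube R N).

Lemma small_vectors_filter : Filter small_vectors.
Proof.
apply: filter_from_filter; first by exists 1 => /=.
move=> a b a0 b0; exists (Num.min a b); first by rewrite /= lt_min a0.
by move=> x xab; split; apply: cubeS xab; rewrite ge_min lexx ?orbT.
Qed.

Lemma translation_symdiff C : measurable C -> vanishing_symdiff small_vectors (fun v x => x + v) C.
Proof.
apply: (@vanishing_symdiff_measurable _ _ small_vectors_filter).
- by move=> v; exact: measurable_addr_rV.
- by move=> v B mB; exact: borel_lebesgue_translate.
- move=> rho d rho0 d0; exists d => // v vd x _.
  by rewrite /= addrC addKr.
Qed.

End linear_maps.

(** * Reduction to a fixed lattice *)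

Section moving_lattices.
Variables (R : realType) (N : nat).
Local Notation T := 'rV[R]_N.
Local Notation mu := (@borel_lebesgue_measure R N).
Local Notation lin A := (fun x : T => x *m A).

Lemma relaxed_packing_lin (V A : 'M[R]_N) (f : T -> R) : \det V != 0 -> `|\det A| = 1 ->
  relaxed_packing (V *m A) f -> relaxed_packing V (fun x => f (x *m A)).
Proof.
move=> V0 dA [mf f01 H].
have A0 : \det A != 0 by rewrite -normr_eq0 dA oner_eq0.
have uA : A \in unitmx by rewrite unitmxE unitfE.
have uV : V \in unitmx by rewrite unitmxE unitfE.
split => //; first by apply: (measurableT_comp mf); exact: measurable_mulmx_rV.
move=> W mW pW; pose W' := lin (invmx A) @^-1` W.
have mW' : measurable W' by exact: measurable_lin.
have pW' : periodic_set (V *m A) W'.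
  move=> c x; rewrite /W'/= mulmxDl /lattice_point mulmxA mulmxK//; exact: pW.
have f0 x : 0 <= f x by have /andP[] := f01 x.
have mfE : measurable_fun setT (fun x => (f x)%:E) by exact/measurable_EFinP.
have -> : (\int[mu]_(x in W) (f (x *m A))%:E = \int[mu]_(x in W') (f x)%:E)%E.
  rewrite [RHS]integral_indicE -(integral_unimodular dA).
  - rewrite [LHS]integral_indicE; apply: eq_integral => x _; congr (_%:E * _)%E.
    rewrite !indicE; congr ((_ : bool)%:R); apply/idP/idP; rewrite !inE /W' /= mulmxK//.
  - exact: measurable_indicM.
  - by move=> x; rewrite mule_ge0// lee_fin.
apply: (le_trans (H W' mW' pW')).
have mC := @measurable_cell R N (V *m A).
rewrite -(measure_unimodular dA); last exact: measurableI.
apply: eq_lee; congr (mu _); rewrite preimage_setI; congr (_ `&` _).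
  by apply/seteqP; split => x; rewrite /W' /= mulmxK.
have E (x : T) : x *m A *m invmx (V *m A) = x *m invmx V.
  have uVA : V *m A \in unitmx by rewrite unitmx_mul uV.
  by apply: (can_inj (mulmxK uVA)); rewrite mulmxKV// mulmxA mulmxKV.
by apply/seteqP; split => x; rewrite /cell /= E.
Qed.

Lemma interaction_lin (A : 'M[R]_N) (k : T -> \bar R) (f g : T -> R) : `|\det A| = 1 ->
  kernel_function k -> weight f -> weight g ->
  interaction k f g =
  interaction (fun z => k (z *m A)) (fun x => f (x *m A)) (fun x => g (x *m A)).
Proof.
move=> dA hk wf wg; have [mf f0] := wf; have [mg g0] := wg.
rewrite [LHS]interactionE -(integral_unimodular dA).
- apply: eq_integral => y _; congr (_ * _)%E; rewrite /potential -(integral_unimodular dA).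
  + by apply: eq_integral => x _; rewrite mulmxBl.
  + by apply: measurable_weightM => //; exact: measurable_kernel_shift.
  + by move=> x; rewrite mule_ge0 ?lee_fin//; case: hk.
- by apply: measurable_weightM => //; exact: measurable_potential.
- by move=> y; rewrite mule_ge0 ?lee_fin//; exact: potential_ge0.
Qed.

Import HBNNSimple.

Section limit.
Variables (J : Type) (U : set_system J).
Context {UU : UltraFilter U}.
Variables (V : 'M[R]_N) (Vs : J -> 'M[R]_N) (f : J -> T -> R).
Hypothesis V0 : \det V != 0.
Hypothesis detV : forall i, `|\det (Vs i)| = `|\det V|.
Hypothesis cvgV : forall d, 0 < d -> U [set i | `|Vs i - V| <= d].
Hypothesis fP : forall i, relaxed_packing (Vs i) (f i).

(** [V *m A i = Vs i], so composing with [A i] brings the functions to the fixed lattice of [V]. The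
    determinant is 1 in absolute value, so only the kernel changes in the energies. *)
Let A i := invmx V *m Vs i.

Let uV : V \in unitmx. Proof. by rewrite unitmxE unitfE. Qed.

Let detA i : `|\det (A i)| = 1.
Proof. by rewrite /A det_mulmx det_inv normrM normfV detV mulVf// normr_eq0. Qed.

Let cvgA d : 0 < d -> U [set i | `|A i - 1%:M| <= d].
Proof.
move=> d0; pose c := N%:R * `|invmx V| + 1; have c0 : 0 < c by rewrite ltr_wpDl// mulr_ge0.
apply: filterS (cvgV (divr_gt0 d0 c0)) => i /= Vi.
have -> : A i - 1%:M = invmx V *m (Vs i - V) by rewrite mulmxBr mulVmx.
apply: le_trans (norm_mulmx_le _ _) _; rewrite mulrA.
apply: (@le_trans _ _ (c * (d / c))); last by rewrite mulrC divfK// gt_eqF.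
by apply: ler_pM; rewrite ?mulr_ge0// /c lerDl.
Qed.

Let g i x := f i (x *m A i).

Let gP i : relaxed_packing V (g i).
Proof.
by apply: (relaxed_packing_lin V0 (detA i)); rewrite mulmxA mulmxV// mul1mx; exact: fP.
Qed.

Local Open Scope ereal_scope.

Let wf i : weight (f i).
Proof. by have [mf f01 _] := fP i; split => // x; have /andP[] := f01 x. Qed.

Let wg i : weight (g i).
Proof. by have [mg g01 _] := gP i; split => // x; have /andP[] := g01 x. Qed.

(** The change of variables replaces [C] by its preimage under [A i]. The kernel error is at most
    the indicator of a symmetric difference [S], with energy at most [|\det V|] times the measure of
    [S]. *)
Lemma energy_indic_usc (h : T -> R) : relaxed_packing V h ->
  (forall A, measurable A -> \int[mu]_(x in A) (h x)%:E = total_profile V U g A) ->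
  forall (C : set T) r e, measurable C -> C `<=` cube r -> (0 <= r)%R -> (0 < e)%R ->
  U [set i | interaction (fun x : T => (\1_C x)%:E) (f i) (f i) <=
             interaction (fun x : T => (\1_C x)%:E) h h + e%:E].
Proof.
move=> hP hE C r e mC Cr r0 e0; have e20 : (0 < e / 2)%R by rewrite divr_gt0.
have m0 : (0 < `|\det V|)%R by rewrite normr_gt0.
have r10 : (0 < 2 * r + 1)%R by rewrite ltr_wpDl// mulr_ge0.
have [_ /(_ _ _ r10 (divr_gt0 e20 m0)) US] := lin_symdiff _ detA cvgA mC.
(* This closeness gives [|x (A i - 1)| <= |x| / 2], so a point sent by [A i] into [cube r] lies in
   [cube (2 * r)]. *)
have N20 : (0 < (2 * N.+1%:R)^-1 :> R)%R by rewrite invr_gt0 mulr_gt0.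
apply: filterS3 (energy_usc V0 gP hP hE mC Cr r0 e20) US (cvgA N20) => i /= Ei Si Ai.
have hC := kernel_function_indic mC.
rewrite (interaction_lin (detA i) hC (wf i) (wf i)).
pose S := symdiff (fun i x => x *m A i) i C `&` cube (2 * r + 1).
have mS : measurable S.
  apply: measurableI; last exact: measurable_cube.
  by apply: measurable_symdiff => // j; exact: measurable_mulmx_rV.
have hS := kernel_function_indic mS.
have mCA : measurable (lin (A i) @^-1` C) by exact: measurable_lin.
have hCA := kernel_function_indic mCA.
apply: (@le_trans _ _ (interaction (fun x : T => (\1_C x)%:E + (\1_S x)%:E) (g i) (g i))).
  apply: (le_interactionk hCA _ (wg i) (wg i)).
    by split; [apply: emeasurable_funD; [case: hC|case: hS]|move=> x; rewrite adde_ge0// lee_fin].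
  move=> x; rewrite -EFinD lee_fin !indicE.
  have [/set_mem CA|_] := boolP (x \in _ @^-1` C); last by rewrite addr_ge0.
  have [xC|xC] := boolP (x \in C); first by rewrite lerDl.
  rewrite add0r mem_set//; split; first by left; split => //; move: xC; rewrite notin_setE.
  have xE : x = (x *m A i - x *m (A i - 1%:M))%R by rewrite mulmxBr mulmx1 opprB addrC subrK.
  have x1 : (`|x| <= `|x *m A i| + `|x *m (A i - 1%:M)|)%R by rewrite {1}xE ler_normB.
  have x2 : (`|x *m (A i - 1%:M)| <= `|x| / 2)%R.
    apply: le_trans (norm_mulmx_le _ _) _; rewrite mulrCA ler_wpM2l//.
    apply: (@le_trans _ _ (N.+1%:R * (2 * N.+1%:R)^-1)%R).
      by apply: ler_pM => //; rewrite ler_nat.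
    by rewrite invfM mulrCA mulfV ?mulr1// pnatr_eq0.
  have := Cr _ CA; rewrite /cube/=; move: x1 x2.
  by move: `|x|%R `|x *m A i|%R `|x *m (A i - 1%:M)|%R => a b c *; lra.
rewrite (interactionDk hC hS (wg i) (wg i)).
have gm : \int[mu]_x (g i x)%:E <= `|\det V|%:E by exact: integral_relaxed_packing.
have S2 : interaction (fun x : T => (\1_S x)%:E) (g i) (g i) <= (e / 2)%:E.
  apply: (@le_trans _ _ (interaction (fun x : T => (\1_S x)%:E) (g i) (cst 1%R))).
    have w1 : weight (cst 1%R : T -> R) by exact: weight_cst.
    apply: (le_interactionr hS (wg i) (wg i) w1).
    by apply: aeW => x /=; have [_ /(_ x)/andP[]] := gP i.
  rewrite (interaction_cst1 hS (wg i)) integral_indic// setIT.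
  apply: (@le_trans _ _ (`|\det V|%:E * (e / 2 / `|\det V|)%:E)).
    by apply: lee_pmul => //; apply: integral_ge0 => x _; rewrite lee_fin; case: (wg i).
  by rewrite -EFinM mulrC divfK// gt_eqF.
apply: (le_trans (leeD Ei S2)); rewrite -addeA -EFinD leeD2l// lee_fin; lra.
Qed.

(** The same [h] serves all simple kernels, which are nonnegative combinations of indicators; this
    permits a later passage from simple kernels to [K] with [h] fixed. *)
Theorem energy_limit : exists h : T -> R, relaxed_packing V h /\
  forall (s : {nnsfun T >-> R}) r e, (0 <= r)%R -> (0 < e)%R ->
  U [set i | interaction (fun x : T => (s x * \1_(cube r) x)%:E) (f i) (f i) <=
             interaction (fun x : T => (s x * \1_(cube r) x)%:E) h h + e%:E].
Proof.
have [h [hP hE]] := bubble_sum V0 gP.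
exists h; split => // s r e r0.
have wh : weight h by have [mh h01 _] := hP; split => // x; have /andP[] := h01 x.
pose usc (k : T -> \bar R) := kernel_function k /\ forall e, (0 < e)%R ->
  U [set i | interaction k (f i) (f i) <= interaction k h h + e%:E].
have usc_term y : usc (fun x => y%:E * (\1_((s @^-1` [set y]) `&` cube r) x)%:E).
  have mC : measurable ((s @^-1` [set y]) `&` @cube R N r).
    by apply: measurableI; [exact: measurable_funPTI|exact: measurable_cube].
  have [y0|y0] := leP 0%R y; last first.
    have -> : s @^-1` [set y] = set0.
      by apply/seteqP; split => // x /= sx; have : (0 <= s x)%R by []; rewrite sx leNgt y0.
    rewrite set0I.
    have zero (x : T) : y%:E * (\1_(@set0 T) x)%:E = 0 by rewrite indic0 mule0.
    split; first by split; [rewrite (funext zero)|move=> x; rewrite zero].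
    move=> e' e0; apply: filterS filterT => i _ /=; rewrite (funext zero).
    have Z (u : T -> R) : interaction (fun=> 0) u u = 0 :> \bar R.
      by apply: integral0_eq => z _; rewrite integral0_eq ?mule0// => ? _; rewrite mule0.
    by rewrite !Z add0e lee_fin ltW.
  have hC := kernel_function_indic mC.
  split.
    by split; [apply: measurable_funeM; case: hC|move=> x; rewrite mule_ge0// lee_fin].
  move=> e' e0; have e1 : (0 < e' / (y + 1))%R by rewrite divr_gt0// ltr_wpDl.
  have sub : (s @^-1` [set y]) `&` cube r `<=` @cube R N r by move=> x [].
  apply: filterS (energy_indic_usc hP hE mC sub r0 e1) => i /= H.
  rewrite !interactionZk//; apply: (le_trans (lee_wpmul2l _ H)); first by rewrite lee_fin.
  rewrite ge0_muleDr; [|exact: interaction_ge0|by rewrite lee_fin ltW].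
  rewrite leeD2l// -EFinM lee_fin mulrCA ler_piMr ?(ltW e0)//.
  by rewrite ler_pdivrMr ?ltr_wpDl// mul1r lerDl.
have uscD k k' : usc k -> usc k' -> usc (fun x => k x + k' x).
  move=> [hk Hk] [hk' Hk']; split.
    by split; [apply: emeasurable_funD; [case: hk|case: hk']|move=> x; rewrite adde_ge0//; [case: hk|case: hk']].
  move=> e' e0; have e20 : (0 < e' / 2)%R by rewrite divr_gt0.
  apply: filterS2 (Hk _ e20) (Hk' _ e20) => i /= H1 H2.
  rewrite !interactionDk//; apply: (le_trans (leeD H1 H2)).
  by rewrite addeACA -EFinD leeD2l// lee_fin; lra.
have usc_sum (I0 : Type) (l : seq I0) (k : I0 -> T -> \bar R) : (forall i, usc (k i)) ->
    usc (fun x => \sum_(i <- l) k i x).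
  move=> H; elim: l => [|i l IH].
    rewrite (_ : (fun _ => _) = fun=> 0); last by apply/funext => x; rewrite big_nil.
    split; first by split.
    move=> e' e0; apply: filterS filterT => j _ /=.
    have Z (u : T -> R) : interaction (fun=> 0) u u = 0 :> \bar R.
      by apply: integral0_eq => z _; rewrite integral0_eq ?mule0// => ? _; rewrite mule0.
    by rewrite !Z add0e lee_fin ltW.
  apply: (eq_ind _ usc (uscD _ _ (H i) IH)); apply/funext => x.
  by rewrite big_cons.
suff [_] : usc (fun x : T => (s x * \1_(cube r) x)%:E) by exact.
rewrite (_ : (fun _ => _) = fun x => \sum_(y <- finmap.enum_fset (fset_set (range s)))
  y%:E * (\1_((s @^-1` [set y]) `&` cube r) x)%:E); first exact: usc_sum.
apply/funext => x; rewrite [in LHS](fimfunE s x) fsbig_finite//= mulr_suml -sumEFin.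
by apply: eq_bigr => y _; rewrite indicI/= -!EFinM mulrA.
Qed.

End limit.

End moving_lattices.

(** * Existence of a relaxed minimiser *)

Section minimisers.
Variables (R : realType) (N : nat).
Hypothesis N0 : (0 < N)%N.
Local Notation T := 'rV[R]_N.
Local Notation mu := (@borel_lebesgue_measure R N).
Variables (K : T -> \bar R) (m : R).
Hypothesis hK : kernel_function K.
Hypothesis m0 : 0 < m.

Import HBNNSimple.
Local Open Scope ereal_scope.

Lemma kernel_approximation : exists s : nat -> {nnsfun T >-> R},
  let k n := fun z : T => (s n z * \1_(cube n%:R) z)%:E in
  [/\ forall n, kernel_function (k n), forall x, nondecreasing_seq (k ^~ x),
    forall x, k n x @[n --> \oo] --> K x &
    forall n, exists2 M, (0 <= M)%R & forall x, k n x <= M%:E * (\1_(cube n%:R) x)%:E].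
Proof.
have [mK K0] := hK; exists (nnsfun_approx measurableT mK); set s := nnsfun_approx measurableT mK.
have s0 n x : (0 <= s n x)%R by [].
split.
- move=> n; split; last by move=> x; rewrite lee_fin mulr_ge0.
  apply/measurable_EFinP; apply: measurable_funM => //.
  by apply: measurable_indic; exact: measurable_cube.
- move=> x i j ij; rewrite lee_fin; apply: ler_pM => //.
    by have /lefP := nd_nnsfun_approx measurableT mK ij; apply.
  rewrite !indicE; have [/set_mem xi|//] := boolP (x \in cube i%:R).
  by rewrite mem_set//; apply: cubeS xi; rewrite ler_nat.
- move=> x; have := @cvg_nnsfun_approx _ T R setT measurableT K mK (fun x _ => K0 x) x I.
  apply: cvg_trans; apply: near_eq_cvg.
  exists (Num.bound `|x|) => // n /= xn; rewrite indicE mem_set ?mulr1//.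
  apply: (@cubeS _ _ (Num.bound `|x|)%:R); first by rewrite ler_nat.
  by rewrite /cube/= ltW// archi_boundP.
- move=> n; have [M [_ HM]] := simple_bounded (s n).
  exists (`|M| + 1)%R; first by rewrite addr_ge0.
  move=> x; rewrite -EFinM lee_fin ler_wpM2r//.
  have := HM (`|M| + 1)%R; rewrite (le_lt_trans (ler_norm M))//; last by rewrite ltrDl.
  by move=> /(_ isT x I); apply: le_trans; exact: ler_norm.
Qed.

Lemma integral_relaxed_fin (V : 'M[R]_N) f : \det V != 0%R -> relaxed_packing V f ->
  \int[mu]_x (f x)%:E \is a fin_num.
Proof.
move=> V0 fP; have [mf f01 _] := fP; rewrite ge0_fin_numE.
  by apply: (le_lt_trans (integral_relaxed_packing V0 fP)); rewrite ltry.
by apply: integral_ge0 => x _; rewrite lee_fin; have /andP[] := f01 x.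
Qed.

(** A vector shorter than [r / M'] has [M'] multiples of norm at most [r]; spreading then bounds the
    potential everywhere by [M * S / M'], and the energy by [m] times that. *)
Lemma no_short_vectors (k : T -> \bar R) (M r c1 : R) : kernel_function k ->
  (forall x, k x <= M%:E * (\1_(cube r) x)%:E) -> (0 < r)%R -> (0 <= M)%R -> (0 < c1)%R ->
  exists2 rho, (0 < rho)%R & forall (V : 'M[R]_N) (f : T -> R), `|\det V|%R = m ->
    relaxed_packing V f -> c1%:E <= interaction k f f ->
    forall c, c != 0%R -> (rho <= `|lattice_point V c|)%R.
Proof.
move=> hk kM r0 M0 c10; pose S := fine (mu (cube (r + r))).
have SE : mu (cube (r + r)) = S%:E by rewrite fineK// cube_fin_num.
have S0 : (0 <= S)%R by rewrite fine_ge0.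
have q0 : (0 <= M * m * S / c1)%R by rewrite !mulr_ge0 ?invr_ge0// ltW.
(* Large enough for [m * M * S / M'] to fall below [c1]. *)
pose M' := (Num.bound (M * m * S / c1)).+1.
have M'0 : (0 < M'%:R :> R)%R by rewrite ltr0n.
have big : (M * m * S < c1 * M'%:R)%R.
  rewrite [ltRHS]mulrC -ltr_pdivrMr//; apply: (@lt_trans _ _ (Num.bound (M * m * S / c1))%:R).
    exact: archi_boundP.
  by rewrite ltr_nat.
exists (r / M'%:R)%R; first by rewrite divr_gt0.
move=> V f dV fP c1J c c0; rewrite leNgt; apply/negP => short.
have V0 : \det V != 0%R by rewrite -normr_eq0 dV gt_eqF.
have [mf f01 _] := fP; have f0 x : (0 <= f x)%R by have /andP[] := f01 x.
have wf : weight f by split.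
have short' : (M'%:R * `|lattice_point V c| <= r)%R.
  by rewrite mulrC -ler_pdivlMr// ltW.
have pot y : potential k f y <= (M * (S / M'%:R))%:E.
  apply: (le_trans (potential_cube y hk wf M0 kM)); rewrite EFinM lee_wpmul2l ?lee_fin//.
  have := short_vector_spreads y V0 fP c0 short'; rewrite SE => H.
  by rewrite -(@lee_pmul2l _ M'%:R%:E) ?lte_fin// -EFinM mulrC divfK// gt_eqF.
move: c1J; rewrite leNgt => /negP; apply.
apply: (@le_lt_trans _ _ (\int[mu]_y ((f y)%:E * (M * (S / M'%:R))%:E))).
  apply: ge0_le_integral => //.
  - by move=> y _; rewrite mule_ge0 ?lee_fin//; exact: potential_ge0.
  - by apply: measurable_weightM => //; exact: measurable_potential.
  - by apply: measurable_weightM => //; exact: measurable_cst.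
  - by move=> y _; rewrite lee_wpmul2l ?lee_fin//; exact: pot.
have Q0 : (0 <= M * (S / M'%:R))%R by rewrite !mulr_ge0// invr_ge0 ltW.
rewrite ge0_integralZr//; last 2 first.
- exact: measurable_EFin_weight.
- by move=> y _; rewrite lee_fin.
apply: (@le_lt_trans _ _ (m%:E * (M * (S / M'%:R))%:E)).
  rewrite lee_wpmul2r ?lee_fin// -dV; exact: integral_relaxed_packing.
rewrite -EFinM lte_fin mulrA mulrA ltr_pdivrMr//.
by rewrite mulrAC (mulrC m) mulrAC in big *.
Qed.

Definition admissible (V : 'M[R]_N) (f : T -> R) := `|\det V|%R = m /\ relaxed_domain V f.

Definition perimeter (f : T -> R) := interaction K f (fun x => 1 - f x)%R.

Lemma weight_compl (f : T -> R) : measurable_fun setT f -> (forall x, 0 <= f x <= 1)%R ->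
  weight f /\ weight (fun x => 1 - f x)%R.
Proof.
move=> mf f01; split; first by split => // x; have /andP[] := f01 x.
split; first exact: measurable_funB.
by move=> x; rewrite subr_ge0; have /andP[] := f01 x.
Qed.

Lemma admissible_mass V f : admissible V f -> \int[mu]_x (f x)%:E = m%:E.
Proof.
move=> [dV fD]; rewrite (@integral_relaxed_domain _ _ V)// ?dV//.
by rewrite -normr_eq0 dV gt_eqF.
Qed.

Lemma perimeter_ge0 V f : admissible V f -> 0 <= perimeter f.
Proof.
by move=> [_ [mf f01 _]]; have [wf wf'] := weight_compl mf f01; exact: interaction_ge0.
Qed.

(** For a smaller kernel the complement identity becomes a lower bound on J by the perimeter of the
    full kernel, meaningful even if [K] is not integrable. *)
Lemma admissible_energy V f (k : T -> \bar R) : admissible V f -> kernel_function k ->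
  (forall x, k x <= K x) -> m%:E * \int[mu]_x k x <= interaction k f f + perimeter f.
Proof.
move=> af hk kK; have [_ [mf f01 _]] := af; have [wf wf'] := weight_compl mf f01.
rewrite -(admissible_mass af) -(interaction_complement hk mf f01) leeD2l//.
exact: le_interactionk.
Qed.

(* A short lattice vector spreads the mass of [f], which makes the interaction small. *)
Lemma bounded_basis (k : T -> \bar R) (M r c1 : R) : kernel_function k ->
  (forall x, k x <= M%:E * (\1_(cube r) x)%:E) -> (0 < r)%R -> (0 <= M)%R -> (0 < c1)%R ->
  exists B : R, forall V f, admissible V f -> c1%:E <= interaction k f f ->
    exists2 W, admissible W f & (`|W| <= B)%R.
Proof.
move=> hk kM r0 M0 c10; have [rho rho0 short] := no_short_vectors hk kM r0 M0 c10.
have [c c0 cover] := covering_radius N rho0 m0.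
have [B HB] := reduced_basis N0 c0 m0; exists B => V f [dV fD] c1J.
have V0 : \det V != 0%R by rewrite -normr_eq0 dV gt_eqF.
have cV := cover V dV (short V f dV (relaxed_domain_packing fD) c1J).
have [W [WV dW WB]] := HB V dV cV; exists W => //; split => //.
have W0 : \det W != 0%R by rewrite -normr_eq0 dW gt_eqF.
exact: relaxed_domain_change WV fD.
Qed.

Lemma ultra_cvg_matrix (J : Type) (U : set_system J) (UU : UltraFilter U) (Vs : J -> 'M[R]_N) B :
  (forall i, `|Vs i| <= B)%R ->
  exists V : 'M[R]_N, forall d, (0 < d)%R -> U [set i | (`|Vs i - V| <= d)%R].
Proof.
move=> VB; have /choice[l lP] (p : 'I_N * 'I_N) : exists l : R, (fun i => Vs i p.1 p.2) @ U --> l.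
  have [|l _ ll] := @ultra_cvg_bounded R J U UU (fun i => Vs i p.1 p.2) (- B)%R B; last by exists l.
  move=> i; rewrite -ler_norml; apply: le_trans (VB i); exact: entry_le_norm.
exists (\matrix_(a, b) l (a, b)) => d d0.
have : U [set i | forall p, p \in enum {: 'I_N * 'I_N} -> (`|l p - Vs i p.1 p.2| <= d)%R].
  by apply: near_seq => p _; have /cvgrPdist_le/(_ _ d0) := lP p.
apply: filterS => i /= H; apply: norm_le_entries => [|a b]; first exact: ltW.
rewrite !mxE distrC; have := H (a, b); apply; exact: mem_enum.
Qed.

Lemma cvg_prod_seq (J : Type) (U : set_system J) (FU : Filter U) (I0 : Type) (s : seq I0)
    (u : I0 -> J -> R) (l : I0 -> R) : (forall a, u a @ U --> l a) ->
  (fun i => \prod_(a <- s) u a i)%R @ U --> (\prod_(a <- s) l a)%R.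
Proof.
move=> ul; elim: s => [|a s IH].
  by rewrite big_nil; under eq_fun do rewrite big_nil; exact: cvg_cst.
by rewrite big_cons; under eq_fun do rewrite big_cons; exact: cvgM.
Qed.

Lemma cvg_sum_seq (J : Type) (U : set_system J) (FU : Filter U) (I0 : Type) (s : seq I0)
    (u : I0 -> J -> R) (l : I0 -> R) : (forall a, u a @ U --> l a) ->
  (fun i => \sum_(a <- s) u a i)%R @ U --> (\sum_(a <- s) l a)%R.
Proof.
move=> ul; elim: s => [|a s IH].
  by rewrite big_nil; under eq_fun do rewrite big_nil; exact: cvg_cst.
by rewrite big_cons; under eq_fun do rewrite big_cons; exact: cvgD.
Qed.

Lemma cvg_det (J : Type) (U : set_system J) (FU : Filter U) (Vs : J -> 'M[R]_N) (V : 'M[R]_N) :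
  (forall d, (0 < d)%R -> U [set i | (`|Vs i - V| <= d)%R]) ->
  (fun i => \det (Vs i)) @ U --> \det V.
Proof.
move=> VV; have cE a b : (fun i => Vs i a b) @ U --> V a b.
  apply/cvgrPdist_le => d d0; apply: filterS (VV d d0) => i /= H.
  rewrite distrC; apply: le_trans H; have -> : (Vs i a b - V a b = (Vs i - V) a b)%R by rewrite !mxE.
  exact: entry_le_norm.
apply: cvg_sum_seq => s; apply: cvgM; first exact: cvg_cst.
exact: cvg_prod_seq.
Qed.

(** The strict inequality is what compactness requires: it leaves a gap between the infimum and the
    perimeter of completely dispersed mass. *)
Theorem relaxed_minimiser V0 f0 : admissible V0 f0 -> perimeter f0 < m%:E * \int[mu]_x K x ->
  exists V f, admissible V f /\ forall W g, admissible W g -> perimeter f <= perimeter g.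
Proof.
move=> af0 pf0; have [mK K0] := hK.
pose P := [set perimeter p.2 | p in [set p : 'M[R]_N * (T -> R) | admissible p.1 p.2]].
pose Inf := ereal_inf P.
have Inf_le W g : admissible W g -> Inf <= perimeter g.
  by move=> ag; apply: ereal_inf_lbound; exists (W, g).
have Inf0 : 0 <= Inf.
  by apply: le_ereal_inf_tmp => _ [[W g] /= ag <-]; exact: perimeter_ge0 ag.
have Inffin : Inf \is a fin_num.
  rewrite ge0_fin_numE//; apply: (le_lt_trans (Inf_le _ _ af0)); apply: (lt_le_trans pf0).
  exact: leey.
have [s] := kernel_approximation; set k := fun n (z : T) => (s n z * \1_(cube n%:R) z)%:E.
move=> [hk kmono kK kM].
have kleK n x : k n x <= K x.
  rewrite -(cvg_lim (@ereal_hausdorff R) (kK x)).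
  apply: lime_ge; first exact: cvgP (kK x).
  by exists n => // j /= nj; exact: kmono.
have intk := cvg_kernel_integral hk kmono kK.
have k_int_fin n : \int[mu]_x k n x \is a fin_num.
  have [M M0 HM] := kM n; have [mk k0] := hk n.
  have mcn : measurable (@cube R N n%:R) by exact: measurable_cube.
  rewrite ge0_fin_numE; last by apply: integral_ge0.
  apply: (@le_lt_trans _ _ (\int[mu]_x (M%:E * (\1_(cube n%:R) x)%:E))).
    by apply: ge0_le_integral => //; apply: measurable_funeM; apply/measurable_EFinP; exact: measurable_indic.
  rewrite ge0_integralZl//; last first.
    by apply/measurable_EFinP; exact: measurable_indic.
  by rewrite integral_indic// setIT lte_mul_pinfty// ?cube_lty.
(* One truncated kernel already sees the gap; [c1] below is half of it, so a perimeter within [c1]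
   of the infimum forces an energy of at least [c1] and thereby a bounded basis. *)
have [n Hn] : exists n, Inf < m%:E * \int[mu]_x k n x.
  apply: contrapT => /forallNP H.
  have mc : m%:E * \int[mu]_x k n x @[n --> \oo] --> m%:E * \int[mu]_x K x by exact: cvgeZl.
  have : m%:E * \int[mu]_x K x <= Inf.
    rewrite -(cvg_lim (@ereal_hausdorff R) mc); apply: lime_le; first exact: cvgP mc.
    by apply: nearW => n; rewrite leNgt; exact/negP.
  by rewrite leNgt (le_lt_trans (Inf_le _ _ af0) pf0).
have [M M0 HM] := kM n.
have mkfin : m%:E * \int[mu]_x k n x \is a fin_num by exact: fin_numM.
pose c1 := ((fine (m%:E * \int[mu]_x k n x) - fine Inf) / 2)%R.
have c10 : (0 < c1)%R.
  by rewrite divr_gt0// subr_gt0 -lte_fin !fineK.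
have HM' x : k n x <= M%:E * (\1_(cube (n%:R + 1)) x)%:E.
  apply: (le_trans (HM x)); rewrite lee_wpmul2l ?lee_fin// !indicE.
  have [/set_mem xn|//] := boolP (x \in cube n%:R).
  by rewrite mem_set//; apply: cubeS xn; rewrite lerDl.
have n10 : (0 < n%:R + 1 :> R)%R by rewrite ltr_wpDl.
have [B HB] := bounded_basis (hk n) HM' n10 M0 c10.
have /choice[p pP] (j : nat) : exists p : 'M[R]_N * (T -> R),
    [/\ admissible p.1 p.2, (`|p.1| <= B)%R & perimeter p.2 <= Inf + (c1 / j.+1%:R)%:E].
  have e0 : (0 < c1 / j.+1%:R)%R by rewrite divr_gt0.
  have [_ [[W g] /= ag <-] Hg] := lb_ereal_inf_adherent e0 Inffin.
  have c1J : c1%:E <= interaction (k n) g g.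
    have := admissible_energy ag (hk n) (kleK n).
    have : perimeter g <= Inf + c1%:E.
      apply: (le_trans (ltW Hg)); rewrite leeD2l// lee_fin ler_pdivrMr// ler_peMr// ?(ltW c10)//.
      by rewrite ler1n.
    move=> h1 h2; have := le_trans h2 (leeD (lexx _) h1).
    have -> : Inf + c1%:E = (fine Inf + c1)%:E by rewrite EFinD fineK.
    rewrite -(fineK mkfin) -leeBlDr// -EFinB.
    apply: le_trans; rewrite lee_fin /c1; lra.
  have [W' aW' WB] := HB W g ag c1J.
  by exists (W', g); split => //; exact: ltW.
(* The ultrafilter refines convergence to infinity, so the perimeters tend to [Inf] along it. *)
have [U [UU sU]] := ultraFilterLemma (@eventually_filter).
have VB j : (`|(p j).1| <= B)%R by case: (pP j).
have [V cV] := ultra_cvg_matrix UU VB.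
have dVj j : `|\det (p j).1|%R = m by have [[]] := pP j.
have dV : `|\det V|%R = m.
  have nd : (fun j => `|\det (p j).1|%R) @ U --> `|\det V|%R.
    by apply: (@cvg_norm R R); exact: cvg_det.
  have md : (fun j => `|\det (p j).1|%R) @ U --> m.
    rewrite (_ : (fun _ => _) = fun=> m); last by apply/funext => j; exact: dVj.
    exact: cvg_cst.
  exact: (cvg_unique (@norm_hausdorff _ R) nd md).
have V0' : \det V != 0%R by rewrite -normr_eq0 dV gt_eqF.
have dVj' j : `|\det (p j).1|%R = `|\det V|%R by rewrite dVj dV.
have pD j : relaxed_packing (p j).1 (p j).2.
  by apply: relaxed_domain_packing; have [[]] := pP j.
have [h [hP hE]] := energy_limit V0' dVj' cV pD.
have [mh h01 _] := hP; have [wh wh'] := weight_compl mh h01.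
(* Energy and perimeter of one well-chosen member of the sequence are compared with the limit [h],
   separately for each truncated kernel. *)
have key i : m%:E * \int[mu]_x k i x <= interaction (k i) h h + Inf.
  apply/lee_addgt0Pr => e e0; have e20 : (0 < e / 2)%R by rewrite divr_gt0.
  have U1 := hE (s i) _ _ (ler0n _ i) e20.
  have U2 : U [set j | perimeter (p j).2 <= Inf + (e / 2)%:E].
    apply: sU; exists (Num.bound (c1 / (e / 2))) => // j /= Hj.
    have [_ _] := pP j; move/le_trans; apply; rewrite leeD2l// lee_fin.
    rewrite ler_pdivrMr// mulrC -ler_pdivrMr// ltW//.
    apply: (@lt_le_trans _ _ (Num.bound (c1 / (e / 2)))%:R).
      by rewrite archi_boundP// divr_ge0// ltW.
    by rewrite ler_nat; exact: leq_trans Hj (leqnSn j).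
  have [j [/= H1 H2]] := filter_ex (filterI U1 U2).
  have [aj _ _] := pP j.
  apply: (le_trans (admissible_energy aj (hk i) (kleK i))).
  apply: (le_trans (leeD H1 H2)); rewrite addeACA -EFinD leeD2l// lee_fin; lra.
have [r [mr r0 fillD rE]] := relaxed_packing_fill V0' hP.
have wr : weight r by split.
have rfin : \int[mu]_x (r x)%:E \is a fin_num.
  rewrite ge0_fin_numE; last by apply: integral_ge0 => x _; rewrite lee_fin.
  apply: (@le_lt_trans _ _ (`|\det V|%:E)); last by rewrite ltry.
  by rewrite -rE leeDl//; apply: integral_ge0 => x _; rewrite lee_fin; case: wh.
have hfin := integral_relaxed_fin V0' hP.
(* With [m] split into the masses of [r] and [h], the energy of [h] cancels; escaped mass is charged
   as if it interacted with nothing. *)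
have bound i : \int[mu]_x (r x)%:E * \int[mu]_x k i x + interaction (k i) h (fun x => 1 - h x)%R <= Inf.
  have := key i; rewrite -dV -rE ge0_muleDl; last 2 first.
  - by apply: integral_ge0 => x _; rewrite lee_fin.
  - by apply: integral_ge0 => x _; rewrite lee_fin; case: wh.
  rewrite -(interaction_complement (hk i) mh h01) addeCA leeD2lE//.
  rewrite ge0_fin_numE; last exact: interaction_ge0.
  apply: (@le_lt_trans _ _ (\int[mu]_x (h x)%:E * \int[mu]_x k i x)).
    by rewrite -(interaction_complement (hk i) mh h01) leeDl//; exact: interaction_ge0.
  by rewrite -ge0_fin_numE ?fin_numM// mule_ge0//; apply: integral_ge0 => x _; [rewrite lee_fin; case: wh|case: (hk i)].
have final : \int[mu]_x (r x)%:E * \int[mu]_x K x + perimeter h <= Inf.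
  have c1' : \int[mu]_x (r x)%:E * \int[mu]_x k i x @[i --> \oo] --> \int[mu]_x (r x)%:E * \int[mu]_x K x.
    exact: cvgeZl.
  have c2' := cvg_interaction hk kmono kK wh wh'.
  have c3' : (\int[mu]_x (r x)%:E * \int[mu]_x k i x + interaction (k i) h (fun x => 1 - h x)%R) @[i --> \oo] -->
      \int[mu]_x (r x)%:E * \int[mu]_x K x + perimeter h.
    apply: cvgeD => //; apply: ge0_adde_def; rewrite inE; last exact: interaction_ge0.
    by rewrite mule_ge0//; apply: integral_ge0 => x _; rewrite ?lee_fin.
  rewrite -(cvg_lim (@ereal_hausdorff R) c3'); apply: lime_le; first exact: cvgP c3'.
  by apply: nearW => i; exact: bound.
exists V, (fun x => h x + r x)%R; split; first by split.
move=> W g ag; apply: le_trans (Inf_le W g ag); apply: le_trans final.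
have [mhr hr01 _] := fillD; have [whr whr'] := weight_compl mhr hr01.
have w1 : weight (cst 1%R : T -> R) by exact: weight_cst.
(* The filling [r] contributes at most its mass times the integral of [K], exactly what the escaped
   mass was charged, and it only lowers the contribution of [h]. *)
rewrite /perimeter (interactionDl hK wh wr whr') [leLHS]addeC; apply: leeD.
  rewrite -(interaction_cst1 hK wr); apply: (le_interactionr hK wr whr' w1).
  by apply: aeW => x /=; rewrite gerBl; case: whr.
apply: (le_interactionr hK wh whr' wh'); apply: aeW => x.
by rewrite lerD2l lerN2 lerDl.
Qed.

End minimisers.

(** * Minimisers are sets *)

Section strict_interaction.
Variables (R : realType) (N : nat).
Local Notation T := 'rV[R]_N.
Local Notation mu := (@borel_lebesgue_measure R N).
Local Notation shift v := (fun x : T => x + v)%R.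
Local Open Scope ereal_scope.

Lemma interaction_eq0_null (k : T -> \bar R) (Z A : set T) : kernel_function k ->
  measurable Z -> mu Z = 0 -> measurable A ->
  (forall x y, A x -> A y -> ~ Z (x - y)%R -> 0 < k (x - y)%R) ->
  interaction k (\1_A) (\1_A) = 0 -> mu A = 0.
Proof.
move=> hk mZ Z0 mA kpos; have wA := weight_indic mA; have [_ k0] := hk.
have mpot := measurable_potential hk wA.
have pot0 y : 0 <= potential k (\1_A) y by exact: potential_ge0.
rewrite interactionE -integral_indicE => I0; apply: contrapT => /eqP A0.
have mAZ y : measurable (A `\` shift (- y)%R @^-1` Z).
  by apply: measurableD => //; exact: measurable_shift.
have AZ0 y : mu (A `\` shift (- y)%R @^-1` Z) != 0.
  apply: contra A0 => /eqP E; have mZy : measurable (shift (- y)%R @^-1` Z) by exact: measurable_shift.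
  rewrite eq_le measure_ge0 andbT -E; apply: (@le_trans _ _ (mu ((A `\` shift (- y)%R @^-1` Z) `|` shift (- y)%R @^-1` Z))).
    apply: le_measure; rewrite ?inE//; first exact: measurableU.
    by move=> x Ax; have [h|h] := pselect ((shift (- y)%R @^-1` Z) x); [right|left].
  apply: eq_lee; apply: measureU0 => //.
  by rewrite -[LHS]/(mu _) borel_lebesgue_translate.
move/eqP: A0; apply; apply: (integral_gt0_null mA _ _ I0).
  exact: measurable_funTS.
move=> y Ay; rewrite lt_neqAle pot0 andbT eq_sym; apply/negP => /eqP P0.
have /negP := AZ0 y; apply; apply/eqP.
apply: (@integral_gt0_null _ _ _ mu _ (fun x => k (x - y)%R)) => //.
- by apply: measurable_funTS; exact: measurable_kernel_shift.
- by move=> x [Ax nZ]; exact: kpos.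
apply/eqP; rewrite eq_le; apply/andP; split; last by apply: integral_ge0.
rewrite -P0 /potential -integral_indicE; apply: ge0_subset_integral => //.
by apply: measurable_funTS; exact: measurable_kernel_shift.
Qed.

(** A fine cubic lattice has countably many cells, so one of them meets [A] in positive measure. *)
Lemma small_part (A : set T) (r : R) : measurable A -> (0 < mu A) -> (0 < r)%R ->
  exists B : set T, [/\ measurable B, B `<=` A, 0 < mu B & forall x y, B x -> B y -> (`|x - y| <= r)%R].
Proof.
move=> mA A0 r0; pose q := (r / (2 * N.+1%:R))%R; have q0 : (0 < q)%R by rewrite divr_gt0// mulr_gt0.
pose V : 'M[R]_N := (q%:M)%R.
have V0 : \det V != 0%R by rewrite det_scalar expf_neq0// gt_eqF.
pose F (c : 'rV[int]_N) := A `&` shift (- lattice_point V c)%R @^-1` cell V.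
have mF c : measurable (F c).
  by apply: measurableI => //; apply: measurable_shift; exact: measurable_cell.
have [c Fc] : exists c, 0 < mu (F c).
  apply: contrapT => /forallNP H; move: A0; rewrite ltNge => /negP; apply.
  have F0 c : mu (F c) = 0.
    by apply/eqP; rewrite eq_le measure_ge0 andbT leNgt; exact/negP.
  have := @null_bigcup R N _ F mF F0; rewrite (_ : \bigcup_i F i = A); first by move=> ->.
  apply/seteqP; split => [x [c _ []]//|x Ax].
  by exists (cell_index V x) => //; split => //; apply/(cellP V0).
exists (F c); split => //; first by move=> x [].
move=> x y [_ /= cx] [_ /= cy].
have h u : cell V u -> (`|u| <= r / 2)%R.
  move=> /(cell_cube V0); rewrite /cube/= => /le_trans; apply.
  have vq : (`|V| <= q)%R.
    apply: norm_le_entries => [|i j]; first exact: ltW.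
    by rewrite mxE; case: eqP => _; rewrite ?mulr1n ?mulr0n ?normr0 ?(ltW q0)// gtr0_norm.
  apply: (@le_trans _ _ (N.+1%:R * q)%R); first by apply: ler_pM => //; rewrite ler_nat.
  rewrite /q invfM mulrCA mulrA mulrA mulrAC -mulrA mulrA.
  by rewrite -[leRHS]mulr1 le_eqVlt; apply/orP; left; apply/eqP; field; rewrite nat1r pnatr_eq0.
have -> : (x - y = (x - lattice_point V c) - (y - lattice_point V c))%R by rewrite opprB addrA subrK.
apply: (le_trans (ler_normB _ _)); have := h _ cx; have := h _ cy.
by move: (`|_|)%R (`|_|)%R => a b *; lra.
Qed.

Lemma interaction_autocorrelation (k : T -> \bar R) (A : set T) : kernel_function k -> measurable A ->
  interaction k (\1_A) (\1_A) = \int[mu]_z (k z * mu (A `&` shift z @^-1` A)).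
Proof.
move=> hk mA; have [mk k0] := hk; have wA := weight_indic mA.
pose G (p : T * T) := (\1_A p.1)%:E * ((\1_A (p.2 + p.1)%R)%:E * k p.2).
have mG : measurable_fun setT G.
  have mi : measurable_fun setT (fun x : T => (\1_A x)%:E : \bar R).
    exact: measurable_EFin_weight.
  apply: emeasurable_funM; first by apply: (measurableT_comp mi); exact: measurable_fst.
  apply: emeasurable_funM; last by apply: (measurableT_comp mk); exact: measurable_snd.
  apply: (measurableT_comp mi); rewrite (_ : (fun p : T * T => (p.2 + p.1)%R) =
    (fun p : T * T => (p.2 - (- p.1))%R)); last by apply/funext => p; rewrite opprK.
  apply: measurable_funB_rV; first exact: measurable_snd.
  rewrite (_ : (fun p : T * T => (- p.1)%R) = (fun p : T * T => (0 - p.1)%R)).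
    by apply: measurable_funB_rV; [exact: measurable_cst|exact: measurable_fst].
  by apply/funext => p; rewrite sub0r.
have G0 p : 0 <= G p by rewrite !mule_ge0// lee_fin.
transitivity (\int[mu]_y \int[mu]_z G (y, z)).
  apply: eq_integral => y _; rewrite -(integral_translate y).
  - rewrite -ge0_integralZl//.
    + by apply: eq_integral => z _; rewrite /G/= addrK.
    + apply: (measurableT_comp (measurable_weightM wA (measurable_kernel_shift y hk))).
      exact: measurable_addr_rV.
    + by move=> z _; rewrite mule_ge0// lee_fin.
  - exact: measurable_weightM wA (measurable_kernel_shift y hk).
  - by move=> z; rewrite mule_ge0// lee_fin.
rewrite (fubini_tonelli G mG G0); apply: eq_integral => z _.
have mAz : measurable (A `&` shift z @^-1` A).
  by apply: measurableI => //; exact: measurable_shift.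
rewrite -[X in _ = _ * X]mul1e -(integral_cst mu mAz 1%:E) integral_indicE -ge0_integralZl//.
- apply: eq_integral => y _; rewrite /G/= mule1 muleA -EFinM [RHS]muleC indicI.
  by congr (_%:E * _); congr (_ * _)%R; rewrite !indicE; congr ((_ : bool)%:R); apply/idP/idP; rewrite !inE /= addrC.
- by apply: measurable_indicM => //; exact: measurable_cst.
- by move=> y _; rewrite mule_ge0// lee_fin.
Qed.

(* The interaction is the integral of [k z] times [mu (A `&` (A - z))], which stays bounded
   below for small [z]. *)
Lemma interaction_singular (k : T -> \bar R) : kernel_function k ->
  (forall d, (0 < d)%R -> \int[mu]_(z in cube d) k z = +oo) ->
  forall A, measurable A -> 0 < mu A -> interaction k (\1_A) (\1_A) = +oo.
Proof.
move=> hk kdiv A mA A0; have [mk k0] := hk.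
have [B [mB BA B0 Bd]] := small_part mA A0 ltr01.
have [y0 By0] : B !=set0 by apply/set0P/negP => /eqP E; move: B0; rewrite E measure0 ltxx.
pose rho := (`|y0| + 1)%R; have rho0 : (0 < rho)%R by rewrite ltr_wpDl.
have Brho : B `<=` cube rho.
  move=> x Bx; rewrite /cube/= -(subrK y0 x) addrC (le_trans (ler_normD _ _))//.
  by rewrite lerD2l; exact: Bd.
have Bfin : mu B \is a fin_num by exact: bounded_measure_fin Brho.
pose b := fine (mu B); have bE : mu B = b%:E by rewrite fineK.
have b0 : (0 < b)%R by rewrite -lte_fin -bE.
have b20 : (0 < b / 2)%R by rewrite divr_gt0.
have [_ /(_ rho _ rho0 b20)[d /= d0 Hd]] := translation_symdiff mB.
(* Translations are continuous in measure, so for small [z] the set [B] loses at most half of its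
   measure when intersected with its translate. *)
have corr z : cube d z -> (b / 2)%:E <= mu (B `&` shift z @^-1` B).
  move=> /Hd /= Sz; have mBz : measurable (shift z @^-1` B) by exact: measurable_shift.
  have mI : measurable (B `&` shift z @^-1` B) by exact: measurableI.
  have : mu B <= mu (B `&` shift z @^-1` B) + (b / 2)%:E.
    apply: (@le_trans _ _ (mu (B `&` shift z @^-1` B) + mu (B `\` shift z @^-1` B))).
      rewrite -[X in mu X <= _](setUIDK B (shift z @^-1` B)).
      by apply: measureU2 => //; exact: measurableD.
    rewrite leeD2l//; apply: le_trans Sz; apply: le_measure; rewrite ?inE.
    - exact: measurableD.
    - apply: measurableI; last exact: measurable_cube.
      by apply: measurable_symdiff => // v; exact: measurable_addr_rV.
    - by move=> x [Bx nBx]; split; [right|exact: Brho].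
  by rewrite bE -leeBlDr// -EFinB; apply: le_trans; rewrite lee_fin; lra.
apply/eqP; rewrite -leye_eq; apply: (@le_trans _ _ (interaction k (\1_B) (\1_B))); last first.
  have wA := weight_indic mA; have wB := weight_indic mB.
  have AB : {ae mu, forall x, (\1_B x <= \1_A x :> R)%R}.
    apply: aeW => x; rewrite !indicE; have [/set_mem Bx|//] := boolP (x \in B).
    by rewrite mem_set//; exact: BA.
  by apply: (@le_trans _ _ (interaction k (\1_A) (\1_B))); [exact: le_interactionl|exact: le_interactionr].
rewrite interaction_autocorrelation//.
have mcd : measurable (@cube R N d) by exact: measurable_cube.
apply: (@le_trans _ _ (\int[mu]_(z in cube d) (k z * (b / 2)%:E))).
  rewrite ge0_integralZr//.
  - by rewrite kdiv// mulyr gtr0_sg// mul1e.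
  - exact: measurable_funTS.
  - by rewrite lee_fin ltW.
rewrite [leLHS]integral_indicE; apply: ge0_le_integral => //.
- by move=> z _; rewrite !mule_ge0// lee_fin// ltW.
- apply: measurable_indicM => //; apply: emeasurable_funM => //; exact: measurable_cst.
- apply: emeasurable_funM => //.
  rewrite (_ : (fun z => _) = potential (fun x => (\1_B x)%:E) (\1_B) \o (fun z : T => (0 - z)%R)).
    apply: measurableT_comp.
      by apply: measurable_potential; [exact: kernel_function_indic|exact: weight_indic].
    by apply: measurable_funB_rV; [exact: measurable_cst|exact: measurable_id].
  apply/funext => z /=; rewrite /potential.
  have mBz : measurable (B `&` shift z @^-1` B).
    by apply: measurableI => //; exact: measurable_shift.
  rewrite -[LHS]mul1e -(integral_cst mu mBz 1%:E) integral_indicE.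
  apply: eq_integral => x _; rewrite mule1 -EFinM indicI; congr (_ * _)%:E.
  by rewrite sub0r opprK !indicE; congr ((_ : bool)%:R); apply/idP/idP; rewrite !inE.
- move=> z _; rewrite indicE; have [/set_mem zd|_] := boolP (z \in cube d).
    by rewrite mul1e lee_wpmul2l//; exact: corr.
  by rewrite mul0e mule_ge0.
Qed.

End strict_interaction.

(** * Overlaps and exchanges of mass *)

Section overlaps.
Variables (R : realType) (N : nat) (V : 'M[R]_N).
Hypothesis V0 : \det V != 0.
Local Notation T := 'rV[R]_N.
Local Notation mu := (@borel_lebesgue_measure R N).
Local Notation lp := (lattice_point V).
Local Open Scope ereal_scope.

(** The packing inequality for the two translates [0] and [c]; cutting with cubes provides the
    finite measure needed to conclude. *)
Lemma overlap_le1 (f : T -> R) c : relaxed_packing V f -> c != 0%R ->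
  mu [set x | 1 < f x + f (x + lp c)]%R = 0.
Proof.
move=> fP c0; have [mf f01 _] := fP; have f0 x : (0 <= f x)%R by have /andP[] := f01 x.
have wf : weight f by split.
have ws := weight_shift (lp c) wf.
set S := [set x | _].
have mg : measurable_fun setT (fun x => f x + f (x + lp c))%R by case: (weightD wf ws).
have mS : measurable S.
  have := measurable_fun_ltr (measurable_cst (1 : R)%R) mg measurableT (Y := [set true]) I.
  by rewrite setTI.
have mSj j : measurable (S `&` @cube R N j%:R).
  by apply: measurableI => //; exact: measurable_cube.
have -> : S = \bigcup_j (S `&` @cube R N j%:R) by rewrite -setI_bigcupr bigcup_cube setIT.
apply: null_bigcup => // j.
apply: (integral_le_measure_null (mSj j) _ (g := fun x => (f x + f (x + lp c))%:E)).
- apply: (le_lt_trans _ (cube_lty N j%:R)); apply: le_measure; rewrite ?inE//.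
  exact: measurable_cube.
- by apply: measurable_funTS; exact/measurable_EFinP.
- by move=> x [Sx _]; rewrite lte_fin.
have := relaxed_packing_sum (s := [:: 0%R; c]) V0 fP _ (mSj j).
rewrite !big_cons big_nil adde0 => H; apply: le_trans (H _).
  rewrite -ge0_integralD//.
  - apply: eq_lee; apply: eq_integral => x _.
    by rewrite lattice_point0 addr0 EFinD.
  - by move=> x _; rewrite lee_fin.
  - apply: measurable_funTS; apply: measurable_EFin_weight.
    exact: (weight_shift (lp 0%R) wf).
  - by move=> x _; rewrite lee_fin.
  - by apply: measurable_funTS; exact: measurable_EFin_weight.
by rewrite /= inE eq_sym c0.
Qed.

(** Positivity on both translates gives a uniform lower bound [e] on a subset of positive measure.
    The upper bound [1 - e] then follows, as the two values add up to at most 1 almost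
    everywhere. *)
Lemma overlap_witness (f : T -> R) : relaxed_packing V f -> ~ packs V [set x | 0 < f x]%R ->
  exists c e A, [/\ c != 0%R, (0 < e)%R, measurable A, 0 < mu A &
    forall x, A x -> (e <= f x <= 1 - e)%R /\ (e <= f (x + lp c) <= 1 - e)%R].
Proof.
move=> fP /existsNP[c /not_implyP[c0 /eqP Dc]].
have [mf f01 _] := fP; have f0 x : (0 <= f x)%R by have /andP[] := f01 x.
have mfs : measurable_fun setT (fun x : T => f (x + lp c))%R.
  by apply: (measurableT_comp mf); exact: measurable_addr_rV.
have mgt (h : T -> R) (e : R) : measurable_fun setT h -> measurable [set x | e < h x]%R.
  move=> mh; have := measurable_fun_ltr (measurable_cst e) mh measurableT (Y := [set true]) I.
  by rewrite setTI.
pose F n : set T := [set x | n.+1%:R^-1 < f x]%R `&` [set x | n.+1%:R^-1 < f (x + lp c)]%R.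
have mF n : measurable (F n) by apply: measurableI; exact: mgt.
have [n Fn] : exists n, mu (F n) != 0.
  apply: contrapT => /forallNP H; move/eqP: Dc; apply.
  have F0 n : mu (F n) = 0 by apply/eqP; have /negP := H n; rewrite negbK.
  rewrite -[RHS](null_bigcup mF F0); congr (mu _); apply/esym.
  apply/seteqP; split => [x [n _ [h1 h2]]|x [/= h1 h2]].
    by split => /=; [apply: lt_trans h1|apply: lt_trans h2]; rewrite invr_gt0.
  have hm : (0 < Num.min (f x) (f (x + lp c)))%R by rewrite lt_min h1.
  have := archi_boundP (ltW (divr_gt0 ltr01 hm)); set M := Num.bound _ => HM.
  have : (M.+1%:R^-1 < Num.min (f x) (f (x + lp c)))%R.
    rewrite invf_plt ?posrE//; rewrite div1r in HM; apply: (lt_trans HM).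
    by rewrite ltr_nat.
  by rewrite lt_min => /andP[]; exists M.
pose S : set T := [set x | 1 < f x + f (x + lp c)]%R.
have S0 : mu S = 0 by exact: overlap_le1.
have mS : measurable S by apply: mgt; exact: measurable_funD.
exists c, (n.+1%:R^-1)%R, (F n `\` S); split => //.
- exact: measurableD.
- rewrite lt_neqAle measure_ge0 andbT eq_sym; apply: contra Fn => /eqP E.
  rewrite eq_le measure_ge0 andbT -E; apply: (@le_trans _ _ (mu ((F n `\` S) `|` S))).
    apply: le_measure; rewrite ?inE//; first by apply: measurableU => //; exact: measurableD.
    by move=> x Fx; have [h|h] := pselect (S x); [right|left].
  by apply: eq_lee; apply: measureU0 => //; exact: measurableD.
move=> x [[/= /ltW h1 /ltW h2] /negP]; rewrite -leNgt => h3.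
by split; rewrite ?h1 ?h2 /= lerBrDr; apply: le_trans h3; [rewrite lerD2l|rewrite addrC lerD2r].
Qed.

(** An invariant set receives equal mass from [e * \1_A] and from its lattice translate, and this
    mass is finite, so it cancels. *)
Lemma exchange_domain (f : T -> R) (A : set T) (e : R) c : relaxed_domain V f ->
  measurable A -> mu A < +oo -> (0 <= e)%R ->
  (forall x, 0 <= f x + e * \1_A x - e * \1_A (x - lp c) <= 1)%R ->
  relaxed_domain V (fun x => f x + e * \1_A x - e * \1_A (x - lp c))%R.
Proof.
move=> [mf f01 fD] mA Aoo e0 h01; have wA := weight_indic mA.
have wf : weight f by split => // x; have /andP[] := f01 x.
pose a x := (e * \1_A x)%R; have wa : weight a by apply: weightM => //; exact: weight_cst.
have wb : weight (fun x => a (x - lp c))%R by exact: weight_shift.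
set h := fun x => _.
have mh : measurable_fun setT h.
  by apply: measurable_funB; [apply: measurable_funD; case: wa|case: wb].
have wh : weight h by split => // x; have /andP[] := h01 x.
split => // W mW pW; rewrite -fD//.
have afin : \int[mu]_(x in W) (a x)%:E \is a fin_num.
  rewrite ge0_fin_numE; last by apply: integral_ge0 => x _; rewrite lee_fin; case: wa.
  apply: (@le_lt_trans _ _ (\int[mu]_x (a x)%:E)).
    apply: ge0_subset_integral => //; first exact: measurable_EFin_weight.
    by move=> x _; rewrite lee_fin; case: wa.
  under eq_integral => x _ do rewrite EFinM.
  rewrite ge0_integralZl//; last exact: measurable_EFin_weight.
  by rewrite integral_indic// setIT lte_mul_pinfty.
have ab : \int[mu]_(x in W) (a (x - lp c)%R)%:E = \int[mu]_(x in W) (a x)%:E.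
  rewrite integral_indicE -(integral_translate (lp c)).
  - rewrite [RHS]integral_indicE; apply: eq_integral => x _.
    by rewrite addrK indic_periodic.
  - by apply: measurable_indicM => //; exact: measurable_EFin_weight.
  - by move=> x; rewrite mule_ge0// lee_fin; case: wa.
have sum (u v : T -> R) : weight u -> weight v ->
    \int[mu]_(x in W) (u x + v x)%:E = \int[mu]_(x in W) (u x)%:E + \int[mu]_(x in W) (v x)%:E.
  move=> wu wv; rewrite -ge0_integralD//.
  - by move=> x _; rewrite lee_fin; case: wu.
  - by apply: measurable_funTS; exact: measurable_EFin_weight.
  - by move=> x _; rewrite lee_fin; case: wv.
  - by apply: measurable_funTS; exact: measurable_EFin_weight.
have : \int[mu]_(x in W) (h x)%:E + \int[mu]_(x in W) (a x)%:E =
    \int[mu]_(x in W) (f x)%:E + \int[mu]_(x in W) (a x)%:E.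
  by rewrite -{1}ab -!sum//; apply: eq_integral => x _; rewrite /h /a subrK.
move/(congr1 (fun z => z - \int[mu]_(x in W) (a x)%:E)); rewrite !addeK//.
Qed.

End overlaps.

(** With J bilinear, J(f0 + 2a) and J(f0 + 2b) are both at most J(f0 + a + b). In the sum of the two
    inequalities all terms of degree at most one in [a], [b] cancel; finiteness makes this ordinary
    linear arithmetic. *)
Lemma cancel_cross_terms (R : realType) (x00 x0a x0b xa0 xb0 xaa xab xba xbb : \bar R) :
  x00 \is a fin_num -> x0a \is a fin_num -> x0b \is a fin_num -> xa0 \is a fin_num ->
  xb0 \is a fin_num -> xaa \is a fin_num -> xab \is a fin_num -> xba \is a fin_num ->
  xbb \is a fin_num ->
  (x00 + (x0a + x0a) + ((xa0 + (xaa + xaa)) + (xa0 + (xaa + xaa))) <=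
   x00 + (x0a + x0b) + ((xa0 + (xaa + xab)) + (xb0 + (xba + xbb))))%E ->
  (x00 + (x0b + x0b) + ((xb0 + (xbb + xbb)) + (xb0 + (xbb + xbb))) <=
   x00 + (x0a + x0b) + ((xa0 + (xaa + xab)) + (xb0 + (xba + xbb))))%E ->
  (xaa + xbb <= xab + xba)%E.
Proof.
do 9 (move=> /fineK <-); rewrite -!EFinD !lee_fin; lra.
Qed.

Section minimal_sets.
Variables (R : realType) (N : nat).
Local Notation T := 'rV[R]_N.
Local Notation mu := (@borel_lebesgue_measure R N).
Local Notation shift v := (fun x : T => x + v)%R.
Variables (K : T -> \bar R) (m : R).
Hypothesis hK : kernel_function K.
Hypothesis m0 : 0 < m.
Local Open Scope ereal_scope.

Lemma singular_minimiser_packs (V : 'M[R]_N) f : admissible m V f ->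
  (forall A, measurable A -> 0 < mu A -> interaction K (\1_A) (\1_A) = +oo) ->
  perimeter K f < +oo -> packs V [set x | 0 < f x]%R.
Proof.
move=> [dV fD] Kdiv pf; have V0 : \det V != 0%R by rewrite -normr_eq0 dV gt_eqF.
apply: contrapT => /(overlap_witness V0 (relaxed_domain_packing fD))[c [e [A [c0 e0 mA A0 HA]]]].
have [mf f01 _] := fD; have [wf wf'] := weight_compl mf f01.
have wA := weight_indic mA.
have wa : weight (fun x => e * \1_A x)%R by apply: weightM => //; apply: weight_cst; exact: ltW.
move: pf; rewrite ltNge => /negP; apply.
apply: (@le_trans _ _ (interaction K (fun x => e * \1_A x)%R (fun x => e * \1_A x)%R)).
  rewrite (interactionZl (ltW e0) hK wA wa) (interactionZr (ltW e0) hK wA wA) Kdiv//.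
  by rewrite gt0_muley ?lte_fin// gt0_muley ?lte_fin.
apply: (@le_trans _ _ (interaction K (fun x => e * \1_A x)%R (fun x => 1 - f x)%R)).
  apply: (le_interactionr hK wa wa wf'); apply: aeW => x; rewrite indicE.
  have [/set_mem/HA[/andP[_ h] _]|_] := boolP (x \in A); last by rewrite mulr0; case: wf'.
  by rewrite mulr1; lra.
apply: (le_interactionl hK wa wf wf'); apply: aeW => x; rewrite indicE.
have [/set_mem/HA[/andP[h _] _]|_] := boolP (x \in A); last by rewrite mulr0; case: wf.
by rewrite mulr1.
Qed.

Lemma le_interaction_on (k k' : T -> \bar R) (A : set T) : kernel_function k -> kernel_function k' ->
  measurable A -> (forall x y, A x -> A y -> k (x - y)%R <= k' (x - y)%R) ->
  interaction k (\1_A) (\1_A) <= interaction k' (\1_A) (\1_A).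
Proof.
move=> hk hk' mA H; have wA := weight_indic mA; apply: ge0_le_integral => //.
- by move=> y _; rewrite mule_ge0 ?lee_fin//; exact: potential_ge0.
- by apply: measurable_weightM => //; exact: measurable_potential.
- by apply: measurable_weightM => //; exact: measurable_potential.
move=> y _; rewrite indicE; have [/set_mem Ay|_] := boolP (y \in A); last by rewrite !mul0e.
rewrite !mul1e; apply: ge0_le_integral => //.
- by move=> x _; rewrite mule_ge0 ?lee_fin//; case: hk.
- by apply: measurable_weightM => //; exact: measurable_kernel_shift.
- by apply: measurable_weightM => //; exact: measurable_kernel_shift.
move=> x _; rewrite indicE; have [/set_mem Ax|_] := boolP (x \in A); last by rewrite !mul0e.
by rewrite !mul1e; exact: H.
Qed.

Lemma interaction_null_kernel (k : T -> \bar R) (Z A : set T) : kernel_function k ->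
  measurable Z -> mu Z = 0 -> (forall z, ~ Z z -> k z = 0) -> measurable A ->
  interaction k (\1_A) (\1_A) = 0.
Proof.
move=> hk mZ Z0 kZ mA; have wA := weight_indic mA; apply: integral0_eq => y _.
rewrite (_ : \int[mu]_x _ = 0) ?mule0//.
have mZy : measurable (shift (- y)%R @^-1` Z) by exact: measurable_shift.
have mF : measurable_fun setT (fun x => (\1_A x)%:E * k (x - y)%R).
  by apply: measurable_weightM => //; exact: measurable_kernel_shift.
rewrite -(null_set_integral (mu := mu) mZy (measurable_funTS mF)); last first.
  by rewrite -[LHS]/(mu _) borel_lebesgue_translate.
rewrite [RHS]integral_indicE; apply: eq_integral => x _; rewrite !indicE.
have [_|/negP xZ] := boolP (x \in (shift (- y)%R @^-1` Z)); first by rewrite mul1e.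
by rewrite kZ ?mule0// => Zx; apply: xZ; rewrite inE.
Qed.

Lemma translated_kernel v : kernel_function (fun z => K (z + v)%R).
Proof.
have [mK K0] := hK; split => //; apply: (measurableT_comp mK); exact: measurable_addr_rV.
Qed.

Lemma interaction_translater (u v : T -> R) w : weight u -> weight v ->
  interaction K u (fun x => v (x - w)%R) = interaction (fun z => K (z + w)%R) u v.
Proof.
move=> wu wv; have ws := weight_shift (- w)%R wv; have [_ v0] := ws.
apply: eq_integral => y _; congr (_ * _); rewrite -(integral_translate w).
- by apply: eq_integral => x _; rewrite addrK addrAC.
- exact: (measurable_weightM ws (measurable_kernel_shift y hK)).
- by move=> x; rewrite mule_ge0 ?lee_fin//; case: hK.
Qed.

Lemma interaction_translatel (u v : T -> R) w : weight u -> weight v ->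
  interaction K (fun x => u (x - w)%R) v = interaction (fun z => K (z - w)%R) u v.
Proof.
move=> wu wv; have ws := weight_shift (- w)%R wu; have [_ u0] := ws.
rewrite interactionE -(integral_translate w).
- apply: eq_integral => y _; rewrite addrK; congr (_ * _).
  by apply: eq_integral => x _; rewrite opprD addrA.
- exact: (measurable_weightM ws (measurable_potential hK wv)).
- by move=> y; rewrite mule_ge0 ?lee_fin//; exact: potential_ge0.
Qed.

(* If [f] overlaps its translate by [w] on [A], moving the mass [e] of [f] from [A + w] to
   [A], or the other way round, keeps [f] admissible; add the two minimality inequalities. *)
Lemma exchange_inequality (V : 'M[R]_N) f (A : set T) (e : R) c : admissible m V f ->
  (forall W g, admissible m W g -> perimeter K f <= perimeter K g) ->
  \int[mu]_x K x < +oo -> (0 < e)%R -> measurable A -> mu A < +oo ->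
  (forall x, A x -> (e <= f x <= 1 - e)%R /\ (e <= f (x + lattice_point V c) <= 1 - e)%R) ->
  (forall x, A x -> ~ A (x - lattice_point V c)%R) ->
  interaction K (\1_A) (\1_A) + interaction K (\1_A) (\1_A) <=
  interaction (fun z => K (z + lattice_point V c)%R) (\1_A) (\1_A) +
  interaction (fun z => K (z - lattice_point V c)%R) (\1_A) (\1_A).
Proof.
move=> af minf Koo e0 mA Aoo HA disj; have [dV fD] := af.
have V0 : \det V != 0%R by rewrite -normr_eq0 dV gt_eqF.
set w := lattice_point V c in HA disj *; have [mf f01 _] := fD.
have [wf wf'] := weight_compl mf f01; have wA := weight_indic mA.
pose a x := (e * \1_A x)%R; have wa : weight a by apply: weightM => //; apply: weight_cst; exact: ltW.
pose b x := a (x - w)%R; have wb : weight b by exact: weight_shift.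
(* [A] and its translate are disjoint, so at most one of [a], [b] is nonzero at [x], and there [f]
   stays between [e] and [1 - e]. *)
have cases x : [/\ (a x = 0)%R, (b x = 0)%R & (0 <= f x <= 1)%R] \/
    [/\ (a x = e)%R, (b x = 0)%R & (e <= f x <= 1 - e)%R] \/
    [/\ (a x = 0)%R, (b x = e)%R & (e <= f x <= 1 - e)%R].
  rewrite /b /a !indicE; have [Ax|nAx] := pselect (A x).
    right; left; rewrite (mem_set Ax) (memNset (disj _ Ax)) mulr1 mulr0; split => //.
    by case: (HA x Ax).
  have [Aw|nAw] := pselect (A (x - w)%R); [right; right|left].
    rewrite (memNset nAx) (mem_set Aw) mulr1 mulr0; split => //.
    by have [_] := HA _ Aw; rewrite subrK.
  by rewrite (memNset nAx) (memNset nAw) mulr0; split.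
(* The part left fixed: [f] is [f0 + a + b], and the two exchanges produce [f0 + 2a] and
   [f0 + 2b]. *)
pose f0 x := (f x - a x - b x)%R.
have wf0 : weight f0.
  split; first by apply: measurable_funB; [apply: measurable_funB; case: wa|case: wb].
  move=> x; rewrite /f0; case: (cases x) => [|[]] [-> -> /andP[h _]]; lra.
have fE x : (f x = f0 x + (a x + b x))%R by rewrite /f0; lra.
have ap : admissible m V (fun x => f x + e * \1_A x - e * \1_A (x - w))%R.
  split => //; apply: exchange_domain => //; first exact: ltW.
  move=> x; rewrite -[(e * \1_A x)%R]/(a x) -[(e * \1_A (x - w))%R]/(b x).
  by case: (cases x) => [|[]] [-> -> /andP[h h']]; apply/andP; split; lra.
have mAw : measurable (shift (- w)%R @^-1` A) by exact: measurable_shift.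
(* The reverse exchange is the same construction for the translated set and the vector [- c]. *)
have am : admissible m V (fun x => f x + e * \1_(shift (- w)%R @^-1` A) x -
    e * \1_(shift (- w)%R @^-1` A) (x - lattice_point V (- c)))%R.
  have E1 x : (e * \1_(shift (- w)%R @^-1` A) x = b x)%R.
    by rewrite /b /a !indicE; congr (_ * (_ : bool)%:R)%R; apply/idP/idP; rewrite !inE.
  split => //; apply: exchange_domain => //; last 2 first.
  - exact: ltW.
  - move=> x; rewrite E1 E1 /b lattice_pointN opprK -/w addrK.
    by case: (cases x) => [|[]] [-> ]; rewrite /b => -> /andP[h h']; apply/andP; split; lra.
  - by rewrite -[ltLHS]/(mu _) borel_lebesgue_translate.
have Jfin u v : weight u -> weight v -> (forall x, v x <= 1)%R -> \int[mu]_x (u x)%:E < +oo ->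
    interaction K u v \is a fin_num.
  move=> wu wv v1 uoo; rewrite ge0_fin_numE; last exact: interaction_ge0.
  have w1 : weight (cst 1%R : T -> R) by exact: weight_cst.
  apply: (@le_lt_trans _ _ (interaction K u (cst 1%R))).
    by apply: (le_interactionr hK wu wv w1); exact: aeW.
  rewrite (interaction_cst1 hK wu) lte_mul_pinfty//.
    by apply: integral_ge0 => x _; rewrite lee_fin; case: wu.
  rewrite ge0_fin_numE//; apply: integral_ge0 => x _; rewrite lee_fin; by case: wu.
have mfin : m%:E * \int[mu]_x K x \is a fin_num.
  rewrite fin_numM// ge0_fin_numE//; apply: integral_ge0 => x _; by case: hK.
(* Energy and perimeter of an admissible function have the fixed finite sum [m] times the integral
   of [K], so minimal perimeter means maximal energy. *)
have Jle g W : admissible m W g -> interaction K g g <= interaction K f f.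
  move=> ag; have [_ [mg g01 _]] := ag; have [wg wg'] := weight_compl mg g01.
  have := interaction_complement hK mg g01; rewrite (admissible_mass m0 ag).
  have := interaction_complement hK mf f01; rewrite (admissible_mass m0 af) => <- E.
  have E' : interaction K g g + perimeter K g = interaction K f f + perimeter K f := E.
  have pg : perimeter K g \is a fin_num.
    apply: (Jfin _ _ wg wg'); first by move=> x; rewrite gerBl; case: wg.
    by rewrite (admissible_mass m0 ag) ltry.
  move: E' pg (minf W g ag); clear.
  move: (perimeter K f) (perimeter K g) (interaction K g g) (interaction K f f) => p q u v uv qfin pq.
  by rewrite -(leeD2rE _ _ qfin) uv leeD2l.
have small u : weight u -> (forall x, u x <= f x)%R -> \int[mu]_x (u x)%:E < +oo /\ (forall x, u x <= 1)%R.
  move=> wu uf; split; last by move=> x; apply: le_trans (uf x) _; have /andP[] := f01 x.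
  apply: (@le_lt_trans _ _ (\int[mu]_x (f x)%:E)); last by rewrite (admissible_mass m0 af) ltry.
  apply: ge0_le_integral => //.
  - by move=> x _; rewrite lee_fin; case: wu.
  - exact: measurable_EFin_weight.
  - exact: measurable_EFin_weight.
  - by move=> x _; rewrite lee_fin.
have [f0oo f01'] : \int[mu]_x (f0 x)%:E < +oo /\ (forall x, f0 x <= 1)%R.
  apply: small => // x; rewrite /f0; have [_ /(_ x) h1] := wa; have [_ /(_ x) h2] := wb; lra.
have [aoo a1] : \int[mu]_x (a x)%:E < +oo /\ (forall x, a x <= 1)%R.
  by apply: small => // x; case: (cases x) => [|[]] [-> _ /andP[h1 h2]]; lra.
have [boo b1] : \int[mu]_x (b x)%:E < +oo /\ (forall x, b x <= 1)%R.
  by apply: small => // x; case: (cases x) => [|[]] [_ -> /andP[h1 h2]]; lra.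
have expand u v : weight u -> weight v -> interaction K (fun x => f0 x + (u x + v x))%R (fun x => f0 x + (u x + v x))%R =
    interaction K f0 f0 + (interaction K f0 u + interaction K f0 v) +
    ((interaction K u f0 + (interaction K u u + interaction K u v)) +
     (interaction K v f0 + (interaction K v u + interaction K v v))).
  move=> wu wv; have wuv := weightD wu wv; have wfuv := weightD wf0 wuv.
  rewrite (interactionDl hK wf0 wuv wfuv) (interactionDl hK wu wv wfuv).
  by rewrite !(interactionDr hK _ wf0 wuv)// !(interactionDr hK _ wu wv).
have Jp := Jle _ _ ap; have Jm := Jle _ _ am.
rewrite (@eq_interaction _ _ K _ (fun x => f0 x + (a x + a x))%R _ (fun x => f0 x + (a x + a x))%R) in Jp; last 2 first.
- by move=> x; rewrite -[(e * \1_A x)%R]/(a x) -[(e * \1_A (x - w))%R]/(b x) /f0; lra.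
- by move=> x; rewrite -[(e * \1_A x)%R]/(a x) -[(e * \1_A (x - w))%R]/(b x) /f0; lra.
have Em x : (f x + e * \1_(shift (- w)%R @^-1` A) x -
    e * \1_(shift (- w)%R @^-1` A) (x - lattice_point V (- c)) = f0 x + (b x + b x))%R.
  have E1 z : (e * \1_(shift (- w)%R @^-1` A) z = b z)%R.
    by rewrite /b /a !indicE; congr (_ * (_ : bool)%:R)%R; apply/idP/idP; rewrite !inE.
  by rewrite !E1 {2}/b lattice_pointN opprK addrK /f0; lra.
rewrite (eq_interaction K Em Em) in Jm.
rewrite (eq_interaction K fE fE) (expand a b wa wb) in Jp Jm.
rewrite (expand a a wa wa) in Jp; rewrite (expand b b wb wb) in Jm.
have key : interaction K a a + interaction K b b <= interaction K a b + interaction K b a.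
  exact: (@cancel_cross_terms R _ _ _ _ _ _ _ _ _ (Jfin f0 f0 wf0 wf0 f01' f0oo)
    (Jfin f0 a wf0 wa a1 f0oo) (Jfin f0 b wf0 wb b1 f0oo) (Jfin a f0 wa wf0 f01' aoo)
    (Jfin b f0 wb wf0 f01' boo) (Jfin a a wa wa a1 aoo) (Jfin a b wa wb b1 aoo)
    (Jfin b a wb wa a1 boo) (Jfin b b wb wb b1 boo) Jp Jm).
clear Jp Jm; move: key; have -> : interaction K b b = interaction K a a by exact: interaction_shift.
have abE : interaction K a b = interaction (fun z => K (z + w)%R) a a := interaction_translater w wa wa.
have baE : interaction K b a = interaction (fun z => K (z - w)%R) a a := interaction_translatel w wa wa.
rewrite abE baE.
have hp := translated_kernel w; have hm := translated_kernel (- w)%R.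
have e20 : (0 < e * e)%R by rewrite mulr_gt0.
have scale k : kernel_function k -> interaction k a a = (e * e)%:E * interaction k (\1_A) (\1_A).
  move=> hk; rewrite (interactionZl (ltW e0) hk wA wa) (interactionZr (ltW e0) hk wA wA).
  by rewrite muleA.
rewrite (scale _ hK) (scale _ hp) (scale _ hm).
have := interaction_ge0 hK wA wA; have := interaction_ge0 hp wA wA.
have := interaction_ge0 hm wA wA; clear -e20.
move: (interaction _ _ _) (interaction _ _ _) (interaction _ _ _) => p q r p0 q0 r0.
by rewrite -!ge0_muleDr// lee_pmul2l// lte_fin.
Qed.

End minimal_sets.

Lemma squeeze_to0 (R : realType) (x y z : \bar R) : (0 <= x)%E -> (0 <= y)%E ->
  z \is a fin_num -> (x + y <= z)%E -> (z <= x)%E -> y = 0%E.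
Proof.
move=> x0 y0 zfin xyz zx; have xfin : x \is a fin_num.
  rewrite ge0_fin_numE//; apply: (@le_lt_trans _ _ z); last by rewrite ltey_eq zfin.
  by apply: le_trans xyz; rewrite leeDl.
apply/eqP; rewrite eq_le y0 andbT -(leeD2lE _ _ xfin) adde0; exact: le_trans zx.
Qed.

Lemma lt_summand (R : realType) (x y z : \bar R) : (0 < x)%E -> (0 <= y)%E ->
  (x + y = z)%E -> (z < +oo)%E -> (y < z /\ y < +oo)%E.
Proof.
move=> x0 y0 xyz zoo; have yoo : (y < +oo)%E.
  by apply: le_lt_trans zoo; rewrite -xyz leeDr// ltW.
by split => //; rewrite -xyz lteDr// ge0_fin_numE.
Qed.

Section integrable_kernels.
Variables (R : realType) (N : nat).
Local Notation T := 'rV[R]_N.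
Local Notation mu := (@borel_lebesgue_measure R N).
Variables (K : T -> \bar R) (m : R).
Hypothesis hK : kernel_function K.
Hypothesis m0 : 0 < m.
Local Open Scope ereal_scope.

(** What the liminf condition leaves for a Borel representative: near the origin, strict inequality
    off a null set that may depend on [w]. *)
Definition strict_peak := forall w : T, w != 0%R -> exists r : R, exists Z : set T,
  [/\ (0 < r)%R, measurable Z, mu Z = 0 &
    forall z, cube r z -> ~ Z z -> K (z + w)%R < K z].

(** On a small set only differences near the origin occur. There both translates of the kernel lie
    strictly below it, against the inequality obtained from the exchanges. *)
Lemma integrable_minimiser_packs (V : 'M[R]_N) f : admissible m V f ->
  (forall W g, admissible m W g -> perimeter K f <= perimeter K g) ->
  \int[mu]_x K x < +oo -> strict_peak -> packs V [set x | 0 < f x]%R.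
Proof.
move=> af minf Koo peak; have [dV fD] := af; have [mK K0] := hK.
have V0 : \det V != 0%R by rewrite -normr_eq0 dV gt_eqF.
apply: contrapT => /(overlap_witness V0 (relaxed_domain_packing fD))[c [e [A [c0 e0 mA A0 HA]]]].
pose w := lattice_point V c.
have w0 : w != 0%R.
  apply: contra c0 => /eqP E; apply/eqP/(lattice_point_inj V0); by rewrite lattice_point0.
have wn0 : (- w)%R != 0%R by rewrite oppr_eq0.
have [r1 [Z1 [r10 mZ1 Z10 H1]]] := peak w w0.
have [r2 [Z2 [r20 mZ2 Z20 H2]]] := peak (- w)%R wn0.
(* Besides the two peak radii, [|w| / 2] keeps a set of diameter [r] disjoint from its translate by
   [w]. *)
pose r := Num.min (Num.min r1 r2) (`|w| / 2)%R.
have r0 : (0 < r)%R by rewrite !lt_min r10 r20 divr_gt0// normr_gt0.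
have [B [mB BA B0 Bd]] := small_part mA A0 r0.
have [y0 By0] : B !=set0 by apply/set0P/negP => /eqP E; move: B0; rewrite E measure0 ltxx.
have Boo : mu B < +oo.
  have Brho : B `<=` cube (`|y0| + r).
    move=> x Bx; rewrite /cube/= -(subrK y0 x) addrC (le_trans (ler_normD _ _))//.
    by rewrite lerD2l; exact: Bd.
  by rewrite -ge0_fin_numE//; exact: bounded_measure_fin Brho.
have disj x : B x -> ~ B (x - w)%R.
  move=> Bx Bw; have := Bd _ _ Bx Bw; rewrite opprB addrC subrK leNgt => /negP; apply.
  apply: (@le_lt_trans _ _ (`|w| / 2)%R); first by rewrite ge_min lexx orbT.
  by rewrite ltr_pdivrMr// ltr_pMr ?normr_gt0// ltr1n.
have HB x : B x -> (e <= f x <= 1 - e)%R /\ (e <= f (x + w) <= 1 - e)%R by move=> /BA /HA.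
have exch := exchange_inequality hK m0 af minf Koo e0 mB Boo HB disj.
have hp := translated_kernel hK w; have hm := translated_kernel hK (- w)%R.
pose Kp z := K (z + w)%R; pose Km z := K (z - w)%R.
(* Off a null set this is the whole cube; on [E] both translated kernels are finite, so the
   difference [G] below is meaningful. [F2] absorbs the null set, where the representative may be
   infinite. *)
pose E := (cube r `&` [set z | Kp z < K z]) `&` [set z | Km z < K z].
have mE : measurable E.
  have mlt (F : T -> \bar R) : measurable_fun setT F -> measurable [set z | F z < K z].
    by move=> mF; have := emeasurable_fun_lt measurableT mF mK; rewrite setTI.
  apply: measurableI; [apply: measurableI; first exact: measurable_cube|].
    by apply: mlt; case: hp.
  by apply: mlt; case: hm.
pose Z := Z1 `|` Z2; have mZ : measurable Z by exact: measurableU.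
have Z0 : mu Z = 0 by rewrite measureU0.
have EZ z : cube r z -> ~ Z z -> E z.
  move=> zr nZ; split; [split => //; apply: H1|apply: H2].
  - by apply: cubeS zr; rewrite !ge_min lexx.
  - by move=> Zz; apply: nZ; left.
  - by apply: cubeS zr; rewrite !ge_min lexx orbT.
  - by move=> Zz; apply: nZ; right.
have mKp : measurable_fun setT Kp by case: hp.
have mKm : measurable_fun setT Km by case: hm.
have Kp0 z : 0 <= Kp z by exact: K0.
have Km0 z : 0 <= Km z by exact: K0.
have mKpm : measurable_fun setT (fun z => Kp z + Km z) by exact: emeasurable_funD.
have mKK : measurable_fun setT (fun z => K z + K z) by exact: emeasurable_funD.
pose F1 z := (\1_E z)%:E * (Kp z + Km z).
pose F2 z := (\1_Z z)%:E * (Kp z + Km z).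
pose G z := (\1_E z)%:E * ((K z + K z) - (Kp z + Km z)).
have Elt z : E z -> Kp z + Km z < K z + K z /\ Kp z + Km z \is a fin_num.
  move=> [[_ h1] h2]; have f1 : Kp z \is a fin_num.
    by rewrite ge0_fin_numE//; apply: (lt_le_trans h1); exact: leey.
  have f2 : Km z \is a fin_num.
    by rewrite ge0_fin_numE//; apply: (lt_le_trans h2); exact: leey.
  by split; [exact: lteD|rewrite fin_numD f1].
have hF1 : kernel_function F1.
  by split; [exact: measurable_indicM|move=> z; rewrite mule_ge0 ?lee_fin// adde_ge0].
have hF2 : kernel_function F2.
  by split; [exact: measurable_indicM|move=> z; rewrite mule_ge0 ?lee_fin// adde_ge0].
have hG : kernel_function G.
  split; first by apply: measurable_indicM => //; exact: emeasurable_funB.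
  move=> z; rewrite /G indicE; have [/set_mem/Elt[h1 h2]|_] := boolP (z \in E); last by rewrite mul0e.
  by rewrite mul1e sube_ge0 ?h2// ltW.
have hKpm : kernel_function (fun z => Kp z + Km z) by split => // z; rewrite adde_ge0.
have hKK : kernel_function (fun z => K z + K z) by split => // z; rewrite adde_ge0.
have wB := weight_indic mB.
have I1 : interaction (fun z => K z + K z) (\1_B) (\1_B) <= interaction F1 (\1_B) (\1_B).
  rewrite (interactionDk hK hK wB wB); apply: (le_trans exch).
  rewrite -(interactionDk hp hm wB wB).
  have -> : interaction F1 (\1_B) (\1_B) = interaction (fun z => F1 z + F2 z) (\1_B) (\1_B).
    rewrite (interactionDk hF1 hF2 wB wB) (interaction_null_kernel hF2 mZ Z0 _ mB) ?adde0//.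
    by move=> z nZ; rewrite /F2 indicE memNset// mul0e.
  apply: le_interaction_on => //.
    by split; [apply: emeasurable_funD; [case: hF1|case: hF2]|move=> z; rewrite adde_ge0//; [case: hF1|case: hF2]].
  move=> x y Bx By; have F10 := hF1.2 (x - y)%R; have F20 := hF2.2 (x - y)%R.
  have [Zz|nZ] := pselect (Z (x - y)%R).
    by apply: (@le_trans _ _ (F2 (x - y)%R)); [rewrite /F2 indicE mem_set// mul1e|rewrite leeDr].
  apply: (@le_trans _ _ (F1 (x - y)%R)); last by rewrite leeDl.
  by rewrite /F1 indicE mem_set ?mul1e//; apply: EZ => //; exact: Bd.
have I2 : interaction F1 (\1_B) (\1_B) + interaction G (\1_B) (\1_B) <=
    interaction (fun z => K z + K z) (\1_B) (\1_B).
  rewrite -(interactionDk hF1 hG wB wB); apply: le_interactionk => //.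
    by split; [apply: emeasurable_funD; [case: hF1|case: hG]|move=> z; rewrite adde_ge0//; [case: hF1|case: hG]].
  move=> z; rewrite /F1 /G indicE; have [/set_mem/Elt[h1 h2]|_] := boolP (z \in E).
    by rewrite !mul1e addeC subeK.
  by rewrite !mul0e adde0 adde_ge0.
have Jfin : interaction K (\1_B) (\1_B) \is a fin_num.
  rewrite ge0_fin_numE; last exact: interaction_ge0.
  have w1 : weight (cst 1%R : T -> R) by exact: weight_cst.
  apply: (@le_lt_trans _ _ (interaction K (\1_B) (cst 1%R))).
    apply: (le_interactionr hK wB wB w1); apply: aeW => x /=.
    by rewrite indicE; case: (_ \in _).
  rewrite (interaction_cst1 hK wB) integral_indic// setIT lte_mul_pinfty//.
  by rewrite ge0_fin_numE.
have KKfin : interaction (fun z => K z + K z) (\1_B) (\1_B) \is a fin_num.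
  by rewrite (interactionDk hK hK wB wB) fin_numD Jfin.
have G0 : interaction G (\1_B) (\1_B) = 0.
  exact: (squeeze_to0 (interaction_ge0 hF1 wB wB) (interaction_ge0 hG wB wB) KKfin I2 I1).
move: B0; rewrite (interaction_eq0_null hG mZ Z0 mB _ G0) ?ltxx// => x y Bx By nZ.
have Exy : E (x - y)%R by apply: EZ => //; exact: Bd.
by rewrite /G indicE mem_set// mul1e; have [h1 h2] := Elt _ Exy; rewrite sube_gt0.
Qed.

(** A strict peak dominates a nonnegative value, so the kernel is positive almost everywhere near
    the origin. This provides the competitor with strictly smaller perimeter. *)
Lemma peak_interaction_gt0 (A : set T) : (0 < N)%N -> strict_peak -> measurable A -> 0 < mu A ->
  0 < interaction K (\1_A) (\1_A).
Proof.
move=> N0 peak mA A0; have wA := weight_indic mA.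
have w0 : (const_mx 1%R : T) != 0%R.
  by apply/eqP => /rowP/(_ (Ordinal N0)); rewrite !mxE => /eqP; rewrite oner_eq0.
have [r [Z [r0 mZ Z0 HZ]]] := peak _ w0.
rewrite lt_neqAle interaction_ge0// andbT eq_sym; apply/negP => /eqP I0.
have [B [mB BA B0 Bd]] := small_part mA A0 r0; have wB := weight_indic mB.
have AB : {ae mu, forall x, (\1_B x <= \1_A x :> R)%R}.
  apply: aeW => x; rewrite !indicE; have [/set_mem Bx|//] := boolP (x \in B).
  by rewrite mem_set//; exact: BA.
have IB : interaction K (\1_B) (\1_B) = 0.
  apply/eqP; rewrite eq_le interaction_ge0// andbT -I0.
  by apply: (@le_trans _ _ (interaction K (\1_A) (\1_B))); [exact: le_interactionl|exact: le_interactionr].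
move: B0; rewrite (interaction_eq0_null hK mZ Z0 mB _ IB) ?ltxx// => x y Bx By nZ.
apply: le_lt_trans (HZ _ (Bd _ _ Bx By) nZ); by case: hK.
Qed.

End integrable_kernels.

Section borel_minimisers.
Variables (R : realType) (N : nat).
Hypothesis N0 : (0 < N)%N.
Local Notation T := 'rV[R]_N.
Local Notation mu := (@borel_lebesgue_measure R N).
Variables (K : T -> \bar R) (m : R).
Hypothesis hK : kernel_function K.
Hypothesis m0 : 0 < m.
Local Open Scope ereal_scope.

Lemma perimeter_indic (B : set T) : measurable B ->
  perimeter K (\1_B) = interaction K (\1_B) (\1_(~` B)).
Proof.
move=> mB; apply: eq_interaction => // x; rewrite !indicE in_setC.
by case: (x \in B); rewrite ?subrr ?subr0.
Qed.

Definition singular := forall A, measurable A -> 0 < mu A -> interaction K (\1_A) (\1_A) = +oo.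

Lemma cell_domain (V : 'M[R]_N) : \det V != 0%R ->
  [/\ packs V (cell V), mu (~` saturation V (cell V)) = 0 & relaxed_domain V (\1_(cell V))].
Proof.
move=> V0; have mc := measurable_cell V.
have pc : packs V (cell V).
  move=> c c0; rewrite (_ : _ `&` _ = set0) ?measure0//; apply/seteqP; split => // x [x1 /= x2].
  have h1 : 0%R = cell_index V x by apply/(cellP V0); rewrite lattice_point0 subr0.
  have h2 : (- c)%R = cell_index V x by apply/(cellP V0); rewrite lattice_pointN opprK.
  by move/eqP: c0; apply; apply/eqP; rewrite -oppr_eq0 h2 -h1.
have sc : mu (~` saturation V (cell V)) = 0.
  rewrite (_ : saturation V (cell V) = setT) ?setCT ?measure0//; apply/seteqP; split => // x _.
  exists (- cell_index V x)%R => //=; rewrite lattice_pointN; exact/(cellP V0).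
by split => //; exact: relaxed_domain_indic.
Qed.

Lemma matrix_of_det : exists V : 'M[R]_N, `|\det V|%R = m.
Proof.
exists (diag_mx (\row_j if j == Ordinal N0 then m else 1%R)).
rewrite det_diag (bigD1 (Ordinal N0))//= !mxE eqxx big1 ?mulr1 ?gtr0_norm// => j /negPf ji.
by rewrite !mxE ji.
Qed.

Theorem borel_minimiser : singular \/ (\int[mu]_x K x < +oo /\ strict_peak K) ->
  exists V D, [/\ `|\det V|%R = m, measurable D, packs V D, mu (~` saturation V D) = 0 &
    forall W g, admissible m W g -> interaction K (\1_D) (\1_(~` D)) <= perimeter K g].
Proof.
move=> HK; have [V1 dV1] := matrix_of_det.
have V10 : \det V1 != 0%R by rewrite -normr_eq0 dV1 gt_eqF.
have [pc sc Dc] := cell_domain V10; have mc := measurable_cell V1.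
(* If no admissible function has finite perimeter, every domain is minimal and a cell will do. *)
have [[V2 [f2 [af2 pf2]]]|noone] := pselect (exists V f, admissible m V f /\ perimeter K f < +oo); last first.
  exists V1, (cell V1); split; [exact: dV1|exact: mc|exact: pc|exact: sc|move=> W g ag].
  suff -> : perimeter K g = +oo by exact: leey.
  apply/eqP; rewrite -leye_eq leNgt; apply/negP => pg; apply: noone.
  by exists W, g.
have [V3 [f3 [af3 pf3 pf3oo]]] : exists V f, [/\ admissible m V f,
    perimeter K f < m%:E * \int[mu]_x K x & perimeter K f < +oo].
  case: HK => [sing|[Koo peak]].
    (* A singular kernel has infinite integral: otherwise the energy of the unit cube would be
       finite. *)
    exists V2, f2; split => //; suff -> : \int[mu]_x K x = +oo.
      by rewrite gt0_muley ?lte_fin.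
    pose Q := @cube R N 1; have mQ : measurable Q by exact: measurable_cube.
    have wQ := weight_indic mQ; have w1 : weight (cst 1%R : T -> R) by exact: weight_cst.
    have IQ : +oo <= mu Q * \int[mu]_x K x.
      rewrite -(sing Q mQ (cube_gt0 N ltr01)).
      have -> : mu Q = \int[mu]_x (\1_Q x)%:E by rewrite integral_indic// setIT.
      rewrite -(interaction_cst1 hK wQ); apply: (le_interactionr hK wQ wQ w1).
      by apply: aeW => x /=; rewrite indicE; case: (_ \in _).
    apply/eqP; rewrite -leye_eq leNgt; apply/negP => Koo; move: IQ; rewrite leNgt => /negP; apply.
    by rewrite lte_mul_pinfty// ?cube_fin_num.
  (* In the integrable case the cell has positive energy, hence perimeter strictly below [m] times
     the integral of [K]. *)
  have ac : admissible m V1 (\1_(cell V1)) by [].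
  have [_ [mi i01 _]] := ac; have [wi wi'] := weight_compl mi i01.
  have comp := interaction_complement hK mi i01; rewrite (admissible_mass m0 ac) in comp.
  have Jc : 0 < interaction K (\1_(cell V1)) (\1_(cell V1)).
    by apply: peak_interaction_gt0 => //; rewrite borel_lebesgue_cell// lte_fin normr_gt0.
  have per0 := perimeter_ge0 hK ac.
  have mKoo : m%:E * \int[mu]_x K x < +oo by rewrite lte_mul_pinfty ?lee_fin ?(ltW m0).
  have [p1 p2] := lt_summand Jc per0 comp mKoo.
  by exists V1, (\1_(cell V1)); split.
have [V [f [af minf]]] := relaxed_minimiser N0 hK m0 af3 pf3.
have [dV fD] := af; have V0 : \det V != 0%R by rewrite -normr_eq0 dV gt_eqF.
pose D := [set x | 0 < f x]%R.
have pD : packs V D.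
  case: HK => [sing|[Koo peak]].
    apply: (singular_minimiser_packs hK m0 af sing).
    exact: le_lt_trans (minf _ _ af3) pf3oo.
  exact: (integrable_minimiser_packs hK m0 af minf Koo peak).
have [satD fE] := relaxed_domain_support V0 fD pD.
have [mf f01 _] := fD; have [wf wf'] := weight_compl mf f01.
have mD : measurable D.
  have := measurable_fun_ltr (measurable_cst (0 : R)%R) mf measurableT (Y := [set true]) I.
  by rewrite setTI.
exists V, D; split; [exact: dV|exact: mD|exact: pD|exact: satD|move=> W g ag].
apply: le_trans (minf W g ag).
have wD := weight_indic mD; have wDC := weight_indic (measurableC mD).
apply: (@le_trans _ _ (interaction K f (\1_(~` D)))).
  apply: (le_interactionl hK wD wf wDC); apply: filterS fE => x /(_ I) ->; exact: lexx.
apply: (le_interactionr hK wf wDC wf'); apply: filterS fE => x /(_ I) ->.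
rewrite !indicE; case: (boolP (x \in D)) => xD; rewrite ?in_setC ?xD ?subrr ?subr0//.
Qed.

End borel_minimisers.

(** * The two kinds of kernels *)

Section kernel_hypotheses.
Variables (R : realType) (N : nat).
Hypothesis N0 : (0 < N)%N.
Local Notation T := 'rV[R]_N.
Local Notation mu := (@borel_lebesgue_measure R N).
Local Notation lam := (@lebesgue_rV R N).
Local Notation shift v := (fun x : T => x + v)%R.
Variables (K : T -> R) (K' : T -> \bar R) (Z : set T).
Hypothesis K0 : forall x, 0 <= K x.
Hypothesis hK' : kernel_function K'.
Hypothesis mZ : measurable Z.
Hypothesis Z0 : mu Z = 0%E.
Hypothesis KK' : forall x, ~ Z x -> K' x = (K x)%:E.

Lemma measurable_origin : measurable [set 0 : T].
Proof.
rewrite (_ : [set 0 : T] = cube 0); first exact: measurable_cube.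
apply/seteqP; split => x; first by move=> ->; rewrite /cube/= normr0.
by rewrite /cube/= normr_le0 => /eqP.
Qed.

(** Arbitrarily thin slabs contain the origin. Both hypotheses on the kernel speak only of nonzero
    points, so the origin has to be discarded. *)
Lemma origin_null : mu [set 0 : T] = 0%E.
Proof.
apply/eqP; rewrite eq_le measure_ge0 andbT; apply/lee_addgt0Pr => e e0; rewrite add0e.
pose c := fine (mu (@cube R N 1)); have cE : mu (cube 1) = c%:E by rewrite fineK// cube_fin_num.
have c0 : 0 <= c by rewrite fine_ge0.
have eta0 : 0 < e / (c + 1) by rewrite divr_gt0// ltr_wpDl.
have [B mB [sB lB]] := slab_small (Ordinal N0) 0 eta0 ltr01.
apply: (@le_trans _ _ (mu B)).
  apply: le_measure; rewrite ?inE//; first exact: measurable_origin.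
  move=> _ ->; apply: sB; split; first by rewrite mxE subr0 normr0 ltW.
  by rewrite normr0.
apply: (le_trans lB); rewrite divr1 cE -EFinM lee_fin -mulrA ler_piMr ?(ltW e0)//.
by rewrite mulrC ler_pdivrMr ?ltr_wpDl// mul1r lerDl.
Qed.

Lemma enorm_le (x : T) : enorm x <= N%:R * `|x|.
Proof.
have Nx : 0 <= N%:R * `|x| by rewrite mulr_ge0.
rewrite -(ger0_norm Nx) -sqrtr_sqr ler_wsqrtr//.
apply: (@le_trans _ _ (\sum_(i < N) `|x| ^+ 2)).
  by apply: ler_sum => i _; rewrite -real_normK ?num_real// lerXn2r ?nnegrE//; exact: entry_le_norm.
have -> : \sum_(i < N) `|x| ^+ 2 = N%:R * `|x| ^+ 2 by rewrite sumr_const card_ord mulr_natl.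
rewrite exprMn; apply: ler_wpM2r; first exact: sqr_ge0.
by rewrite expr2 ler_peMr// ler1n.
Qed.

Lemma enorm_gt0 (x : T) : x != 0 -> 0 < enorm x.
Proof.
move=> x0; rewrite sqrtr_gt0 lt_neqAle sumr_ge0 ?andbT; last by move=> i _; exact: sqr_ge0.
rewrite eq_sym; apply: contra x0 => /eqP/psumr_eq0P H; apply/eqP/rowP => i.
rewrite mxE; apply/eqP; rewrite -sqrf_eq0; apply/eqP; apply: H => // j _; exact: sqr_ge0.
Qed.

(** On [cube eps] the kernel is at least [C (N eps)^(-N-s)] almost everywhere and the volume is of
    order [eps^N], so the integral is at least [q eps^(-s)], which is unbounded. *)
Lemma fractional_divergence (C s d : R) : 0 < C -> 0 < s < 1 ->
  (forall h, h != 0 -> C * enorm h `^ (- N%:R - s) <= K h) -> 0 < d ->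
  (\int[mu]_(z in cube d) K' z = +oo)%E.
Proof.
move=> C0 /andP[s0 _] KC d0; have [mK' K'0] := hK'.
pose c := fine (mu (@cube R N 1)); have cE : mu (cube 1) = c%:E by rewrite fineK// cube_fin_num.
have c0 : 0 < c by rewrite -lte_fin -cE cube_gt0.
pose q := C * (N%:R `^ (N%:R + s))^-1 * c.
have N0' : 0 < N%:R :> R by rewrite ltr0n.
have q0 : 0 < q by rewrite !mulr_gt0// invr_gt0 powR_gt0.
have low eps : 0 < eps -> eps <= d -> ((q * (eps `^ s)^-1)%:E <= \int[mu]_(z in cube d) K' z)%E.
  move=> eps0 epsd.
  have mc : measurable (@cube R N eps) by exact: measurable_cube.
  have mNull : measurable (Z `|` [set 0 : T]) by apply: measurableU => //; exact: measurable_origin.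
  have null0 : mu (Z `|` [set 0 : T]) = 0%E.
    by rewrite measureU0//; [exact: measurable_origin|exact: origin_null].
  pose D := cube eps `\` (Z `|` [set 0 : T]).
  have mD : measurable D by exact: measurableD.
  have muD : (mu (cube eps) <= mu D)%E.
    apply: (@le_trans _ _ (mu (D `|` (Z `|` [set 0 : T])))).
      apply: le_measure; rewrite ?inE//; first exact: measurableU.
      by move=> x xe; have [h|h] := pselect ((Z `|` [set 0 : T]) x); [right|left].
    by apply: eq_lee; apply: measureU0.
  have mueps : mu (cube eps) = (eps ^+ N * c)%:E.
    rewrite EFinM -cE -(borel_lebesgue_dilate eps0 (@measurable_cube R N 1)); congr (mu _).
    apply/seteqP; split => x; rewrite /cube/= normrZ gtr0_norm ?invr_gt0// mulrC ler_pdivrMr// mul1r//.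
  pose t := C * ((N%:R * eps) `^ (N%:R + s))^-1.
  have t0 : 0 < t by apply: mulr_gt0 => //; rewrite invr_gt0; apply: powR_gt0; exact: mulr_gt0.
  apply: (@le_trans _ _ (\int[mu]_(z in D) t%:E)%E).
    rewrite integral_cst//; apply: (@le_trans _ _ (t%:E * mu (cube eps))%E); last first.
      by rewrite lee_wpmul2l// lee_fin ltW.
    rewrite mueps -EFinM lee_fin le_eqVlt; apply/orP; left; apply/eqP.
    rewrite /q /t powRM ?ltW// [eps `^ (_ + _)]powRD; last by rewrite (gt_eqF eps0) implybT.
    rewrite powR_mulrn ?ltW//; field.
    by rewrite !gt_eqF// ?powR_gt0// exprn_gt0.
  apply: (@le_trans _ _ (\int[mu]_(z in D) K' z)%E).
    apply: ge0_le_integral => //.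
    - by move=> x _; rewrite lee_fin ltW.
    - exact: measurable_funTS.
    move=> x [xe /not_orP[nZ x0]]; have {}x0 : x != 0 by apply/eqP.
    rewrite KK'// lee_fin; apply: le_trans (KC x x0); rewrite ler_wpM2l ?(ltW C0)//.
    rewrite -opprD powRN lef_pV2 ?posrE ?powR_gt0 ?mulr_gt0 ?enorm_gt0//.
    apply: ge0_ler_powR; rewrite ?nnegrE ?addr_ge0 ?sqrtr_ge0 ?mulr_ge0 ?(ltW s0) ?(ltW eps0)//.
    by apply: (le_trans (enorm_le x)); rewrite ler_wpM2l.
  apply: ge0_subset_integral => //; first exact: measurable_cube.
    exact: measurable_funTS.
  by move=> x [xe _]; exact: cubeS xe.
apply/eqP; rewrite -leye_eq leNgt; apply/negP => Ioo.
have I0 : (0 <= \int[mu]_(z in cube d) K' z)%E by apply: integral_ge0.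
have Ifin : (\int[mu]_(z in cube d) K' z)%E \is a fin_num by rewrite ge0_fin_numE.
pose I := fine (\int[mu]_(z in cube d) K' z)%E.
have I0' : 0 <= I by exact: fine_ge0.
(* [eps] is chosen with [eps^(-s) = a]: the first term ensures [eps <= d], the second makes the
   lower bound at least [I + 1]. *)
pose a := Num.max (d `^ s)^-1 ((I + 1) / q).
have ds0 : 0 < d `^ s by rewrite powR_gt0.
have a0 : 0 < a by rewrite lt_max invr_gt0 ds0.
pose eps := a^-1 `^ s^-1.
have eps0 : 0 < eps by rewrite powR_gt0// invr_gt0.
have epss : eps `^ s = a^-1 by rewrite -powRrM mulVf ?gt_eqF// powRr1// invr_ge0 ltW.
have epsd : eps <= d.
  rewrite leNgt; apply/negP => /(gt0_ltr_powR s0); rewrite !nnegrE => H.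
  have := H (ltW d0) (ltW eps0); rewrite epss ltNge => /negP; apply.
  by rewrite -[leRHS]invrK lef_pV2 ?posrE ?invr_gt0// le_max lexx.
have := low _ eps0 epsd; rewrite -(fineK Ifin) -/I lee_fin epss invrK leNgt => /negP; apply.
apply: (@lt_le_trans _ _ (I + 1)); first by rewrite ltrDl.
by rewrite mulrC -ler_pdivrMr// le_max lexx orbT.
Qed.

Lemma fractional_singular : fractional_type K -> singular K'.
Proof.
move=> [_ [C [s [C0 s01 KC]]]]; apply: interaction_singular => // d d0.
exact: fractional_divergence KC d0.
Qed.

Lemma integrable_peak : integrable_type K -> (\int[mu]_x K' x < +oo)%E /\ strict_peak K'.
Proof.
move=> [intK _ liminf]; have [mK' K'0] := hK'; split.
  rewrite -ge0_integral_lebesgue_rV//.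
  have /integrableP[mK intKoo] := intK.
  apply: le_lt_trans intKoo.
  rewrite le_eqVlt; apply/orP; left; apply/eqP.
  clear liminf intK.
  apply: (ge0_ae_eq_integral measurableT).
  - exact: measurable_fun_lebesgue.
  - exact: measurableT_comp mK.
  - by move=> x _; exact: K'0.
  - by move=> x _; exact: abse_ge0.
  exists Z; split; first exact: borel_lebesgue_measurable.
    by rewrite -[LHS]/(lam Z) lebesgue_rV_borel.
  move=> x /= /not_implyP[_ H]; apply: contrapT => nZ; apply: H.
  by rewrite KK'//= ger0_norm.
move=> w w0; have := liminf w w0; rewrite limf_einfE => /ereal_sup_gt[_ [S /= S0 <-] infS].
have [e /= e0 He] : exists2 e : R, 0 < e & forall z : T, z != 0 -> cube e z -> S z.
  move: S0; rewrite /dnbhs /within /= => /nbhs_ballP[e /= e0 He].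
  exists (e / 2); first by rewrite divr_gt0.
  move=> z z0 ze; apply: (He z) => //; split=> // i j /=.
  rewrite /ball/= mxE sub0r normrN; apply: (@le_lt_trans _ _ (e / 2)).
    by apply: le_trans ze; exact: entry_le_norm.
  by rewrite ltr_pdivrMr// ltr_pMr// ltr1n.
(* Discarded are the points where the representative may be wrong at [z] or at [z + w], and the
   origin, which a punctured neighbourhood omits. *)
pose Z' : set T := (Z `|` shift w @^-1` Z) `|` [set 0].
have mZw : measurable (shift w @^-1` Z) by exact: measurable_shift.
exists e, Z'; split => //.
- by apply: measurableU; [exact: measurableU|exact: measurable_origin].
- rewrite measureU0//; last 3 first.
  + exact: measurableU.
  + exact: measurable_origin.
  + exact: origin_null.
  by rewrite measureU0// -[LHS]/(mu _) borel_lebesgue_translate.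
move=> z ze /not_orP[/not_orP[nZ nZw] z0]; rewrite !KK'//; rewrite lte_fin -subr_gt0 -lte_fin.
apply: (lt_le_trans infS); apply: ereal_inf_lbound; exists z => //.
by apply: He => //; exact/eqP.
Qed.

End kernel_hypotheses.

Theorem theorem1p2 (R : realType) (N : nat) (hN : (0 < N)%N)
    (K : 'rV[R]_N -> R) (hK : symmetric_kernel K)
    (hK' : fractional_type K \/ integrable_type K) (m : R) (hm : 0 < m) :
  exists G D : set 'rV[R]_N,
    [/\ lattices_of_volume m G, fundamental_domains G D &
      forall G' E : set 'rV[R]_N,
        lattices_of_volume m G' -> fundamental_domains G' E ->
        (nonlocal_perimeter K D <= nonlocal_perimeter K E)%E].
Proof.
have [mK Ksym] := hK; have K0 x : 0 <= K x by case: (Ksym x).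
have [K' [Z [mK' K'0 mZ Z0 KK']]] := borel_representative mK K0.
have kK' : kernel_function K' by [].
have HK : singular K' \/ ((\int[@borel_lebesgue_measure R N]_x K' x < +oo)%E /\ strict_peak K').
  case: hK' => [fr|it]; [left|right].
    exact: (fractional_singular hN kK' mZ Z0 KK' fr).
  exact: (integrable_peak hN K0 kK' mZ Z0 KK' it).
have [V [D [dV mD pD sD minD]]] := borel_minimiser hN kK' hm HK.
have V0 : \det V != 0 by rewrite -normr_eq0 dV gt_eqF.
exists (Zspan_rows V), D; split.
- by split; [exact: lattice_Zspan_rows|rewrite covolume_Zspan_rows].
- exact: relaxed_fundamental_domain.
move=> G E /(lattices_of_volumeP hN hm)[W <- dW] fE.
have W0 : \det W != 0 by rewrite -normr_eq0 dW gt_eqF.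
(* A competitor is replaced by a Borel core: its perimeter is unchanged and its indicator is a
   relaxed domain, to which minimality among relaxed domains applies. *)
have [B [Y [[mB mY Y0] [BE EBY BD]]]] := fundamental_domains_relaxed W0 fE.
rewrite (nonlocal_perimeter_borel K0 mK' K'0 mZ Z0 KK' mB mY Y0 BE EBY).
rewrite (nonlocal_perimeter_borel K0 mK' K'0 mZ Z0 KK' mD measurable0 (measure0 _)); last 2 first.
- by [].
- by move=> x Dx; left.
by rewrite -(perimeter_indic K' mB); apply: (minD W).
Qed.
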